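(* Let $D\subset\mathbb C$ be a bounded convex domain and let $\Phi:\mathbb D\to D$ be a biholomorphic map with $\Phi(0)=0$ and $|\Phi'(0)|=M_D(0)$. Then there exist $\theta\in\mathbb R$, $c>0$ and $a,\lambda\in\mathbb C$ with $|\lambda|<1$ and $|a-\bar a\lambda|<1-|\lambda|^2$ (equivalently, $1+az+\lambda z^2$ has no zeros on $\overline{\mathbb D}$) such that $F:=e^{i\theta}\Phi$ satisfies $F(0)=0$ and \[ F'(z)=\frac{c}{1+az+\lambda z^2},\qquad z\in\mathbb D. \]
   Context: $\mathbb D=\{z\in\mathbb C:|z|<1\}$. For a domain $D\subset\mathbb C$ and $p\in D$, $M_D(p)$ denotes the supremum of the operator norms $\|df_0\|$ over all harmonic maps $f:\mathbb D\to D$ with $f(0)=p$ whose differential $df_0:\mathbb R^2\to\mathbb R^2$ at $0$ is conformal (i.e. a nonnegative multiple of an orthogonal linear map, orientation preserving or reversing). *)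

(* Defs.v *)
From Stdlib Require Import Reals.
From Coquelicot Require Import Coquelicot.
Open Scope R_scope.

Definition unit_disk (z : C) : Prop := Cmod z < 1.

Definition connected_set (U : C -> Prop) : Prop :=
  forall A B : C -> Prop, open A -> open B ->
    (forall z, U z -> A z \/ B z) ->
    (exists z, U z /\ A z) -> (exists z, U z /\ B z) ->
    exists z, U z /\ A z /\ B z.

Definition is_domain (U : C -> Prop) : Prop :=
  (exists z, U z) /\ open U /\ connected_set U.

Definition bounded_set (U : C -> Prop) : Prop :=
  exists M : R, forall z, U z -> Cmod z <= M.

Definition convex_set (U : C -> Prop) : Prop :=
  forall z w : C, U z -> U w -> forall t : R, 0 <= t <= 1 ->
    U (Cplus (Cmult (RtoC (1 - t)) z) (Cmult (RtoC t) w)).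

Definition holomorphic_on (U : C -> Prop) (f : C -> C) : Prop :=
  forall z, U z -> exists l : C, is_derive (K := C_AbsRing) (V := C_NormedModule) f z l.

Definition biholomorphic (U V : C -> Prop) (f : C -> C) : Prop :=
  holomorphic_on U f /\ (forall z, U z -> V (f z)) /\
  exists g : C -> C, holomorphic_on V g /\ (forall w, V w -> U (g w)) /\
    (forall z, U z -> g (f z) = z) /\ (forall w, V w -> f (g w) = w).

Definition dx (u : C -> R) (p : C) : R := Derive (fun t => u (t, snd p)) (fst p).
Definition dy (u : C -> R) (p : C) : R := Derive (fun t => u (fst p, t)) (snd p).
Definition ex_dx (u : C -> R) (p : C) : Prop := ex_derive (fun t => u (t, snd p)) (fst p).
Definition ex_dy (u : C -> R) (p : C) : Prop := ex_derive (fun t => u (fst p, t)) (snd p).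

Definition C2_on (U : C -> Prop) (u : C -> R) : Prop :=
  forall p, U p ->
    ex_dx u p /\ ex_dy u p /\
    ex_dx (dx u) p /\ ex_dy (dx u) p /\ ex_dx (dy u) p /\ ex_dy (dy u) p /\
    continuous u p /\ continuous (dx u) p /\ continuous (dy u) p /\
    continuous (dx (dx u)) p /\ continuous (dy (dx u)) p /\
    continuous (dx (dy u)) p /\ continuous (dy (dy u)) p.

Definition harmonic_fun_on (U : C -> Prop) (u : C -> R) : Prop :=
  C2_on U u /\ forall p, U p -> dx (dx u) p + dy (dy u) p = 0.

Definition harmonic_map_on (U : C -> Prop) (f : C -> C) : Prop :=
  harmonic_fun_on U (fun p => fst (f p)) /\ harmonic_fun_on U (fun p => snd (f p)).

Record mat2 := Mat2 { m11 : R; m12 : R; m21 : R; m22 : R }.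

Definition mat_apply (m : mat2) (h : C) : C :=
  (m11 m * fst h + m12 m * snd h, m21 m * fst h + m22 m * snd h).

Definition jac (f : C -> C) (p : C) : mat2 :=
  Mat2 (dx (fun q => fst (f q)) p) (dy (fun q => fst (f q)) p)
       (dx (fun q => snd (f q)) p) (dy (fun q => snd (f q)) p).

Definition opnorm (m : mat2) : Rbar :=
  Lub_Rbar (fun r => exists h : C, Cmod h = 1 /\ r = Cmod (mat_apply m h)).

Definition orthogonal (o : mat2) : Prop :=
  m11 o * m11 o + m21 o * m21 o = 1 /\ m12 o * m12 o + m22 o * m22 o = 1 /\
  m11 o * m12 o + m21 o * m22 o = 0.

Definition conformal (m : mat2) : Prop :=
  exists (k : R) (o : mat2), 0 <= k /\ orthogonal o /\
    m11 m = k * m11 o /\ m12 m = k * m12 o /\ m21 m = k * m21 o /\ m22 m = k * m22 o.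

Definition M_D (D : C -> Prop) (p : C) : Rbar :=
  Lub_Rbar (fun r => exists f : C -> C,
    harmonic_map_on unit_disk f /\ (forall z, unit_disk z -> D (f z)) /\
    f (RtoC 0) = p /\ conformal (jac f (RtoC 0)) /\ Finite r = opnorm (jac f (RtoC 0))).

(* Main.v *)
Require Import Defs.
From Stdlib Require Import Reals Lra Lia FunctionalExtensionality.
From Coquelicot Require Import Coquelicot.
Open Scope R_scope.

(* Harmonic extension of a circle map [g] with values in the convex set [D] stays in (the closure of)
   [D]; hence if the Fourier coefficients of [g] of index 0 and -1 vanish, extremality bounds the
   coefficient of index 1 by [|Phi'(0)|].  This is applied to
     [(1 + u) / 2 * Phi (r e^{i theta} z) + (1 - u) / 2 * Phi (r e^{-i theta} z)]
   with a small real trigonometric polynomial [u] carried by the frequencies 1, 2 and [n >= 3].  The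
   two constraints are triangular in the coefficients of frequency 1 and 2, so the one of frequency
   [n] is free.  The coefficient of index 1 loses only a factor [cos theta = 1 - O(theta^2)], while the
   contribution of [u] is of order [theta] with an arbitrary phase; its leading term must vanish.  In
   terms of [Phi' = sum e_k z^k] this says [e_n + a e_{n-1} + lam e_{n-2} = 0] with
   [a = - e_1 / e_0] and [lam = e_1^2 / e_0^2 - e_2 / e_0], that is [(1 + a z + lam z^2) Phi' = e_0].
   The quadratic has no zero in the open disk, and none on the circle because [Phi] is bounded. *)

(** As [u] is real, each frequency enters with a coefficient and its conjugate, which could make the
    constraints only real-linear. This is harmless: half the difference of the two rotated copies
    has coefficient [i sin(k theta) c_k r^k] at index [k >= 0] and none at [k < 0], where [c_k] is
    the Taylor coefficient of [Phi]; in the coefficients of [g] at -1, 0 and 1, the conjugates meet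
    only indices [k <= 0], where it vanishes. So all conditions are complex-linear, and frequency 1
    drops out at index -1. Solving them involves only quotients [sin(k theta) / sin theta], bounded
    by [k]. The admissible size of the free coefficient thus depends neither on [theta] nor on [r],
    which is what lets a gain of order [theta] be compared with a loss of order [theta^2]. Boundary
    values of [Phi] are avoided: [r -> 1] is taken only in a scalar inequality. The competitor is an
    average of [g] against a truncated Poisson kernel, shrunk to return from the closure of [D] into
    [D]; being a harmonic polynomial, it shows its differential at 0 in its coefficients. *)

Definition cis (t : R) : C := (cos t, sin t).

Lemma cis_plus (a b : R) : cis (a + b) = (cis a * cis b)%C.
Proof. unfold cis, Cmult; simpl; rewrite cos_plus, sin_plus; f_equal; ring. Qed.

Lemma cis_0 : cis 0 = RtoC 1.
Proof. unfold cis; rewrite cos_0, sin_0; reflexivity. Qed.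

Lemma cis_opp (t : R) : cis (- t) = Cconj (cis t).
Proof. unfold cis, Cconj; simpl; now rewrite cos_neg, sin_neg. Qed.

Lemma Cmod_cis (t : R) : Cmod (cis t) = 1.
Proof.
  unfold Cmod, cis; simpl fst; simpl snd.
  replace (cos t ^ 2 + sin t ^ 2) with 1; [apply sqrt_1|].
  generalize (sin2_cos2 t); unfold Rsqr; nra.
Qed.

Lemma cis_neq_0 (t : R) : cis t <> RtoC 0.
Proof. apply Cmod_gt_0; rewrite Cmod_cis; lra. Qed.

Lemma cis_INR (k : nat) (t : R) : cis (INR k * t) = (cis t ^ k)%C.
Proof.
  induction k as [|k IH].
  - simpl INR; rewrite Rmult_0_l; exact cis_0.
  - rewrite S_INR, Rmult_plus_distr_r, Rmult_1_l, cis_plus, IH, Cpow_S; ring.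
Qed.

Lemma cis_period (t : R) : cis (t + 2 * PI) = cis t.
Proof.
  rewrite cis_plus; unfold cis at 2; rewrite cos_2PI, sin_2PI.
  apply injective_projections; simpl; ring.
Qed.

Lemma cis_eq_of_Cmod_1 (z : C) : Cmod z = 1 -> exists t : R, z = cis t.
Proof.
  intros H. destruct z as [x y]. unfold Cmod in H; simpl fst in H; simpl snd in H.
  assert (E : x ^ 2 + y ^ 2 = 1).
  { rewrite <- (sqrt_sqrt (x ^ 2 + y ^ 2)); [rewrite H; ring|nra]. }
  assert (Hx : -1 <= x <= 1) by nra.
  assert (S : sin (acos x) = sqrt (1 - x ^ 2)).
  { rewrite sin_acos by lra. f_equal. unfold Rsqr; ring. }
  destruct (Rle_dec 0 y) as [Hy|Hy].
  - exists (acos x). unfold cis. rewrite cos_acos by lra. rewrite S.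
    replace (1 - x ^ 2) with (y ^ 2) by lra. rewrite sqrt_pow2 by lra. reflexivity.
  - exists (- acos x). unfold cis. rewrite cos_neg, sin_neg, cos_acos, S by lra.
    replace (1 - x ^ 2) with ((- y) ^ 2) by lra. rewrite sqrt_pow2 by lra.
    now rewrite Ropp_involutive.
Qed.

Lemma polar (z : C) : exists t : R, z = (RtoC (Cmod z) * cis t)%C.
Proof.
  destruct (Ceq_dec z (RtoC 0)) as [->|Hz].
  - exists 0. rewrite Cmod_0; ring.
  - assert (Hm := proj1 (Cmod_gt_0 z) Hz).
    assert (Hn : RtoC (Cmod z) <> RtoC 0) by (intros E; apply RtoC_inj in E; lra).
    destruct (cis_eq_of_Cmod_1 (z / RtoC (Cmod z))%C) as [t Ht].
    + rewrite Cmod_div by exact Hn. rewrite Cmod_R, Rabs_pos_eq by lra. field; lra.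
    + exists t. rewrite <- Ht. field; exact Hn.
Qed.

Lemma RtoC_neq_0 (x : R) : x <> 0 -> RtoC x <> RtoC 0.
Proof. intros H E; apply H; now apply RtoC_inj. Qed.

Lemma Rabs_fst_le (z : C) : Rabs (fst z) <= Cmod z.
Proof. eapply Rle_trans; [apply Rmax_l|apply Rmax_Cmod]. Qed.

Lemma Rabs_snd_le (z : C) : Rabs (snd z) <= Cmod z.
Proof. eapply Rle_trans; [apply Rmax_r|apply Rmax_Cmod]. Qed.

Lemma Cmod_le_abs (z : C) : Cmod z <= Rabs (fst z) + Rabs (snd z).
Proof.
  replace z with (RtoC (fst z) + Ci * RtoC (snd z))%C at 1.
  - eapply Rle_trans; [apply Cmod_triangle|].
    rewrite Cmod_mult, Cmod_Ci, !Cmod_R; lra.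
  - destruct z as [x y]; unfold Cplus, Cmult, Ci, RtoC; simpl; f_equal; ring.
Qed.

Lemma Cmod_minus_sym (z w : C) : Cmod (z - w) = Cmod (w - z).
Proof. replace (z - w)%C with (- (w - z))%C by ring; apply Cmod_opp. Qed.

Lemma Cmod_minus_le (z w : C) : Cmod (z - w) <= Cmod z + Cmod w.
Proof. unfold Cminus; rewrite <- (Cmod_opp w); apply Cmod_triangle. Qed.

Lemma Cmod_triangle_rev (z w : C) : Cmod z - Cmod w <= Cmod (z - w).
Proof.
  assert (H := Cmod_triangle (z - w) w).
  replace (z - w + w)%C with z in H by ring; lra.
Qed.

(** * Complex differentiability in epsilon-delta form *)

Definition ccont (f : C -> C) (z : C) : Prop :=
  forall eps : R, 0 < eps -> exists delta : R, 0 < delta /\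
    forall w, Cmod (w - z) < delta -> Cmod (f w - f z) <= eps.

(** Multiplied-out form without a quotient, so [w = z] needs no exclusion. *)
Definition cderiv (f : C -> C) (z l : C) : Prop :=
  forall eps : R, 0 < eps -> exists delta : R, 0 < delta /\
    forall w, Cmod (w - z) < delta ->
      Cmod (f w - f z - l * (w - z)) <= eps * Cmod (w - z).

(** The filter form of the derivative quantifies over all limits of the neighbourhood filter of [z];
    the only such limit is [z] itself, and what remains is the epsilon-delta estimate with the
    product commuted. *)
Lemma is_derive_cderiv (f : C -> C) (z l : C) :
  is_derive (K := C_AbsRing) (V := C_NormedModule) f z l <-> cderiv f z l.
Proof.
  split.
  - intros [_ H] eps Heps.
    destruct (H z (fun P HP => HP) (mkposreal eps Heps)) as [d Hd].
    exists d; split; [apply cond_pos|]. intros w Hw.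
    specialize (Hd w Hw).
    rewrite Cmult_comm. exact Hd.
  - intros H. split; [apply is_linear_scal_l|].
    intros x Hx eps.
    rewrite <- (is_filter_lim_locally_unique _ _ Hx).
    destruct (H eps (cond_pos eps)) as [d [Hd1 Hd]].
    exists (mkposreal d Hd1). intros w Hw. specialize (Hd w Hw).
    rewrite Cmult_comm in Hd. exact Hd.
Qed.

Lemma cderiv_ccont (f : C -> C) (z l : C) : cderiv f z l -> ccont f z.
Proof.
  intros H eps Heps. destruct (H 1 Rlt_0_1) as [d [Hd1 Hd]].
  assert (Hl := Cmod_ge_0 l).
  exists (Rmin d (eps / (Cmod l + 1))). split.
  - apply Rmin_pos; [easy|]. apply Rdiv_lt_0_compat; lra.
  - intros w Hw.
    assert (H1 : Cmod (w - z) < d) by (eapply Rlt_le_trans; [exact Hw|apply Rmin_l]).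
    assert (H2 : Cmod (w - z) < eps / (Cmod l + 1)) by (eapply Rlt_le_trans; [exact Hw|apply Rmin_r]).
    specialize (Hd w H1).
    replace (f w - f z)%C with ((f w - f z - l * (w - z)) + l * (w - z))%C by ring.
    eapply Rle_trans; [apply Cmod_triangle|]. rewrite Cmod_mult.
    apply Rle_trans with ((Cmod l + 1) * Cmod (w - z)); [lra|].
    apply Rle_trans with ((Cmod l + 1) * (eps / (Cmod l + 1))).
    + apply Rmult_le_compat_l; lra.
    + right; field; lra.
Qed.

(** Both linear approximations are compared at a single real increment [e], each with tolerance a
    quarter of the gap [|l - l'|]; the gap would then be at most half of itself. *)
Lemma cderiv_unique (f : C -> C) (z l l' : C) : cderiv f z l -> cderiv f z l' -> l = l'.
Proof.
  intros H H'.
  destruct (Ceq_dec l l') as [|N]; [easy|exfalso].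
  assert (P : 0 < Cmod (l - l')) by (apply Cmod_gt_0; now apply Cminus_eq_contra).
  destruct (H (Cmod (l - l') / 4)) as [d [Hd1 Hd]]; [lra|].
  destruct (H' (Cmod (l - l') / 4)) as [d' [Hd1' Hd']]; [lra|].
  set (e := Rmin d d' / 2).
  assert (He : 0 < e) by (unfold e; assert (0 < Rmin d d') by (now apply Rmin_pos); lra).
  assert (E1 := Rmin_l d d'). assert (E2 := Rmin_r d d').
  assert (W : Cmod (z + RtoC e - z) = e).
  { replace (z + RtoC e - z)%C with (RtoC e) by ring. rewrite Cmod_R, Rabs_pos_eq; lra. }
  assert (W' : (z + RtoC e - z)%C = RtoC e) by ring.
  specialize (Hd (z + RtoC e)%C). specialize (Hd' (z + RtoC e)%C).
  rewrite W in Hd, Hd'. rewrite W' in Hd, Hd'.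
  assert (A : Cmod ((l - l') * RtoC e) <= Cmod (l - l') / 4 * e + Cmod (l - l') / 4 * e).
  { replace ((l - l') * RtoC e)%C with ((f (z + RtoC e)%C - f z - l' * RtoC e) - (f (z + RtoC e)%C - f z - l * RtoC e))%C by ring.
    eapply Rle_trans; [apply Cmod_minus_le|].
    apply Rplus_le_compat; [apply Hd'|apply Hd]; unfold e; lra. }
  rewrite Cmod_mult, Cmod_R, Rabs_pos_eq in A by lra. nra.
Qed.

Lemma cderiv_ext_loc (f g : C -> C) (z l : C) (r : R) :
  0 < r -> (forall w, Cmod (w - z) < r -> f w = g w) -> cderiv f z l -> cderiv g z l.
Proof.
  intros Hr E H eps Heps. destruct (H eps Heps) as [d [Hd1 Hd]].
  exists (Rmin d r); split; [now apply Rmin_pos|]. intros w Hw.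
  rewrite <- (E w), <- (E z).
  - apply Hd. eapply Rlt_le_trans; [exact Hw|apply Rmin_l].
  - replace (z - z)%C with (RtoC 0) by ring. now rewrite Cmod_0.
  - eapply Rlt_le_trans; [exact Hw|apply Rmin_r].
Qed.

Lemma cderiv_const (c z : C) : cderiv (fun _ => c) z (RtoC 0).
Proof.
  intros eps Heps; exists 1; split; [lra|]; intros w _.
  replace (c - c - RtoC 0 * (w - z))%C with (RtoC 0) by ring.
  rewrite Cmod_0; assert (H := Cmod_ge_0 (w - z)); nra.
Qed.

Lemma cderiv_id (z : C) : cderiv (fun w => w) z (RtoC 1).
Proof.
  intros eps Heps; exists 1; split; [lra|]; intros w _.
  replace (w - z - RtoC 1 * (w - z))%C with (RtoC 0) by ring.
  rewrite Cmod_0; assert (H := Cmod_ge_0 (w - z)); nra.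
Qed.

Lemma cderiv_plus (f g : C -> C) (z a b : C) :
  cderiv f z a -> cderiv g z b -> cderiv (fun w => f w + g w)%C z (a + b)%C.
Proof.
  intros Hf Hg eps Heps.
  destruct (Hf (eps / 2)) as [d [Hd1 Hd]]; [lra|].
  destruct (Hg (eps / 2)) as [d' [Hd1' Hd']]; [lra|].
  exists (Rmin d d'); split; [now apply Rmin_pos|]. intros w Hw.
  assert (E1 := Rmin_l d d'). assert (E2 := Rmin_r d d').
  specialize (Hd w ltac:(lra)). specialize (Hd' w ltac:(lra)).
  replace (f w + g w - (f z + g z) - (a + b) * (w - z))%C
    with ((f w - f z - a * (w - z)) + (g w - g z - b * (w - z)))%C by ring.
  eapply Rle_trans; [apply Cmod_triangle|]. lra.
Qed.

Lemma cderiv_mult (f g : C -> C) (z a b : C) :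
  cderiv f z a -> cderiv g z b -> cderiv (fun w => f w * g w)%C z (a * g z + f z * b)%C.
Proof.
  intros Hf Hg eps Heps.
  set (K := Cmod (f z) + Cmod (g z) + Cmod a + 2).
  assert (B1 := Cmod_ge_0 (f z)). assert (B2 := Cmod_ge_0 (g z)). assert (B3 := Cmod_ge_0 a).
  assert (HK : 0 < K) by (unfold K; lra).
  set (e := Rmin 1 (eps / (3 * K))).
  assert (He : 0 < e) by (apply Rmin_pos; [lra|apply Rdiv_lt_0_compat; lra]).
  assert (He1 : e <= 1) by apply Rmin_l.
  assert (He2 : e * (3 * K) <= eps).
  { apply Rle_trans with (eps / (3 * K) * (3 * K)); [|right; field; lra].
    apply Rmult_le_compat_r; [lra|apply Rmin_r]. }
  destruct (Hf e He) as [d [Hd1 Hd]].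
  destruct (Hg e He) as [d' [Hd1' Hd']].
  destruct (cderiv_ccont _ _ _ Hg e He) as [d2 [Hd21 Hd2]].
  exists (Rmin d (Rmin d' d2)); split; [repeat apply Rmin_pos; easy|]. intros w Hw.
  assert (E1 := Rmin_l d (Rmin d' d2)). assert (E2 := Rmin_r d (Rmin d' d2)).
  assert (E3 := Rmin_l d' d2). assert (E4 := Rmin_r d' d2).
  specialize (Hd w ltac:(lra)). specialize (Hd' w ltac:(lra)). specialize (Hd2 w ltac:(lra)).
  assert (Pw := Cmod_ge_0 (w - z)).
  (* Two first-order errors weighted by [g z] and [f z], and two mixed terms in which the small
     factor is the increment of [g]. [K] dominates the sum of the four weights. *)
  replace (f w * g w - f z * g z - (a * g z + f z * b) * (w - z))%C
    with ((f w - f z - a * (w - z)) * g z + f z * (g w - g z - b * (w - z))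
          + ((f w - f z - a * (w - z)) * (g w - g z) + a * (w - z) * (g w - g z)))%C by ring.
  eapply Rle_trans; [apply Cmod_triangle|].
  eapply Rle_trans; [apply Rplus_le_compat; apply Cmod_triangle|].
  rewrite !Cmod_mult.
  set (X := Cmod (w - z)) in *. set (P := Cmod (f w - f z - a * (w - z))) in *.
  set (Q := Cmod (g w - g z - b * (w - z))) in *. set (S := Cmod (g w - g z)) in *.
  assert (0 <= P) by apply Cmod_ge_0. assert (0 <= Q) by apply Cmod_ge_0. assert (0 <= S) by apply Cmod_ge_0.
  assert (T1 : P * Cmod (g z) <= e * X * Cmod (g z)) by (apply Rmult_le_compat_r; lra).
  assert (T2 : Cmod (f z) * Q <= Cmod (f z) * (e * X)) by (apply Rmult_le_compat_l; lra).
  assert (T3 : P * S <= e * X * 1) by (apply Rmult_le_compat; lra).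
  assert (T4 : Cmod a * X * S <= Cmod a * X * e) by (apply Rmult_le_compat_l; [apply Rmult_le_pos; lra|lra]).
  assert (T5 : e * X * K <= eps * X) by (assert (0 <= X * e) by (apply Rmult_le_pos; lra); unfold K in *; nra).
  unfold K in T5. nra.
Qed.

Lemma cderiv_comp (f g : C -> C) (z a b : C) :
  cderiv g z b -> cderiv f (g z) a -> cderiv (fun w => f (g w)) z (a * b)%C.
Proof.
  intros Hg Hf eps Heps.
  assert (B1 := Cmod_ge_0 a). assert (B2 := Cmod_ge_0 b).
  set (K := Cmod a + Cmod b + 2).
  assert (HK : 0 < K) by (unfold K; lra).
  set (e := Rmin 1 (eps / K)).
  assert (He : 0 < e) by (apply Rmin_pos; [lra|apply Rdiv_lt_0_compat; lra]).
  assert (He1 : e <= 1) by apply Rmin_l.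
  assert (He2 : e * K <= eps).
  { apply Rle_trans with (eps / K * K); [|right; field; lra].
    apply Rmult_le_compat_r; [lra|apply Rmin_r]. }
  destruct (Hf e He) as [d [Hd1 Hd]].
  destruct (Hg e He) as [d' [Hd1' Hd']].
  destruct (cderiv_ccont _ _ _ Hg (d / 2)) as [d2 [Hd21 Hd2]]; [lra|].
  exists (Rmin d' d2); split; [repeat apply Rmin_pos; easy|]. intros w Hw.
  assert (E3 := Rmin_l d' d2). assert (E4 := Rmin_r d' d2).
  specialize (Hd2 w ltac:(lra)). specialize (Hd' w ltac:(lra)). specialize (Hd (g w) ltac:(lra)).
  replace (f (g w) - f (g z) - a * b * (w - z))%C
    with ((f (g w) - f (g z) - a * (g w - g z)) + a * (g w - g z - b * (w - z)))%C by ring.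
  eapply Rle_trans; [apply Cmod_triangle|]. rewrite Cmod_mult.
  assert (G : Cmod (g w - g z) <= (1 + Cmod b) * Cmod (w - z)).
  { replace (g w - g z)%C with ((g w - g z - b * (w - z)) + b * (w - z))%C by ring.
    eapply Rle_trans; [apply Cmod_triangle|]. rewrite Cmod_mult.
    assert (0 <= Cmod (w - z)) by apply Cmod_ge_0. nra. }
  assert (P := Cmod_ge_0 (w - z)).
  apply Rle_trans with (e * ((1 + Cmod b) * Cmod (w - z)) + Cmod a * (e * Cmod (w - z))).
  - apply Rplus_le_compat.
    + eapply Rle_trans; [exact Hd|]. apply Rmult_le_compat_l; lra.
    + apply Rmult_le_compat_l; lra.
  - unfold K in He2. nra.
Qed.

(** The remainder is exactly [(w - z)^2 / (w z^2)]. With [|w| >= m / 2] it is at most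
    [2 |w - z|^2 / m^3], whence the radius [eps * m ^ 3 / 2]. *)
Lemma cderiv_inv (z : C) : z <> RtoC 0 -> cderiv Cinv z (- (/ z * / z))%C.
Proof.
  intros Hz eps Heps.
  assert (P := proj1 (Cmod_gt_0 z) Hz). set (m := Cmod z) in *.
  assert (P3 : 0 < m ^ 3) by (apply pow_lt; lra).
  exists (Rmin (m / 2) (eps * m ^ 3 / 2)). split.
  - apply Rmin_pos; [lra|]. assert (0 < eps * m ^ 3) by (apply Rmult_lt_0_compat; lra). lra.
  - intros w Hw.
    assert (H1 : Cmod (w - z) < m / 2) by (eapply Rlt_le_trans; [exact Hw|apply Rmin_l]).
    assert (H2 : Cmod (w - z) < eps * m ^ 3 / 2) by (eapply Rlt_le_trans; [exact Hw|apply Rmin_r]).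
    assert (Hm : m / 2 <= Cmod w).
    { assert (H := Cmod_triangle_rev z w). rewrite Cmod_minus_sym in H. fold m in H. lra. }
    assert (Hw0 : w <> RtoC 0) by (apply Cmod_gt_0; lra).
    replace (/ w - / z - - (/ z * / z) * (w - z))%C
      with ((w - z) * (w - z) * / (w * z * z))%C by (field; split; assumption).
    rewrite !Cmod_mult, Cmod_inv by (repeat apply Cmult_neq_0; assumption).
    rewrite !Cmod_mult. fold m.
    set (X := Cmod (w - z)) in *. assert (0 <= X) by apply Cmod_ge_0.
    assert (Q : 0 < Cmod w * m * m) by (repeat apply Rmult_lt_0_compat; lra).
    apply Rmult_le_reg_r with (Cmod w * m * m); [exact Q|].
    rewrite Rmult_assoc, Rinv_l by lra.
    assert (m ^ 3 / 2 <= Cmod w * m * m).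
    { replace (m ^ 3 / 2) with (m / 2 * (m * m)) by (simpl; field). rewrite Rmult_assoc.
      apply Rmult_le_compat_r; nra. }
    assert (X <= eps * (Cmod w * m * m)) by nra.
    nra.
Qed.

Lemma cderiv_opp (f : C -> C) (z a : C) : cderiv f z a -> cderiv (fun w => - f w)%C z (- a)%C.
Proof.
  intros H eps Heps. destruct (H eps Heps) as [d [Hd1 Hd]]. exists d; split; [easy|].
  intros w Hw. replace (- f w - - f z - - a * (w - z))%C with (- (f w - f z - a * (w - z)))%C by ring.
  rewrite Cmod_opp. now apply Hd.
Qed.

(** For [k = 0] the exponent [pred 0 = 0] is a default value, annihilated by the factor [INR 0]. *)
Lemma cderiv_Cpow (k : nat) (z : C) :
  cderiv (fun w => w ^ k)%C z (RtoC (INR k) * z ^ pred k)%C.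
Proof.
  induction k as [|k IH].
  - replace (RtoC (INR 0) * z ^ Init.Nat.pred 0)%C with (RtoC 0) by (simpl; ring). apply (cderiv_const (RtoC 1)).
  - replace (RtoC (INR (S k)) * z ^ Init.Nat.pred (S k))%C with (RtoC 1 * z ^ k + z * (RtoC (INR k) * z ^ pred k))%C.
    + apply (cderiv_mult (fun w => w) (fun w => w ^ k)%C); [apply cderiv_id|exact IH].
    + rewrite S_INR, RtoC_plus. destruct k; simpl; ring.
Qed.

(** * Integrals of complex-valued functions of a real variable *)

Definition rcont (f : R -> C) (t : R) : Prop :=
  forall eps : R, 0 < eps -> exists delta : R, 0 < delta /\
    forall s, Rabs (s - t) < delta -> Cmod (f s - f t) <= eps.

(** Taken componentwise, so that the real theory of [RInt] applies to each coordinate; integrability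
    is supplied each time by continuity. *)
Definition CInt (f : R -> C) (a b : R) : C :=
  (RInt (fun t => fst (f t)) a b, RInt (fun t => snd (f t)) a b).

Lemma rcont_const (c : C) (t : R) : rcont (fun _ => c) t.
Proof.
  intros eps Heps; exists 1; split; [lra|]; intros s _.
  replace (c - c)%C with (RtoC 0) by ring; rewrite Cmod_0; lra.
Qed.

Lemma rcont_plus (f g : R -> C) (t : R) :
  rcont f t -> rcont g t -> rcont (fun s => f s + g s)%C t.
Proof.
  intros Hf Hg eps Heps.
  destruct (Hf (eps / 2)) as [d [Hd1 Hd]]; [lra|].
  destruct (Hg (eps / 2)) as [d' [Hd1' Hd']]; [lra|].
  exists (Rmin d d'); split; [now apply Rmin_pos|]. intros s Hs.
  assert (E1 := Rmin_l d d'). assert (E2 := Rmin_r d d').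
  specialize (Hd s ltac:(lra)). specialize (Hd' s ltac:(lra)).
  replace (f s + g s - (f t + g t))%C with ((f s - f t) + (g s - g t))%C by ring.
  eapply Rle_trans; [apply Cmod_triangle|]. lra.
Qed.

Lemma rcont_mult (f g : R -> C) (t : R) :
  rcont f t -> rcont g t -> rcont (fun s => f s * g s)%C t.
Proof.
  intros Hf Hg eps Heps.
  assert (B1 := Cmod_ge_0 (f t)). assert (B2 := Cmod_ge_0 (g t)).
  set (K := Cmod (f t) + Cmod (g t) + 1).
  set (e := Rmin 1 (eps / K)).
  assert (HK : 0 < K) by (unfold K; lra).
  assert (He : 0 < e) by (apply Rmin_pos; [lra|apply Rdiv_lt_0_compat; lra]).
  assert (He1 : e <= 1) by apply Rmin_l.
  assert (He2 : e * K <= eps).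
  { apply Rle_trans with (eps / K * K); [|right; field; lra].
    apply Rmult_le_compat_r; [lra|apply Rmin_r]. }
  destruct (Hf e He) as [d [Hd1 Hd]]. destruct (Hg e He) as [d' [Hd1' Hd']].
  exists (Rmin d d'); split; [now apply Rmin_pos|]. intros s Hs.
  assert (E1 := Rmin_l d d'). assert (E2 := Rmin_r d d').
  specialize (Hd s ltac:(lra)). specialize (Hd' s ltac:(lra)).
  replace (f s * g s - f t * g t)%C
    with ((f s - f t) * g t + f t * (g s - g t) + (f s - f t) * (g s - g t))%C by ring.
  eapply Rle_trans; [apply Cmod_triangle|].
  eapply Rle_trans; [apply Rplus_le_compat_r, Cmod_triangle|].
  rewrite !Cmod_mult.
  assert (P1 := Cmod_ge_0 (f s - f t)). assert (P2 := Cmod_ge_0 (g s - g t)).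
  unfold K in He2. nra.
Qed.

Lemma rcont_opp (f : R -> C) (t : R) : rcont f t -> rcont (fun s => - f s)%C t.
Proof.
  intros H eps Heps. destruct (H eps Heps) as [d [Hd1 Hd]]. exists d; split; [easy|].
  intros s Hs. replace (- f s - - f t)%C with (- (f s - f t))%C by ring.
  rewrite Cmod_opp; now apply Hd.
Qed.

Lemma rcont_comp (h : C -> C) (f : R -> C) (t : R) :
  rcont f t -> ccont h (f t) -> rcont (fun s => h (f s)) t.
Proof.
  intros Hf Hh eps Heps.
  destruct (Hh eps Heps) as [d [Hd1 Hd]].
  destruct (Hf (d / 2)) as [d' [Hd1' Hd']]; [lra|].
  exists d'; split; [easy|]. intros s Hs. apply Hd. specialize (Hd' s Hs); lra.
Qed.

Lemma rcont_comp_R (f : R -> C) (u : R -> R) (t : R) :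
  rcont f (u t) -> continuity_pt u t -> rcont (fun s => f (u s)) t.
Proof.
  intros Hf Hu eps Heps.
  destruct (Hf eps Heps) as [d [Hd1 Hd]].
  destruct (proj1 (continuity_pt_locally u t) Hu (mkposreal d Hd1)) as [d' Hd'].
  exists d'; split; [apply cond_pos|]. intros s Hs. apply Hd. now apply Hd'.
Qed.

Lemma rcont_pair (f : R -> C) (t : R) :
  continuity_pt (fun s => fst (f s)) t -> continuity_pt (fun s => snd (f s)) t -> rcont f t.
Proof.
  intros H1 H2 eps Heps.
  assert (He : 0 < eps / 2) by lra.
  destruct (proj1 (continuity_pt_locally _ t) H1 (mkposreal _ He)) as [d1 Hd1].
  destruct (proj1 (continuity_pt_locally _ t) H2 (mkposreal _ He)) as [d2 Hd2].
  exists (Rmin d1 d2); split; [apply Rmin_pos; apply cond_pos|]. intros s Hs.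
  assert (E1 := Rmin_l d1 d2). assert (E2 := Rmin_r d1 d2).
  assert (A1 : Rabs (fst (f s) - fst (f t)) < eps / 2) by (apply Hd1; change (Rabs (s - t) < d1); lra).
  assert (A2 : Rabs (snd (f s) - snd (f t)) < eps / 2) by (apply Hd2; change (Rabs (s - t) < d2); lra).
  eapply Rle_trans; [apply Cmod_le_abs|]. simpl.
  unfold Rminus in A1, A2. lra.
Qed.

Lemma rcont_fst (f : R -> C) (t : R) : rcont f t -> continuity_pt (fun s => fst (f s)) t.
Proof.
  intros H. apply continuity_pt_locally. intros eps.
  destruct (H (eps / 2)) as [d [Hd1 Hd]]; [assert (P := cond_pos eps); lra|].
  exists (mkposreal d Hd1). intros s Hs. specialize (Hd s Hs).
  assert (A := Rabs_fst_le (f s - f t)). simpl in A. assert (P := cond_pos eps). unfold Rminus; lra.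
Qed.

Lemma rcont_snd (f : R -> C) (t : R) : rcont f t -> continuity_pt (fun s => snd (f s)) t.
Proof.
  intros H. apply continuity_pt_locally. intros eps.
  destruct (H (eps / 2)) as [d [Hd1 Hd]]; [assert (P := cond_pos eps); lra|].
  exists (mkposreal d Hd1). intros s Hs. specialize (Hd s Hs).
  assert (A := Rabs_snd_le (f s - f t)). simpl in A. assert (P := cond_pos eps). unfold Rminus; lra.
Qed.

Lemma rcont_RtoC (u : R -> R) (t : R) : continuity_pt u t -> rcont (fun s => RtoC (u s)) t.
Proof.
  intros H; apply rcont_pair; simpl; [exact H|].
  apply continuity_pt_const; intros ? ?; reflexivity.
Qed.

Lemma rcont_cis (t : R) : rcont cis t.
Proof.
  apply rcont_pair; simpl; [apply continuity_cos|apply continuity_sin].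
Qed.

Lemma rcont_cis_scal (k t : R) : rcont (fun s => cis (k * s)) t.
Proof.
  apply (rcont_comp_R cis (fun s => k * s)); [apply rcont_cis|].
  apply continuity_pt_mult; [apply continuity_pt_const; intros ? ?; reflexivity|].
  apply derivable_continuous_pt, derivable_pt_id.
Qed.

Lemma rcont_cis_opp_scal (k t : R) : rcont (fun t => cis (- (k * t))) t.
Proof.
  apply (rcont_comp_R cis (fun t => - (k * t))); [apply rcont_cis|].
  apply continuity_pt_opp, continuity_pt_mult; [apply continuity_pt_const; intros ? ?; reflexivity|].
  apply derivable_continuous_pt, derivable_pt_id.
Qed.

Definition rcont_on (f : R -> C) (a b : R) : Prop :=
  forall t, Rmin a b <= t <= Rmax a b -> rcont f t.

Lemma ex_RInt_rcont (f : R -> C) (a b : R) : rcont_on f a b ->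
  ex_RInt (fun t => fst (f t)) a b /\ ex_RInt (fun t => snd (f t)) a b.
Proof.
  intros H; split; apply (ex_RInt_continuous (V := R_CompleteNormedModule)); intros t Ht;
    apply continuity_pt_filterlim; [apply rcont_fst|apply rcont_snd]; now apply H.
Qed.

Lemma CInt_ext (f g : R -> C) (a b : R) :
  (forall t, Rmin a b < t < Rmax a b -> f t = g t) -> CInt f a b = CInt g a b.
Proof.
  intros H; unfold CInt; f_equal; apply RInt_ext; intros t Ht; now rewrite H.
Qed.

Lemma CInt_plus (f g : R -> C) (a b : R) : rcont_on f a b -> rcont_on g a b ->
  CInt (fun t => f t + g t)%C a b = (CInt f a b + CInt g a b)%C.
Proof.
  intros Hf Hg. destruct (ex_RInt_rcont f a b Hf). destruct (ex_RInt_rcont g a b Hg).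
  unfold CInt, Cplus; simpl; f_equal; now apply (RInt_plus (V := R_CompleteNormedModule)).
Qed.

Lemma CInt_scal (c : C) (f : R -> C) (a b : R) : rcont_on f a b ->
  CInt (fun t => c * f t)%C a b = (c * CInt f a b)%C.
Proof.
  intros Hf. destruct (ex_RInt_rcont f a b Hf) as [H1 H2]. destruct c as [x y].
  unfold CInt, Cmult; simpl; f_equal.
  - rewrite (RInt_minus (V := R_CompleteNormedModule) (fun t => x * fst (f t)) (fun t => y * snd (f t)))
      by (apply (ex_RInt_scal (V := R_NormedModule)); assumption).
    rewrite (RInt_scal (V := R_CompleteNormedModule) (fun t => fst (f t))) by assumption.
    rewrite (RInt_scal (V := R_CompleteNormedModule) (fun t => snd (f t))) by assumption.
    reflexivity.
  - rewrite (RInt_plus (V := R_CompleteNormedModule) (fun t => x * snd (f t)) (fun t => y * fst (f t)))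
      by (apply (ex_RInt_scal (V := R_NormedModule)); assumption).
    rewrite (RInt_scal (V := R_CompleteNormedModule) (fun t => fst (f t))) by assumption.
    rewrite (RInt_scal (V := R_CompleteNormedModule) (fun t => snd (f t))) by assumption.
    reflexivity.
Qed.

Lemma CInt_opp (f : R -> C) (a b : R) : rcont_on f a b ->
  CInt (fun t => - f t)%C a b = (- CInt f a b)%C.
Proof.
  intros Hf.
  rewrite (CInt_ext _ (fun t => - RtoC 1 * f t)%C) by (intros; ring).
  rewrite CInt_scal by exact Hf. ring.
Qed.

Lemma CInt_minus (f g : R -> C) (a b : R) : rcont_on f a b -> rcont_on g a b ->
  CInt (fun t => f t - g t)%C a b = (CInt f a b - CInt g a b)%C.
Proof.
  intros Hf Hg. unfold Cminus.
  rewrite (CInt_plus f (fun t => - g t)%C); [now rewrite CInt_opp|exact Hf|].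
  intros t Ht; apply rcont_opp, Hg, Ht.
Qed.

Lemma CInt_conj (f : R -> C) (a b : R) : rcont_on f a b ->
  CInt (fun t => Cconj (f t)) a b = Cconj (CInt f a b).
Proof.
  intros Hf. destruct (ex_RInt_rcont f a b Hf) as [H1 H2].
  unfold CInt, Cconj; simpl; f_equal.
  now apply (RInt_opp (V := R_CompleteNormedModule)).
Qed.

Lemma CInt_const (c : C) (a b : R) : CInt (fun _ => c) a b = (RtoC (b - a) * c)%C.
Proof.
  unfold CInt, Cmult; simpl; rewrite !RInt_const; f_equal; unfold scal; simpl; unfold mult; simpl; ring.
Qed.

Lemma CInt_chasles (f : R -> C) (a b c : R) : rcont_on f a b -> rcont_on f b c ->
  (CInt f a b + CInt f b c)%C = CInt f a c.
Proof.
  intros H1 H2. destruct (ex_RInt_rcont f a b H1). destruct (ex_RInt_rcont f b c H2).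
  unfold CInt, Cplus; simpl; f_equal; now apply (RInt_Chasles (V := R_CompleteNormedModule)).
Qed.

(** The factor 2 comes from estimating the two coordinates separately. The estimates built on it
    only need some constant; the sharp inequality of the proof comes from [M_D] instead. *)
Lemma CInt_bound (f : R -> C) (a b M : R) : a <= b -> rcont_on f a b ->
  (forall t, a <= t <= b -> Cmod (f t) <= M) -> Cmod (CInt f a b) <= 2 * M * (b - a).
Proof.
  intros Hab Hf HM. destruct (ex_RInt_rcont f a b Hf) as [H1 H2].
  eapply Rle_trans; [apply Cmod_le_abs|]. unfold CInt; simpl.
  assert (A1 : Rabs (RInt (fun t => fst (f t)) a b) <= (b - a) * M).
  { apply abs_RInt_le_const; [exact Hab|exact H1|]. intros t Ht.
    eapply Rle_trans; [apply Rabs_fst_le|]. now apply HM. }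
  assert (A2 : Rabs (RInt (fun t => snd (f t)) a b) <= (b - a) * M).
  { apply abs_RInt_le_const; [exact Hab|exact H2|]. intros t Ht.
    eapply Rle_trans; [apply Rabs_snd_le|]. now apply HM. }
  lra.
Qed.

Lemma CInt_comp_shift (f : R -> C) (s a b : R) : rcont_on f (a + s) (b + s) ->
  CInt (fun t => f (t + s)) a b = CInt f (a + s) (b + s).
Proof.
  intros Hf. destruct (ex_RInt_rcont f _ _ Hf) as [H1 H2].
  unfold CInt; f_equal.
  - rewrite <- (Rmult_1_l a), <- (Rmult_1_l b) at 2.
    rewrite <- (RInt_comp_lin (V := R_CompleteNormedModule) (fun t => fst (f t)) 1 s a b).
    + apply RInt_ext; intros t _. unfold scal; simpl; unfold mult; simpl. now rewrite !Rmult_1_l.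
    + now rewrite !Rmult_1_l.
  - rewrite <- (Rmult_1_l a), <- (Rmult_1_l b) at 2.
    rewrite <- (RInt_comp_lin (V := R_CompleteNormedModule) (fun t => snd (f t)) 1 s a b).
    + apply RInt_ext; intros t _. unfold scal; simpl; unfold mult; simpl. now rewrite !Rmult_1_l.
    + now rewrite !Rmult_1_l.
Qed.


(** After translation, the overhang from [2 * PI] to [2 * PI + s] equals by periodicity the missing
    piece from 0 to [s]. Chasles is used with either orientation, so the sign of [s] is free. *)
Lemma CInt_shift_period (f : R -> C) (s : R) :
  (forall t, rcont f t) -> (forall t, f (t + 2 * PI) = f t) ->
  CInt (fun t => f (t + s)) 0 (2 * PI) = CInt f 0 (2 * PI).
Proof.
  intros Hc Hp.
  assert (Hon : forall a b, rcont_on f a b) by (intros a b t _; apply Hc).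
  rewrite CInt_comp_shift by apply Hon. rewrite Rplus_0_l.
  assert (E1 := CInt_chasles f s 0 (2 * PI + s) (Hon _ _) (Hon _ _)).
  assert (E2 := CInt_chasles f 0 (2 * PI) (2 * PI + s) (Hon _ _) (Hon _ _)).
  assert (E3 : CInt f (2 * PI) (2 * PI + s) = CInt f 0 s).
  { transitivity (CInt f (0 + 2 * PI) (s + 2 * PI)); [f_equal; ring|].
    rewrite <- CInt_comp_shift by apply Hon. apply CInt_ext; intros t _; apply Hp. }
  assert (E4 := CInt_chasles f 0 s 0 (Hon _ _) (Hon _ _)).
  assert (E5 : CInt f 0 0 = RtoC 0).
  { unfold CInt; rewrite !RInt_point; reflexivity. }
  rewrite <- E1, <- E2, E3.
  replace (CInt f s 0) with (- CInt f 0 s)%C; [ring|].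
  rewrite E5 in E4.
  replace (CInt f s 0) with (CInt f 0 s + CInt f s 0 - CInt f 0 s)%C by ring.
  rewrite E4; ring.
Qed.

Lemma CInt_affine_real (p q : C) (a b : R) :
  CInt (fun t => p + q * RtoC t)%C a b
  = (RtoC (b - a) * p + q * RtoC ((b ^ 2 - a ^ 2) / 2))%C.
Proof.
  assert (E : forall u v : R, RInt (fun t => u + v * t) a b = (b - a) * u + v * ((b ^ 2 - a ^ 2) / 2)).
  { intros u v. apply is_RInt_unique.
    replace ((b - a) * u + v * ((b ^ 2 - a ^ 2) / 2)) with
      (minus ((fun t => u * t + v * (t ^ 2 / 2)) b) ((fun t => u * t + v * (t ^ 2 / 2)) a))
      by (unfold minus, plus, opp; simpl; field).
    apply (is_RInt_derive (V := R_CompleteNormedModule) (fun t => u * t + v * (t ^ 2 / 2)) (fun t => u + v * t)).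
    - intros t _. auto_derive; [easy|]. field.
    - intros t _. apply (ex_derive_continuous (K := R_AbsRing) (V := R_NormedModule) (fun t : R => u + v * t)). auto_derive; easy. }
  destruct p as [p1 p2], q as [q1 q2].
  unfold CInt, Cplus, Cmult, RtoC; simpl. f_equal.
  - rewrite (RInt_ext _ (fun t => p1 + q1 * t)) by (intros; apply Rminus_diag_uniq; simpl; ring). rewrite E; simpl; ring.
  - rewrite (RInt_ext _ (fun t => p2 + q2 * t)) by (intros; apply Rminus_diag_uniq; simpl; ring). rewrite E; simpl; ring.
Qed.

(** * Goursat's theorem and circle means *)

Lemma nested_intervals (u v : nat -> R) :
  (forall n, u n <= u (S n)) -> (forall n, v (S n) <= v n) -> (forall n, u n <= v n) ->
  exists x, forall n, u n <= x <= v n.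
Proof.
  intros Hu Hv Huv.
  assert (Mu : forall n k, u n <= u (n + k)%nat).
  { intros n k; induction k as [|k IH]; [rewrite Nat.add_0_r; lra|].
    rewrite Nat.add_succ_r; eapply Rle_trans; [exact IH|apply Hu]. }
  assert (Mv : forall n k, v (n + k)%nat <= v n).
  { intros n k; induction k as [|k IH]; [rewrite Nat.add_0_r; lra|].
    rewrite Nat.add_succ_r; eapply Rle_trans; [apply Hv|exact IH]. }
  assert (B : forall n m, u n <= v m).
  { intros n m. apply Rle_trans with (u (n + m)%nat); [apply Mu|].
    apply Rle_trans with (v (n + m)%nat); [apply Huv|]. rewrite Nat.add_comm; apply Mv. }
  destruct (completeness (fun x => exists n, x = u n)) as [x [Hx1 Hx2]].
  - exists (v 0%nat). intros y [n ->]. apply B.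
  - exists (u 0%nat), 0%nat; reflexivity.
  - exists x. intros n; split; [apply Hx1; now exists n|].
    apply Hx2. intros y [m ->]. apply B.
Qed.

(** Goursat's bisection as an induction principle: if [P] failed, some quarter would fail, and
    iterating gives failing rectangles shrinking to a point, where the local hypothesis contradicts
    the failure. [dec] makes the choice of the failing quarter a function. *)
Lemma quartering_induction (P : R -> R -> R -> R -> Prop)
  (dec : forall a b c d, {P a b c d} + {~ P a b c d}) (a b c d : R) :
  a <= b -> c <= d ->
  (forall a' b' c' d', a <= a' <= b' -> b' <= b -> c <= c' <= d' -> d' <= d ->
     let m := (a' + b') / 2 in let n := (c' + d') / 2 in
     P a' m c' n -> P m b' c' n -> P a' m n d' -> P m b' n d' -> P a' b' c' d') ->
  (forall x y, a <= x <= b -> c <= y <= d -> exists delta, 0 < delta /\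
     forall a' b' c' d', a <= a' <= x -> x <= b' <= b -> c <= c' <= y -> y <= d' <= d ->
       b' - a' < delta -> d' - c' < delta -> P a' b' c' d') ->
  P a b c d.
Proof.
  intros Hab Hcd Hstep Hloc.
  destruct (dec a b c d) as [|N]; [easy|exfalso].
  (* The first failing quarter is selected; the fourth is taken without a test, since it must fail
     when the other three hold and the whole does not. *)
  set (step := fun r : (R * R) * (R * R) =>
    let a := fst (fst r) in let b := snd (fst r) in let c := fst (snd r) in let d := snd (snd r) in
    let m := (a + b) / 2 in let n := (c + d) / 2 in
    if dec a m c n then if dec m b c n then if dec a m n d then ((m, b), (n, d)) else ((a, m), (n, d))
    else ((m, b), (c, n)) else ((a, m), (c, n))).
  set (rr := fun n => Nat.iter n step ((a, b), (c, d))).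
  set (A := fun n => fst (fst (rr n))). set (B := fun n => snd (fst (rr n))).
  set (E := fun n => fst (snd (rr n))). set (D := fun n => snd (snd (rr n))).
  assert (I : forall n, (a <= A n <= B n /\ B n <= b /\ c <= E n <= D n /\ D n <= d) /\
     ~ P (A n) (B n) (E n) (D n)).
  { intros n; induction n as [|n [[[I1 I2] [I3 [[I4 I5] I6]]] I7]].
    - split; [unfold A, B, E, D; simpl; lra|exact N].
    - assert (S := Hstep (A n) (B n) (E n) (D n) ltac:(lra) ltac:(lra) ltac:(lra) ltac:(lra)). simpl in S.
      unfold A, B, E, D in *. change (rr (Datatypes.S n)) with (step (rr n)).
      unfold step.
      destruct (dec _ _ _ _) as [q1|q1]; [|simpl; split; [lra|assumption]].
      destruct (dec _ _ _ _) as [q2|q2]; [|simpl; split; [lra|assumption]].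
      destruct (dec _ _ _ _) as [q3|q3]; [|simpl; split; [lra|assumption]].
      simpl; split; [lra|]. intros q4. apply I7, S; assumption. }
  assert (J : forall n, (A n <= A (S n) /\ B (S n) <= B n /\ E n <= E (S n) /\ D (S n) <= D n) /\
     B (S n) - A (S n) = (B n - A n) / 2 /\ D (S n) - E (S n) = (D n - E n) / 2).
  { intros n. destruct (I n) as [I1 _]. unfold A, B, E, D in *. change (rr (S n)) with (step (rr n)). unfold step.
    destruct (dec _ _ _ _); [|simpl; lra].
    destruct (dec _ _ _ _); [|simpl; lra].
    destruct (dec _ _ _ _); simpl; lra. }
  assert (SZ : forall n, B n - A n = (b - a) * (/ 2) ^ n /\ D n - E n = (d - c) * (/ 2) ^ n).
  { intros n; induction n as [|n [IH1 IH2]]; [simpl; unfold A, B, E, D; simpl; lra|].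
    destruct (J n) as [_ [J1 J2]]. rewrite J1, J2, IH1, IH2. simpl; split; field. }
  destruct (nested_intervals A B) as [x Hx]; try (intros n; destruct (J n), (I n); lra).
  destruct (nested_intervals E D) as [y Hy]; try (intros n; destruct (J n), (I n); lra).
  destruct (Hloc x y) as [delta [Hd1 Hd]].
  { specialize (Hx 0%nat). unfold A, B in Hx; simpl in Hx; lra. }
  { specialize (Hy 0%nat). unfold E, D in Hy; simpl in Hy; lra. }
  (* The summand 1 keeps the denominator positive for a rectangle degenerated to a point. *)
  destruct (pow_lt_1_zero (/ 2)) with (y := delta / (b - a + (d - c) + 1)) as [n Hn].
  { rewrite Rabs_pos_eq; lra. }
  { apply Rdiv_lt_0_compat; lra. }
  specialize (Hn n (le_n n)). rewrite Rabs_pos_eq in Hn by (apply pow_le; lra).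
  assert (Hn' : (b - a + (d - c) + 1) * (/ 2) ^ n < delta).
  { apply Rmult_lt_reg_r with (/ (b - a + (d - c) + 1)); [apply Rinv_0_lt_compat; lra|].
    replace ((b - a + (d - c) + 1) * (/ 2) ^ n * / (b - a + (d - c) + 1)) with ((/ 2) ^ n) by (field; lra). exact Hn. }
  assert (Hp : 0 < (/ 2) ^ n) by (apply pow_lt; lra).
  destruct (I n) as [I1 I2]. destruct (SZ n) as [S1 S2]. specialize (Hx n). specialize (Hy n).
  apply I2, Hd; try lra; try (rewrite S1 || rewrite S2; nra).
Qed.

(** The contour integral of [G(w) dw] along the boundary, counterclockwise; on vertical sides
    [dw = i dy]. *)
Definition rect_int (G : C -> C) (a b c d : R) : C :=
  (CInt (fun x => G (x, c)) a b + Ci * CInt (fun y => G (b, y)) c d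
   - CInt (fun x => G (x, d)) a b - Ci * CInt (fun y => G (a, y)) c d)%C.

Lemma rcont_hline (G : C -> C) (x y : R) : ccont G (x, y) -> rcont (fun s => G (s, y)) x.
Proof.
  intros H. apply (rcont_comp G (fun s => (s, y))); [|exact H].
  apply rcont_pair; simpl; [apply derivable_continuous_pt, derivable_pt_id|].
  apply continuity_pt_const; intros ? ?; reflexivity.
Qed.

Lemma rcont_vline (G : C -> C) (x y : R) : ccont G (x, y) -> rcont (fun s => G (x, s)) y.
Proof.
  intros H. apply (rcont_comp G (fun s => (x, s))); [|exact H].
  apply rcont_pair; simpl; [|apply derivable_continuous_pt, derivable_pt_id].
  apply continuity_pt_const; intros ? ?; reflexivity.
Qed.

Definition ccont_on_rect (G : C -> C) (a b c d : R) : Prop :=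
  forall x y, a <= x <= b -> c <= y <= d -> ccont G (x, y).

Lemma rcont_on_hline (G : C -> C) (a b c d a' b' y : R) :
  ccont_on_rect G a b c d -> a <= a' <= b' -> b' <= b -> c <= y <= d ->
  rcont_on (fun x => G (x, y)) a' b'.
Proof.
  intros H H1 H2 H3 t Ht. rewrite Rmin_left, Rmax_right in Ht by lra.
  apply rcont_hline, H; lra.
Qed.

Lemma rcont_on_vline (G : C -> C) (a b c d c' d' x : R) :
  ccont_on_rect G a b c d -> c <= c' <= d' -> d' <= d -> a <= x <= b ->
  rcont_on (fun y => G (x, y)) c' d'.
Proof.
  intros H H1 H2 H3 t Ht. rewrite Rmin_left, Rmax_right in Ht by lra.
  apply rcont_vline, H; lra.
Qed.

Lemma rect_int_quarter (G : C -> C) (a m b c n d : R) :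
  ccont_on_rect G a b c d -> a <= m <= b -> c <= n <= d ->
  rect_int G a b c d =
  (rect_int G a m c n + rect_int G m b c n + rect_int G a m n d + rect_int G m b n d)%C.
Proof.
  intros H Hm Hn. unfold rect_int.
  assert (HL : forall a' b' y, a <= a' <= b' -> b' <= b -> c <= y <= d -> rcont_on (fun x => G (x, y)) a' b')
    by (intros; eapply rcont_on_hline; eauto).
  assert (VL : forall c' d' x, c <= c' <= d' -> d' <= d -> a <= x <= b -> rcont_on (fun y => G (x, y)) c' d')
    by (intros; eapply rcont_on_vline; eauto).
  rewrite <- (CInt_chasles (fun x => G (x, c)) a m b) by (apply HL; lra).
  rewrite <- (CInt_chasles (fun x => G (x, d)) a m b) by (apply HL; lra).
  rewrite <- (CInt_chasles (fun y => G (a, y)) c n d) by (apply VL; lra).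
  rewrite <- (CInt_chasles (fun y => G (b, y)) c n d) by (apply VL; lra).
  ring.
Qed.

Lemma rect_int_affine (p q : C) (a b c d : R) :
  rect_int (fun w => p + q * w)%C a b c d = RtoC 0.
Proof.
  unfold rect_int.
  assert (H : forall y, CInt (fun x => p + q * (x, y))%C a b
    = (RtoC (b - a) * (p + q * Ci * RtoC y) + q * RtoC ((b ^ 2 - a ^ 2) / 2))%C).
  { intros y. rewrite <- CInt_affine_real. apply CInt_ext; intros t _.
    replace ((t, y) : C) with (RtoC t + Ci * RtoC y)%C; [ring|].
    unfold Cplus, Cmult, Ci, RtoC; simpl; f_equal; ring. }
  assert (V : forall x, CInt (fun y => p + q * (x, y))%C c d
    = (RtoC (d - c) * (p + q * RtoC x) + q * Ci * RtoC ((d ^ 2 - c ^ 2) / 2))%C).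
  { intros x. rewrite <- CInt_affine_real. apply CInt_ext; intros t _.
    replace ((x, t) : C) with (RtoC x + Ci * RtoC t)%C; [ring|].
    unfold Cplus, Cmult, Ci, RtoC; simpl; f_equal; ring. }
  rewrite !H, !V, !RtoC_minus. ring.
Qed.

Lemma rect_int_plus (F G : C -> C) (a b c d : R) : a <= b -> c <= d ->
  ccont_on_rect F a b c d -> ccont_on_rect G a b c d ->
  rect_int (fun w => F w + G w)%C a b c d = (rect_int F a b c d + rect_int G a b c d)%C.
Proof.
  intros Hab Hcd HF HG. unfold rect_int.
  rewrite !CInt_plus; try ring;
    first [eapply rcont_on_hline; eauto; lra | eapply rcont_on_vline; eauto; lra].
Qed.

(** Subtracting the affine approximation at [p] does not change the integral. What is left is at
    most [e * s] on the rectangle, [s] being half the perimeter, and the four sides, with the factor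
    2 of [CInt_bound], contribute [4 * e * s ^ 2]. *)
Lemma rect_int_local_bound (G : C -> C) (a b c d e : R) (p l : C) : a <= b -> c <= d -> 0 <= e ->
  a <= fst p <= b -> c <= snd p <= d -> ccont_on_rect G a b c d ->
  (forall x y, a <= x <= b -> c <= y <= d ->
     Cmod (G (x, y) - G p - l * ((x, y) - p)) <= e * Cmod ((x, y) - p)) ->
  Cmod (rect_int G a b c d) <= 4 * e * (b - a + (d - c)) ^ 2.
Proof.
  intros Hab Hcd He Hp1 Hp2 HG HL.
  set (A := fun w : C => ((G p - l * p) + l * w)%C).
  set (Rm := fun w : C => (G w + (- (G p - l * p) + - l * w))%C).
  assert (AC : forall q r : C, ccont_on_rect (fun w => q + r * w)%C a b c d).
  { intros q r x y _ _. eapply cderiv_ccont, cderiv_plus; [apply cderiv_const|].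
    apply cderiv_mult; [apply cderiv_const|apply cderiv_id]. }
  assert (RC : ccont_on_rect Rm a b c d).
  { intros x y Hx Hy eps Heps.
    destruct (HG x y Hx Hy (eps / 2)) as [d1 [Hd11 Hd1]]; [lra|].
    destruct (AC (- (G p - l * p))%C (- l)%C x y Hx Hy (eps / 2)) as [d2 [Hd21 Hd2]]; [lra|].
    exists (Rmin d1 d2); split; [now apply Rmin_pos|]. intros w Hw.
    assert (E1 := Rmin_l d1 d2). assert (E2 := Rmin_r d1 d2).
    specialize (Hd1 w ltac:(lra)). specialize (Hd2 w ltac:(lra)).
    unfold Rm.
    match goal with |- Cmod ?X <= _ => replace X with ((G w - G (x, y)) + ((- (G p - l * p) + - l * w) - (- (G p - l * p) + - l * (x, y))))%C by ring end.
    eapply Rle_trans; [apply Cmod_triangle|]. lra. }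
  assert (E : rect_int Rm a b c d = rect_int G a b c d).
  { unfold Rm. rewrite rect_int_plus by (auto; apply AC). rewrite rect_int_affine; ring. }
  rewrite <- E. set (s := b - a + (d - c)).
  assert (B : forall x y, a <= x <= b -> c <= y <= d -> Cmod (Rm (x, y)) <= e * s).
  { intros x y Hx Hy. unfold Rm.
    replace (G (x, y) + (- (G p - l * p) + - l * (x, y)))%C with (G (x, y) - G p - l * ((x, y) - p))%C by ring.
    eapply Rle_trans; [apply HL; assumption|]. apply Rmult_le_compat_l; [lra|].
    eapply Rle_trans; [apply Cmod_le_abs|]. simpl. unfold s.
    apply Rplus_le_compat; apply Rabs_le; lra. }
  unfold rect_int.
  assert (Q1 : forall y, c <= y <= d -> Cmod (CInt (fun x => Rm (x, y)) a b) <= 2 * (e * s) * (b - a)).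
  { intros y Hy. apply CInt_bound; [lra|eapply rcont_on_hline; eauto; lra|intros; now apply B]. }
  assert (Q2 : forall x, a <= x <= b -> Cmod (CInt (fun y => Rm (x, y)) c d) <= 2 * (e * s) * (d - c)).
  { intros y Hy. apply CInt_bound; [lra|eapply rcont_on_vline; eauto; lra|intros; now apply B]. }
  eapply Rle_trans; [apply Cmod_minus_le|].
  eapply Rle_trans; [apply Rplus_le_compat_r, Cmod_minus_le|].
  eapply Rle_trans; [apply Rplus_le_compat_r, Rplus_le_compat_r, Cmod_triangle|].
  rewrite !Cmod_mult, Cmod_Ci.
  assert (R1 := Q1 c ltac:(lra)). assert (R2 := Q1 d ltac:(lra)).
  assert (R3 := Q2 a ltac:(lra)). assert (R4 := Q2 b ltac:(lra)).
  assert (S : b - a + (d - c) = s) by reflexivity.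
  replace (4 * e * s ^ 2) with (4 * (e * s) * (b - a + (d - c))) by (rewrite S; ring).
  lra.
Qed.

Lemma goursat (G : C -> C) (a b c d : R) : a <= b -> c <= d ->
  (forall x y, a <= x <= b -> c <= y <= d -> exists l, cderiv G (x, y) l) ->
  rect_int G a b c d = RtoC 0.
Proof.
  intros Hab Hcd HG.
  assert (CC : forall a' b' c' d', a <= a' -> b' <= b -> c <= c' -> d' <= d -> ccont_on_rect G a' b' c' d').
  { intros a' b' c' d' H1 H2 H3 H4 x y Hx Hy. destruct (HG x y) as [l Hl]; try lra. eapply cderiv_ccont, Hl. }
  assert (K : forall e, 0 < e -> Cmod (rect_int G a b c d) <= 4 * e * (b - a + (d - c)) ^ 2).
  { intros e He.
    apply (quartering_induction (fun a b c d => Cmod (rect_int G a b c d) <= 4 * e * (b - a + (d - c)) ^ 2)); try assumption.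
    - intros; apply Rle_dec.
    - intros a' b' c' d' Ha Hb Hc Hd m n q1 q2 q3 q4.
      rewrite (rect_int_quarter G a' m b' c' n d') by first [unfold m, n; lra | apply CC; lra].
      (* The bound is quadratic in the perimeter, and each quarter has half the perimeter; so the
         four bounds add up exactly to the bound of the whole. *)
      replace (4 * e * (b' - a' + (d' - c')) ^ 2) with
        (4 * e * (m - a' + (n - c')) ^ 2 + 4 * e * (b' - m + (n - c')) ^ 2
         + 4 * e * (m - a' + (d' - n)) ^ 2 + 4 * e * (b' - m + (d' - n)) ^ 2)
        by (unfold m, n; field).
      eapply Rle_trans; [apply Cmod_triangle|]. apply Rplus_le_compat; [|exact q4].
      eapply Rle_trans; [apply Cmod_triangle|]. apply Rplus_le_compat; [|exact q3].
      eapply Rle_trans; [apply Cmod_triangle|]. now apply Rplus_le_compat.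
    - intros x y Hx Hy. destruct (HG x y Hx Hy) as [l Hl].
      destruct (Hl e He) as [delta [Hd1 Hd]].
      exists (delta / 2); split; [lra|]. intros a' b' c' d' H1 H2 H3 H4 H5 H6.
      apply (rect_int_local_bound G a' b' c' d' e (x, y) l); simpl; try lra.
      + apply CC; lra.
      + intros x' y' Hx' Hy'. apply Hd.
        eapply Rle_lt_trans; [apply Cmod_le_abs|]. simpl.
        assert (Rabs (x' + - x) <= b' - a') by (apply Rabs_le; lra).
        assert (Rabs (y' + - y) <= d' - c') by (apply Rabs_le; lra). lra. }
  apply Cmod_eq_0. apply Rle_antisym; [|apply Cmod_ge_0].
  apply le_epsilon. intros eps Heps. rewrite Rplus_0_l.
  set (s := (b - a + (d - c)) ^ 2) in *.
  assert (Hs : 0 <= s) by apply pow2_ge_0.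
  (* [s + 1] instead of [s] covers the degenerate rectangle with [s = 0]. *)
  eapply Rle_trans; [apply (K (eps / (4 * (s + 1)))); apply Rdiv_lt_0_compat; lra|].
  replace (4 * (eps / (4 * (s + 1))) * s) with (eps * (s / (s + 1))) by (field; lra).
  rewrite <- (Rmult_1_r eps) at 2. apply Rmult_le_compat_l; [lra|].
  apply Rmult_le_reg_r with (s + 1); [lra|]. unfold Rdiv; rewrite Rmult_assoc, Rinv_l by lra; lra.
Qed.

(** * The complex exponential and integrals over circles *)

Definition Cexp (w : C) : C := (RtoC (exp (fst w)) * cis (snd w))%C.

Lemma Cexp_plus (v w : C) : Cexp (v + w) = (Cexp v * Cexp w)%C.
Proof. unfold Cexp; simpl. rewrite exp_plus, cis_plus, RtoC_mult. ring. Qed.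

Lemma derivable_pt_lim_small (f : R -> R) (l : R) : derivable_pt_lim f 0 l ->
  forall eps, 0 < eps -> exists d, 0 < d /\ forall x, Rabs x < d -> Rabs (f x - f 0 - l * x) <= eps * Rabs x.
Proof.
  intros H eps Heps. destruct (H eps Heps) as [d Hd]. exists d; split; [apply cond_pos|].
  intros x Hx. destruct (Req_dec x 0) as [->|N].
  - rewrite Rmult_0_r, Rabs_R0. replace (f 0 - f 0 - 0) with 0 by ring. rewrite Rabs_R0; lra.
  - specialize (Hd x N Hx). rewrite Rplus_0_l in Hd.
    replace (f x - f 0 - l * x) with (((f x - f 0) / x - l) * x) by (field; exact N).
    rewrite Rabs_mult. apply Rmult_le_compat_r; [apply Rabs_pos|lra].
Qed.

Lemma cderiv_Cexp_0 : cderiv Cexp (RtoC 0) (RtoC 1).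
Proof.
  intros eps Heps.
  (* The real part will contribute an error [3 * e * X] and the imaginary part [5 * e * X]. *)
  set (e := Rmin 1 (eps / 8)).
  assert (He : 0 < e) by (apply Rmin_pos; lra).
  assert (He1 : e <= 1) by apply Rmin_l. assert (He2 : e <= eps / 8) by apply Rmin_r.
  clearbody e.
  destruct (derivable_pt_lim_small exp 1 derivable_pt_lim_exp_0 e He) as [d1 [P1 D1]].
  assert (L2 := derivable_pt_lim_sin 0). rewrite cos_0 in L2.
  destruct (derivable_pt_lim_small sin 1 L2 e He) as [d2 [P2 D2]].
  assert (L3 := derivable_pt_lim_cos 0). rewrite sin_0, Ropp_0 in L3.
  destruct (derivable_pt_lim_small cos 0 L3 e He) as [d3 [P3 D3]].
  exists (Rmin e (Rmin d1 (Rmin d2 d3))); split; [repeat apply Rmin_pos; assumption|].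
  intros w Hw. destruct w as [x y].
  replace ((x, y) - RtoC 0)%C with ((x, y) : C) in * by (unfold Cminus, Cplus, Copp, RtoC; simpl; f_equal; ring).
  assert (M1 := Rmin_l e (Rmin d1 (Rmin d2 d3))). assert (M2 := Rmin_r e (Rmin d1 (Rmin d2 d3))).
  assert (M3 := Rmin_l d1 (Rmin d2 d3)). assert (M4 := Rmin_r d1 (Rmin d2 d3)).
  assert (M5 := Rmin_l d2 d3). assert (M6 := Rmin_r d2 d3).
  assert (Bx := Rabs_fst_le (x, y)). assert (By := Rabs_snd_le (x, y)). simpl in Bx, By.
  set (X := Cmod (x, y)) in *.
  specialize (D1 x ltac:(lra)). specialize (D2 y ltac:(lra)). specialize (D3 y ltac:(lra)).
  rewrite exp_0 in D1. rewrite sin_0 in D2. rewrite cos_0 in D3.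
  eapply Rle_trans; [apply Cmod_le_abs|].
  unfold Cexp, cis, Cmult, Cplus, Cminus, Copp, RtoC; simpl.
  rewrite exp_0, cos_0, sin_0.
  assert (Px := Rabs_pos x). assert (Py := Rabs_pos y).
  assert (T1 : Rabs (exp x * cos y - 0 * sin y + - (1 * 1 - 0 * 0) + - (1 * x - 0 * y)) <= 3 * e * X).
  { replace (exp x * cos y - 0 * sin y + - (1 * 1 - 0 * 0) + - (1 * x - 0 * y))
      with ((exp x - 1 - 1 * x) * cos y + (1 + x) * (cos y - 1 - 0 * y)) by ring.
    eapply Rle_trans; [apply Rabs_triang|]. rewrite !Rabs_mult.
    assert (C1 : Rabs (cos y) <= 1) by (apply Rabs_le, COS_bound).
    assert (C2 : Rabs (1 + x) <= 2) by (apply Rabs_le; assert (A := Rle_abs x); assert (A' := Rle_abs (- x)); rewrite Rabs_Ropp in A'; lra).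
    assert (Rabs (exp x - 1 - 1 * x) * Rabs (cos y) <= (e * Rabs x) * 1)
      by (apply Rmult_le_compat; auto using Rabs_pos).
    assert (Rabs (1 + x) * Rabs (cos y - 1 - 0 * y) <= 2 * (e * Rabs y))
      by (apply Rmult_le_compat; auto using Rabs_pos).
    nra. }
  assert (T2 : Rabs (exp x * sin y + 0 * cos y + - (1 * 0 + 0 * 1) + - (1 * y + 0 * x)) <= 5 * e * X).
  { replace (exp x * sin y + 0 * cos y + - (1 * 0 + 0 * 1) + - (1 * y + 0 * x))
      with ((exp x - 1 - 1 * x) * sin y + x * sin y + (sin y - 0 - 1 * y)) by ring.
    eapply Rle_trans; [apply Rabs_triang|].
    eapply Rle_trans; [apply Rplus_le_compat_r, Rabs_triang|]. rewrite !Rabs_mult.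
    assert (C1 : Rabs (sin y) <= 1) by (apply Rabs_le, SIN_bound).
    assert (C2 : Rabs (sin y) <= 2 * X).
    { replace (sin y) with ((sin y - 0 - 1 * y) + y) by ring.
      eapply Rle_trans; [apply Rabs_triang|]. nra. }
    assert (Rabs (exp x - 1 - 1 * x) * Rabs (sin y) <= (e * Rabs x) * 1)
      by (apply Rmult_le_compat; auto using Rabs_pos).
    assert (Rabs x * Rabs (sin y) <= e * (2 * X))
      by (apply Rmult_le_compat; auto using Rabs_pos; lra).
    nra. }
  match goal with |- Rabs ?A + Rabs ?B <= _ =>
    replace A with (exp x * cos y - 0 * sin y + - (1 * 1 - 0 * 0) + - (1 * x - 0 * y)) by ring;
    replace B with (exp x * sin y + 0 * cos y + - (1 * 0 + 0 * 1) + - (1 * y + 0 * x)) by ring end.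
  assert (0 <= X) by apply Cmod_ge_0. nra.
Qed.

Lemma cderiv_Cexp (w : C) : cderiv Cexp w (Cexp w).
Proof.
  intros eps Heps.
  assert (HK := Cmod_ge_0 (Cexp w)).
  destruct (cderiv_Cexp_0 (eps / (Cmod (Cexp w) + 1))) as [d [Hd1 Hd]]; [apply Rdiv_lt_0_compat; lra|].
  exists d; split; [exact Hd1|]. intros v Hv.
  assert (E0 : Cexp (RtoC 0) = RtoC 1) by (unfold Cexp; simpl; rewrite exp_0, cis_0; ring).
  specialize (Hd (v - w)%C). rewrite E0 in Hd.
  replace (v - w - RtoC 0)%C with (v - w)%C in Hd by ring. specialize (Hd Hv).
  replace v with (w + (v - w))%C at 1 by ring. rewrite Cexp_plus.
  replace (Cexp w * Cexp (v - w) - Cexp w - Cexp w * (v - w))%C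
    with (Cexp w * (Cexp (v - w) - RtoC 1 - RtoC 1 * (v - w)))%C by ring.
  rewrite Cmod_mult.
  eapply Rle_trans; [apply Rmult_le_compat_l; [exact HK|exact Hd]|].
  replace (Cmod (Cexp w) * (eps / (Cmod (Cexp w) + 1) * Cmod (v - w)))
    with ((Cmod (Cexp w) / (Cmod (Cexp w) + 1)) * (eps * Cmod (v - w))) by (field; lra).
  rewrite <- (Rmult_1_l (eps * Cmod (v - w))) at 2.
  apply Rmult_le_compat_r; [apply Rmult_le_pos; [lra|apply Cmod_ge_0]|].
  apply Rmult_le_reg_r with (Cmod (Cexp w) + 1); [lra|].
  unfold Rdiv; rewrite Rmult_assoc, Rinv_l by lra; lra.
Qed.

(** Integration against the angle, that is against [dz / (i z)]: this is the form that does not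
    depend on the radius when [h] is holomorphic on an annulus. *)
Definition circle_int (h : C -> C) (r : R) : C := CInt (fun t => h (RtoC r * cis t)%C) 0 (2 * PI).

(** In logarithmic coordinates the annulus is the rectangle with sides [[ln r1, ln r2]] and
    [[0, 2 PI]]. The two horizontal sides cancel by periodicity of the exponential, and the vertical
    sides are the two circle integrals times [i]. *)
Lemma circle_int_annulus (h : C -> C) (r1 r2 : R) : 0 < r1 -> r1 <= r2 ->
  (forall z, r1 <= Cmod z <= r2 -> exists l, cderiv h z l) ->
  circle_int h r1 = circle_int h r2.
Proof.
  intros H1 H2 Hh.
  set (G := fun w => h (Cexp w)).
  assert (L : ln r1 <= ln r2) by (destruct H2 as [H2| ->]; [left; apply ln_increasing; lra|right; reflexivity]).
  assert (HPI := PI_RGT_0).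
  assert (Z : rect_int G (ln r1) (ln r2) 0 (2 * PI) = RtoC 0).
  { apply goursat; [exact L|lra|]. intros x y Hx Hy.
    destruct (Hh (Cexp (x, y))) as [l Hl].
    - unfold Cexp; simpl. rewrite Cmod_mult, Cmod_cis, Rmult_1_r, Cmod_R, Rabs_pos_eq by (left; apply exp_pos).
      rewrite <- (exp_ln r1), <- (exp_ln r2) by lra.
      split; [destruct Hx as [[Hx|Hx] _]|destruct Hx as [_ [Hx|Hx]]];
        first [left; now apply exp_increasing | right; now f_equal].
    - exists (l * Cexp (x, y))%C. apply (cderiv_comp h Cexp); [apply cderiv_Cexp|exact Hl]. }
  unfold rect_int in Z.
  assert (E1 : CInt (fun x => G (x, 0)) (ln r1) (ln r2) = CInt (fun x => G (x, 2 * PI)) (ln r1) (ln r2)).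
  { apply CInt_ext; intros t _. unfold G, Cexp; simpl.
    replace (cis 0) with (cis (2 * PI)); [reflexivity|]. rewrite <- (cis_period 0). f_equal; ring. }
  assert (E2 : forall r, 0 < r -> CInt (fun y => G (ln r, y)) 0 (2 * PI) = circle_int h r).
  { intros r Hr. apply CInt_ext; intros t _. unfold G, Cexp; simpl. now rewrite exp_ln. }
  rewrite E1, !E2 in Z by lra.
  apply Ceq_minus.
  assert (Z' : (Ci * (circle_int h r1 - circle_int h r2))%C = RtoC 0).
  { transitivity (- RtoC 0)%C; [rewrite <- Z; ring|ring]. }
  replace (circle_int h r1 - circle_int h r2)%C with (- Ci * (Ci * (circle_int h r1 - circle_int h r2)))%C.
  - rewrite Z'; ring.
  - replace (- Ci * (Ci * (circle_int h r1 - circle_int h r2)))%C with (- (Ci * Ci) * (circle_int h r1 - circle_int h r2))%C by ring.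
    replace (Ci * Ci)%C with (- RtoC 1)%C; [ring|]. unfold Ci, Cmult, Copp, RtoC; simpl; f_equal; ring.
Qed.

Lemma rcont_circle (h : C -> C) (r t : R) :
  ccont h (RtoC r * cis t)%C -> rcont (fun s => h (RtoC r * cis s)%C) t.
Proof.
  intros H. apply (rcont_comp h (fun s => RtoC r * cis s)%C); [|exact H].
  apply rcont_mult; [apply rcont_const|apply rcont_cis].
Qed.

Lemma Cmod_circle (r t : R) : 0 <= r -> Cmod (RtoC r * cis t)%C = r.
Proof. intros H. now rewrite Cmod_mult, Cmod_cis, Rmult_1_r, Cmod_R, Rabs_pos_eq. Qed.

Lemma continuity_2d_circle (h : C -> C) (p : C -> R) (r t : R) :
  (forall z, Rabs (p z) <= Cmod z) -> (forall z w, p (z - w)%C = p z - p w) ->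
  ccont h (RtoC r * cis t)%C ->
  continuity_2d_pt (fun r t => p (h (RtoC r * cis t)%C)) r t.
Proof.
  intros Hp Hm H eps.
  destruct (H (eps / 2)) as [d [Hd1 Hd]]; [assert (P := cond_pos eps); lra|].
  assert (Hr := Rabs_pos r).
  destruct (rcont_cis t (d / (2 * (Rabs r + 1)))) as [d' [Hd1' Hd']]; [apply Rdiv_lt_0_compat; lra|].
  assert (Hm' : 0 < Rmin (d / 2) d') by (apply Rmin_pos; lra).
  exists (mkposreal _ Hm'). intros u v Hu Hv. simpl in Hu, Hv.
  assert (E1 := Rmin_l (d / 2) d'). assert (E2 := Rmin_r (d / 2) d').
  rewrite <- Hm. eapply Rle_lt_trans; [apply Hp|].
  apply Rle_lt_trans with (eps / 2); [|assert (P := cond_pos eps); lra].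
  apply Hd.
  replace (RtoC u * cis v - RtoC r * cis t)%C with (RtoC (u - r) * cis v + RtoC r * (cis v - cis t))%C
    by (rewrite RtoC_minus; ring).
  eapply Rle_lt_trans; [apply Cmod_triangle|].
  rewrite !Cmod_mult, Cmod_cis, !Cmod_R.
  specialize (Hd' v ltac:(lra)).
  assert (Rabs r * Cmod (cis v - cis t) <= d / 2).
  { apply Rle_trans with ((Rabs r + 1) * (d / (2 * (Rabs r + 1)))).
    - apply Rmult_le_compat; try lra. apply Cmod_ge_0.
    - right; field; lra. }
  lra.
Qed.

Lemma circle_int_continuous (h : C -> C) (r0 eps : R) : 0 <= r0 -> 0 < eps ->
  (forall z, Cmod z = r0 -> ccont h z) ->
  exists delta, 0 < delta /\ forall r, 0 <= r -> Rabs (r - r0) < delta ->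
    (forall z, Cmod z = r -> ccont h z) -> Cmod (circle_int h r - circle_int h r0) <= eps.
Proof.
  intros Hr0 Heps H. assert (HPI := PI_RGT_0).
  (* Two coordinates, the factor 2 of [CInt_bound] and the length [2 * PI] multiply to [8 * PI]. *)
  assert (He : 0 < eps / (8 * PI)) by (apply Rdiv_lt_0_compat; lra).
  destruct (uniform_continuity_2d_1d' (fun r t => fst (h (RtoC r * cis t)%C)) 0 (2 * PI) r0) with (eps := mkposreal _ He) as [d1 Hd1].
  { intros t Ht. apply (continuity_2d_circle h fst); [apply Rabs_fst_le|reflexivity|].
    apply H, Cmod_circle, Hr0. }
  destruct (uniform_continuity_2d_1d' (fun r t => snd (h (RtoC r * cis t)%C)) 0 (2 * PI) r0) with (eps := mkposreal _ He) as [d2 Hd2].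
  { intros t Ht. apply (continuity_2d_circle h snd); [apply Rabs_snd_le|reflexivity|].
    apply H, Cmod_circle, Hr0. }
  exists (Rmin d1 d2); split; [apply Rmin_pos; apply cond_pos|].
  intros r Hr Hrr Hc.
  assert (E1 := Rmin_l d1 d2). assert (E2 := Rmin_r d1 d2).
  assert (Hrr' := Hrr). apply Rabs_def2 in Hrr'.
  assert (P1 := cond_pos d1). assert (P2 := cond_pos d2).
  unfold circle_int.
  rewrite <- CInt_minus; try (intros t _; apply rcont_circle; first [solve [apply H; now apply Cmod_circle]|apply Hc; now apply Cmod_circle]).
  eapply Rle_trans; [apply (CInt_bound _ _ _ (2 * (eps / (8 * PI))))|].
  - lra.
  - intros t _. apply rcont_plus; [|apply rcont_opp]; apply rcont_circle; first [solve [apply H; now apply Cmod_circle]|apply Hc; now apply Cmod_circle].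
  - intros t Ht. eapply Rle_trans; [apply Cmod_le_abs|].
    assert (Q1 := Hd1 t r0 t r ltac:(lra) ltac:(lra) ltac:(lra) ltac:(lra)).
    assert (Q2 := Hd2 t r0 t r ltac:(lra) ltac:(lra) ltac:(lra) ltac:(lra)).
    replace (t - t) with 0 in Q1, Q2 by ring. rewrite Rabs_R0 in Q1, Q2.
    specialize (Q1 P1). specialize (Q2 P2). simpl in Q1, Q2 |- *. unfold Rminus in Q1, Q2. lra.
  - right; field; lra.
Qed.

(** The closed annulus between [r1 + e] and [r2 - e] is covered by the previous case, and continuity
    in the radius removes [e]. The value [r1 = 0] is allowed: there the integral is [2 PI] times the
    value at the centre. *)
Lemma circle_int_open_annulus (h : C -> C) (r1 r2 : R) : 0 <= r1 -> r1 <= r2 ->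
  (forall z, r1 < Cmod z < r2 -> exists l, cderiv h z l) ->
  (forall z, r1 <= Cmod z <= r2 -> ccont h z) ->
  circle_int h r1 = circle_int h r2.
Proof.
  intros H0 H12 Hd Hc.
  destruct H12 as [H12| ->]; [|reflexivity].
  apply Ceq_minus, Cmod_eq_0, Rle_antisym; [|apply Cmod_ge_0].
  apply le_epsilon. intros eps Heps. rewrite Rplus_0_l.
  destruct (circle_int_continuous h r1 (eps / 2) H0 ltac:(lra)) as [d1 [P1 D1]].
  { intros z Hz; apply Hc; lra. }
  destruct (circle_int_continuous h r2 (eps / 2) ltac:(lra) ltac:(lra)) as [d2 [P2 D2]].
  { intros z Hz; apply Hc; lra. }
  set (e := Rmin ((r2 - r1) / 3) (Rmin (d1 / 2) (d2 / 2))).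
  assert (He : 0 < e) by (repeat apply Rmin_pos; lra).
  assert (E1 : e <= (r2 - r1) / 3) by apply Rmin_l.
  assert (E2 : e <= d1 / 2) by (eapply Rle_trans; [apply Rmin_r|apply Rmin_l]).
  assert (E3 : e <= d2 / 2) by (eapply Rle_trans; [apply Rmin_r|apply Rmin_r]).
  assert (A : circle_int h (r1 + e) = circle_int h (r2 - e)).
  { apply circle_int_annulus; try lra. intros z Hz; apply Hd; lra. }
  specialize (D1 (r1 + e) ltac:(lra)). specialize (D2 (r2 - e) ltac:(lra)).
  replace (r1 + e - r1) with e in D1 by ring. replace (r2 - e - r2) with (- e) in D2 by ring.
  rewrite Rabs_Ropp in D2. rewrite Rabs_pos_eq in D1, D2 by lra.
  specialize (D1 ltac:(lra) ltac:(intros z Hz; apply Hc; lra)).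
  specialize (D2 ltac:(lra) ltac:(intros z Hz; apply Hc; lra)).
  replace (circle_int h r1 - circle_int h r2)%C
    with ((circle_int h (r2 - e) - circle_int h r2) - (circle_int h (r1 + e) - circle_int h r1))%C by (rewrite A; ring).
  eapply Rle_trans; [apply Cmod_minus_le|]. lra.
Qed.

(* The exceptional radius [s], where only continuity is required, is what lets the lemma apply to
   difference quotients. *)
Lemma circle_int_mean_value (h : C -> C) (s r : R) : 0 <= s <= r ->
  (forall z, 0 < Cmod z < r -> Cmod z <> s -> exists l, cderiv h z l) ->
  (forall z, Cmod z <= r -> ccont h z) ->
  circle_int h r = (RtoC (2 * PI) * h (RtoC 0))%C.
Proof.
  intros [Hs Hr] Hd Hc.
  rewrite <- (circle_int_open_annulus h s r) by
    first [lra | intros z Hz; apply Hd; lra | intros z Hz; apply Hc; lra].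
  rewrite <- (circle_int_open_annulus h 0 s) by
    first [lra | intros z Hz; apply Hd; lra | intros z Hz; apply Hc; lra].
  unfold circle_int.
  rewrite (CInt_ext _ (fun _ => h (RtoC 0))) by (intros t _; f_equal; ring).
  rewrite CInt_const. f_equal. f_equal; ring.
Qed.

(** * Taylor expansion in the unit disk *)

Fixpoint Csum (a : nat -> C) (n : nat) : C :=
  match n with O => RtoC 0 | S m => (Csum a m + a m)%C end.

Lemma Csum_ext (a b : nat -> C) (n : nat) :
  (forall k, (k < n)%nat -> a k = b k) -> Csum a n = Csum b n.
Proof.
  induction n as [|n IH]; intros H; [reflexivity|simpl].
  rewrite IH, H by auto with arith. reflexivity.
Qed.

Lemma Csum_plus (a b : nat -> C) (n : nat) :
  Csum (fun k => a k + b k)%C n = (Csum a n + Csum b n)%C.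
Proof. induction n as [|n IH]; simpl; [ring|rewrite IH; ring]. Qed.

Lemma Csum_scal (c : C) (a : nat -> C) (n : nat) :
  Csum (fun k => c * a k)%C n = (c * Csum a n)%C.
Proof. induction n as [|n IH]; simpl; [ring|rewrite IH; ring]. Qed.

Lemma Csum_conj (a : nat -> C) (n : nat) :
  Cconj (Csum a n) = Csum (fun k => Cconj (a k)) n.
Proof.
  induction n as [|n IH]; simpl; [|rewrite Cplus_conj, IH; reflexivity].
  unfold Cconj, RtoC; simpl; f_equal; ring.
Qed.

Lemma rcont_Csum (f : nat -> R -> C) (n : nat) (t : R) :
  (forall k, rcont (f k) t) -> rcont (fun s => Csum (fun k => f k s) n) t.
Proof.
  intros H; induction n as [|n IH]; simpl; [apply rcont_const|].
  apply rcont_plus; [exact IH|apply H].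
Qed.

Lemma CInt_Csum (f : nat -> R -> C) (n : nat) (a b : R) :
  (forall k, rcont_on (f k) a b) ->
  CInt (fun t => Csum (fun k => f k t) n) a b = Csum (fun k => CInt (f k) a b) n.
Proof.
  intros H; induction n as [|n IH]; simpl.
  - rewrite CInt_const; ring.
  - rewrite CInt_plus, IH; [reflexivity| |apply H].
    intros t Ht; apply rcont_Csum; intros k; now apply H.
Qed.

Lemma geometric_split (w : C) (n : nat) : w <> RtoC 1 ->
  (/ (RtoC 1 - w) = Csum (fun k => w ^ k) n + w ^ n * / (RtoC 1 - w))%C.
Proof.
  intros Hw. assert (N : (RtoC 1 - w)%C <> RtoC 0) by (apply Cminus_eq_contra; congruence).
  induction n as [|n IH]; simpl; [ring|].
  rewrite IH at 1. field. exact N.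
Qed.

Definition holo (f : C -> C) : Prop := forall z, unit_disk z -> exists l, cderiv f z l.

Lemma holo_ccont (f : C -> C) (z : C) : holo f -> Cmod z < 1 -> ccont f z.
Proof. intros H Hz. destruct (H z Hz) as [l Hl]. eapply cderiv_ccont, Hl. Qed.

(** Cauchy's integral for the Taylor coefficient. The radius 1/2 is arbitrary: [circle_int_tcoef]
    replaces it by any radius in [(0, 1)]. *)
Definition tcoef (f : C -> C) (k : nat) : C :=
  (RtoC (/ (2 * PI)) * circle_int (fun z => f z * / (z ^ k))%C (1 / 2))%C.

Lemma two_PI_inv : (RtoC (2 * PI) * RtoC (/ (2 * PI)))%C = RtoC 1.
Proof. rewrite <- RtoC_mult. f_equal. assert (H := PI_RGT_0). field; lra. Qed.

Lemma cderiv_div_pow (f : C -> C) (k : nat) (z : C) : holo f -> 0 < Cmod z < 1 ->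
  exists l, cderiv (fun z => f z * / (z ^ k))%C z l.
Proof.
  intros Hf Hz. destruct (Hf z ltac:(apply Hz)) as [l Hl].
  assert (Z : z <> RtoC 0) by (apply Cmod_gt_0; lra).
  eexists. apply cderiv_mult; [exact Hl|].
  apply (cderiv_comp Cinv (fun w => w ^ k)%C); [apply cderiv_Cpow|].
  apply cderiv_inv. now apply Cpow_nz.
Qed.

Lemma circle_int_tcoef (f : C -> C) (k : nat) (r : R) : holo f -> 0 < r < 1 ->
  circle_int (fun z => f z * / (z ^ k))%C r = (RtoC (2 * PI) * tcoef f k)%C.
Proof.
  intros Hf Hr. unfold tcoef. rewrite Cmult_assoc, two_PI_inv, Cmult_1_l.
  destruct (Rle_dec r (1 / 2)) as [H|H]; [|symmetry];
    apply circle_int_annulus; try lra; intros z Hz; apply cderiv_div_pow; auto; lra.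
Qed.

Lemma cis_conj_inv (t : R) : (/ cis t)%C = cis (- t).
Proof.
  assert (H : (cis t * cis (- t))%C = RtoC 1) by (rewrite <- cis_plus, Rplus_opp_r; apply cis_0).
  assert (N := cis_neq_0 t).
  replace (cis (- t)) with (/ cis t * (cis t * cis (- t)))%C by (field; exact N).
  rewrite H; ring.
Qed.

Lemma fourier_nonneg (f : C -> C) (k : nat) (r : R) : holo f -> 0 < r < 1 ->
  CInt (fun t => f (RtoC r * cis t) * cis (- (INR k * t)))%C 0 (2 * PI)
  = (RtoC (2 * PI) * (tcoef f k * RtoC r ^ k))%C.
Proof.
  intros Hf Hr.
  assert (R0 : RtoC r <> RtoC 0) by (apply RtoC_neq_0; lra).
  rewrite Cmult_assoc, <- (circle_int_tcoef f k r Hf Hr), Cmult_comm.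
  unfold circle_int. rewrite <- CInt_scal.
  - apply CInt_ext; intros t _.
    rewrite <- cis_conj_inv, cis_INR, Cpow_mult_l. field.
    split; apply Cpow_nz; [apply cis_neq_0|exact R0].
  - intros t _. apply (rcont_circle (fun z => f z * / z ^ k)%C).
    destruct (cderiv_div_pow f k (RtoC r * cis t)%C Hf) as [l Hl]; [rewrite Cmod_circle; lra|].
    eapply cderiv_ccont, Hl.
Qed.

(** Up to a power of [r] the integrand is [f z * z ^ S m] on the circle; it is holomorphic and
    vanishes at 0, so the mean value property gives 0. *)
Lemma fourier_neg (f : C -> C) (m : nat) (r : R) : holo f -> 0 < r < 1 ->
  CInt (fun t => f (RtoC r * cis t) * cis (INR (S m) * t))%C 0 (2 * PI) = RtoC 0.
Proof.
  intros Hf Hr.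
  assert (R0 : RtoC r <> RtoC 0) by (apply RtoC_neq_0; lra).
  set (h := fun z => (f z * z ^ S m)%C).
  assert (Hh : forall z, Cmod z < 1 -> exists l, cderiv h z l).
  { intros z Hz. destruct (Hf z Hz) as [l Hl]. eexists.
    apply cderiv_mult; [exact Hl|apply cderiv_Cpow]. }
  assert (Z : circle_int h r = RtoC 0).
  { rewrite (circle_int_mean_value h 0 r).
    - unfold h; simpl; ring.
    - lra.
    - intros z Hz _; apply Hh; lra.
    - intros z Hz. destruct (Hh z) as [l Hl]; [lra|]. eapply cderiv_ccont, Hl. }
  transitivity (/ (RtoC r ^ S m) * circle_int h r)%C; [|rewrite Z; ring].
  unfold circle_int. rewrite <- CInt_scal.
  - apply CInt_ext; intros t _. unfold h. rewrite cis_INR, Cpow_mult_l. field.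
    now apply Cpow_nz.
  - intros t _. apply (rcont_circle h).
    destruct (Hh (RtoC r * cis t)%C) as [l Hl]; [rewrite Cmod_circle; lra|]. eapply cderiv_ccont, Hl.
Qed.

Lemma CInt_cis_neg (k : nat) : CInt (fun t => cis (- (INR (S k) * t))) 0 (2 * PI) = RtoC 0.
Proof.
  rewrite (CInt_ext _ (fun t => Cconj (cis (INR (S k) * t)))) by (intros; apply cis_opp).
  rewrite CInt_conj by (intros t _; apply rcont_cis_scal).
  assert (H : CInt (fun t => RtoC 1 * cis (INR (S k) * t))%C 0 (2 * PI) = RtoC 0).
  { apply (fourier_neg (fun _ => RtoC 1) k (1 / 2)); [|lra].
    intros z _; exists (RtoC 0); apply cderiv_const. }
  rewrite (CInt_ext _ (fun t => RtoC 1 * cis (INR (S k) * t))%C), H by (intros; ring).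
  unfold Cconj, RtoC; simpl; f_equal; ring.
Qed.

(** The passage [r -> 1], used for the Cauchy estimate and for the extremal inequality. *)
Lemma le_of_le_left_1 (phi : R -> R) (b : R) : continuity_pt phi 1 ->
  (forall r, 0 < r < 1 -> phi r <= b) -> phi 1 <= b.
Proof.
  intros Hc Hb. apply Rnot_lt_le. intros N.
  destruct (proj1 (continuity_pt_locally phi 1) Hc (mkposreal (phi 1 - b) ltac:(lra))) as [d Hd].
  assert (P := cond_pos d).
  set (r := 1 - Rmin (1 / 2) (d / 2)).
  assert (E1 := Rmin_l (1 / 2) (d / 2)). assert (E2 := Rmin_r (1 / 2) (d / 2)).
  assert (E3 : 0 < Rmin (1 / 2) (d / 2)) by (apply Rmin_pos; lra).
  specialize (Hb r ltac:(unfold r; lra)).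
  assert (A : Rabs (phi r - phi 1) < phi 1 - b).
  { apply Hd. change (Rabs (r - 1) < d). rewrite Rabs_left1; unfold r; lra. }
  apply Rabs_def2 in A. lra.
Qed.

(** Cauchy's estimate at radius [r]; letting [r -> 1] removes the power [r ^ k], so the bound is
    uniform in [k]. *)
Lemma tcoef_bound (f : C -> C) (M : R) (k : nat) : holo f ->
  (forall z, unit_disk z -> Cmod (f z) <= M) -> Cmod (tcoef f k) <= 2 * M.
Proof.
  intros Hf HM. assert (HPI := PI_RGT_0).
  rewrite <- (Rmult_1_r (Cmod (tcoef f k))), <- (pow1 k).
  apply (le_of_le_left_1 (fun r => Cmod (tcoef f k) * r ^ k)).
  { apply continuity_pt_filterlim.
    apply (ex_derive_continuous (K := R_AbsRing) (V := R_NormedModule) (fun r : R => Cmod (tcoef f k) * r ^ k) 1).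
    auto_derive; easy. }
  intros r Hr.
  assert (A : Cmod (RtoC (2 * PI) * (tcoef f k * RtoC r ^ k))%C <= 2 * M * (2 * PI - 0)).
  { rewrite <- fourier_nonneg by assumption. apply CInt_bound; [lra| |].
    - intros t _. apply rcont_mult; [|apply rcont_cis_opp_scal].
      apply rcont_circle, holo_ccont; [exact Hf|rewrite Cmod_circle; lra].
    - intros t _. rewrite Cmod_mult, Cmod_cis, Rmult_1_r. apply HM. unfold unit_disk. rewrite Cmod_circle; lra. }
  rewrite !Cmod_mult, Cmod_pow, !Cmod_R, (Rabs_pos_eq (2 * PI)), (Rabs_pos_eq r) in A by lra.
  apply Rmult_le_reg_l with (2 * PI); lra.
Qed.

(** The function [w (f w - f z) / (w - z)] vanishes at 0, so its mean over [|w| = r] is 0. On that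
    circle [w / (w - z) = 1 / (1 - z / w)] is expanded as a geometric sum of length [n] plus
    remainder: the sum produces the Taylor polynomial minus [f z], the remainder is estimated
    directly. *)
Lemma taylor_remainder (f : C -> C) (M r : R) (z : C) (n : nat) : holo f ->
  (forall w, unit_disk w -> Cmod (f w) <= M) -> Cmod z < r -> r < 1 ->
  Cmod (f z - Csum (fun k => tcoef f k * z ^ k) n)%C <= 4 * M * (Cmod z / r) ^ n / (1 - Cmod z / r).
Proof.
  intros Hf HM Hz Hr. assert (HPI := PI_RGT_0).
  assert (Z0 := Cmod_ge_0 z).
  assert (R0 : RtoC r <> RtoC 0) by (apply RtoC_neq_0; lra).
  destruct (Hf z) as [l Hl]; [unfold unit_disk; lra|].
  set (D := fun w => (f w - f z)%C).
  (* The difference quotient is completed by the derivative [l] at [w = z]; this makes [h]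
     continuous there, while its differentiability at [z] is not known yet. *)
  set (h := fun w => (w * (if Ceq_dec w z then l else D w * / (w - z)))%C).
  assert (Hd : forall w, Cmod w < 1 -> w <> z -> exists l', cderiv h w l').
  { intros w Hw N. destruct (Hf w Hw) as [l' Hl'].
    eexists. apply (cderiv_ext_loc (fun w => w * (D w * / (w - z)))%C) with (r := Cmod (w - z)).
    - apply Cmod_gt_0. now apply Cminus_eq_contra.
    - intros v Hv. unfold h. destruct (Ceq_dec v z) as [->|]; [|reflexivity].
      rewrite Cmod_minus_sym in Hv; lra.
    - apply (cderiv_mult (fun w => w)); [apply cderiv_id|].
      apply cderiv_mult.
      + unfold D, Cminus. apply cderiv_plus; [exact Hl'|apply cderiv_const].
      + apply (cderiv_comp Cinv (fun w => w - z)%C).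
        * unfold Cminus; apply cderiv_plus; [apply cderiv_id|apply cderiv_const].
        * apply cderiv_inv. now apply Cminus_eq_contra. }
  assert (Hc : forall w, Cmod w < 1 -> ccont h w).
  { intros w Hw. destruct (Ceq_dec w z) as [->|N].
    2:{ destruct (Hd w Hw N) as [l' Hl']. eapply cderiv_ccont, Hl'. }
    intros eps Heps. assert (L0 := Cmod_ge_0 l).
    destruct (Hl (eps / 4)) as [d [Hd1 Hd2]]; [lra|].
    exists (Rmin (Rmin d 1) (eps / (2 * (Cmod l + 1)))). split.
    { repeat apply Rmin_pos; try lra. apply Rdiv_lt_0_compat; lra. }
    intros w Hw'.
    assert (E1 := Rmin_l (Rmin d 1) (eps / (2 * (Cmod l + 1)))). assert (E2 := Rmin_r (Rmin d 1) (eps / (2 * (Cmod l + 1)))).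
    assert (E3 := Rmin_l d 1). assert (E4 := Rmin_r d 1).
    unfold h. destruct (Ceq_dec z z) as [_|]; [|congruence].
    destruct (Ceq_dec w z) as [->|N].
    { replace (z * l - z * l)%C with (RtoC 0) by ring. rewrite Cmod_0; lra. }
    assert (NZ : (w - z)%C <> RtoC 0) by now apply Cminus_eq_contra.
    assert (P := proj1 (Cmod_gt_0 _) NZ).
    replace (w * (D w * / (w - z)) - z * l)%C
      with (w * ((f w - f z - l * (w - z)) * / (w - z)) + (w - z) * l)%C by (unfold D; field; exact NZ).
    eapply Rle_trans; [apply Cmod_triangle|]. rewrite !Cmod_mult, Cmod_inv by exact NZ.
    specialize (Hd2 w ltac:(lra)).
    assert (Q : Cmod (f w - f z - l * (w - z)) * / Cmod (w - z) <= eps / 4).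
    { apply Rmult_le_reg_r with (Cmod (w - z)); [exact P|]. rewrite Rmult_assoc, Rinv_l by lra; lra. }
    assert (Q0 : 0 <= Cmod (f w - f z - l * (w - z)) * / Cmod (w - z)).
    { apply Rmult_le_pos; [apply Cmod_ge_0|left; now apply Rinv_0_lt_compat]. }
    assert (W : Cmod w <= 2).
    { replace w with ((w - z) + z)%C by ring. eapply Rle_trans; [apply Cmod_triangle|]. lra. }
    assert (Cmod w * (Cmod (f w - f z - l * (w - z)) * / Cmod (w - z)) <= 2 * (eps / 4))
      by (apply Rmult_le_compat; auto using Cmod_ge_0).
    assert (Cmod (w - z) * Cmod l <= eps / 2).
    { apply Rle_trans with (eps / (2 * (Cmod l + 1)) * (Cmod l + 1)).
      - apply Rmult_le_compat; lra.
      - right; field; lra. }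
    lra. }
  assert (Z : circle_int h r = RtoC 0).
  (* The circle through [z] is the exceptional one, where continuity suffices. *)
  { rewrite (circle_int_mean_value h (Cmod z) r).
    - unfold h; ring.
    - lra.
    - intros w Hw N; apply Hd; [lra|congruence].
    - intros w Hw; apply Hc; lra. }
  set (q := Cmod z / r).
  assert (Hq : 0 <= q < 1).
  { unfold q; split; [apply Rmult_le_pos; [lra|left; apply Rinv_0_lt_compat; lra]|].
    apply Rmult_lt_reg_r with r; [lra|]. unfold Rdiv; rewrite Rmult_assoc, Rinv_l; lra. }
  set (om := fun t => (z * / (RtoC r * cis t))%C).
  assert (ZT : forall t, (RtoC r * cis t)%C <> RtoC 0) by (intros; apply Cmult_neq_0; [exact R0|apply cis_neq_0]).
  assert (Hom : forall t, Cmod (om t) = q).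
  { intros t. unfold om. rewrite Cmod_mult, Cmod_inv, Cmod_circle by (auto; lra). reflexivity. }
  assert (Hom1 : forall t, om t <> RtoC 1).
  { intros t E. assert (A := Hom t). rewrite E, Cmod_1 in A. lra. }
  assert (C1 : forall t, rcont (fun t => D (RtoC r * cis t)%C) t).
  { intros t. apply (rcont_circle D). unfold D, Cminus.
    destruct (Hf (RtoC r * cis t)%C) as [l' Hl']; [unfold unit_disk; rewrite Cmod_circle; lra|].
    eapply cderiv_ccont, cderiv_plus; [exact Hl'|apply cderiv_const]. }
  assert (C2 : forall t, rcont om t).
  { intros t. apply (rcont_circle (fun w => z * / w)%C).
    eapply cderiv_ccont, cderiv_mult; [apply cderiv_const|].
    apply cderiv_inv, ZT. }
  assert (C3 : forall k t, rcont (fun t => om t ^ k)%C t).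
  { intros k t. apply (rcont_comp (fun w => w ^ k)%C om); [apply C2|eapply cderiv_ccont, cderiv_Cpow]. }
  assert (C4 : forall t, rcont (fun t => / (RtoC 1 - om t))%C t).
  { intros t. apply (rcont_comp (fun w => / (RtoC 1 - w))%C om); [apply C2|].
    eapply cderiv_ccont. apply (cderiv_comp Cinv (fun w => RtoC 1 - w)%C).
    - unfold Cminus. apply cderiv_plus; [apply cderiv_const|apply cderiv_opp, cderiv_id].
    - apply cderiv_inv, Cminus_eq_contra. intros E; apply (Hom1 t); now symmetry. }
  set (rem := fun t => (D (RtoC r * cis t) * (om t ^ n * / (RtoC 1 - om t)))%C).
  assert (C5 : forall t, rcont rem t) by (intros t; repeat apply rcont_mult; auto).
  (* The constant [f z] inside [D] is orthogonal to all frequencies but 0, so it is subtracted only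
     in the term [k = 0]. *)
  assert (CT : forall k, CInt (fun t => D (RtoC r * cis t) * om t ^ k)%C 0 (2 * PI)
     = (RtoC (2 * PI) * (tcoef f k * z ^ k - (if k then f z else RtoC 0)))%C).
  { intros k.
    rewrite (CInt_ext _ (fun t => z ^ k * (/ (RtoC r ^ k) * (f (RtoC r * cis t) * cis (- (INR k * t)))) +
        - (z ^ k * (/ (RtoC r ^ k) * (f z * cis (- (INR k * t))))))%C).
    2:{ intros t _. unfold D, om. rewrite <- cis_conj_inv, cis_INR, Cpow_mult_l, Cpow_inv, Cpow_mult_l by apply ZT.
        field. split; apply Cpow_nz; [apply cis_neq_0|exact R0]. }
    assert (K1 : forall t, rcont (fun t => cis (- (INR k * t))) t) by (intros; apply rcont_cis_opp_scal).
    assert (K2 : forall t, rcont (fun t => f (RtoC r * cis t)%C) t).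
    { intros t. apply rcont_circle, holo_ccont; [exact Hf|rewrite Cmod_circle; lra]. }
    assert (K3 : forall t, rcont (fun t => f (RtoC r * cis t) * cis (- (INR k * t)))%C t) by (intros; now apply rcont_mult).
    rewrite CInt_plus, CInt_opp, !CInt_scal; try (intros t _; auto using rcont_mult, rcont_const, rcont_opp).
    rewrite fourier_nonneg by (auto; lra).
    destruct k as [|k].
    - simpl INR. rewrite (CInt_ext _ (fun _ => RtoC 1)) by (intros t _; rewrite Rmult_0_l, Ropp_0; apply cis_0).
      rewrite CInt_const, Rminus_0_r. simpl. field.
    - rewrite CInt_cis_neg. field. now apply Cpow_nz. }
  assert (E : (Csum (fun k => RtoC (2 * PI) * (tcoef f k * z ^ k - (if k then f z else RtoC 0)))%C n
     + CInt rem 0 (2 * PI))%C = RtoC 0).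
  { transitivity (circle_int h r); [|exact Z]. unfold circle_int.
    rewrite (CInt_ext (fun t => h (RtoC r * cis t)%C) (fun t => Csum (fun k => D (RtoC r * cis t) * om t ^ k)%C n + rem t)%C).
    - rewrite CInt_plus.
      + f_equal. rewrite CInt_Csum by (intros k t _; apply rcont_mult; auto). apply Csum_ext; intros; symmetry; apply CT.
      + intros t _. apply (rcont_Csum (fun k t => D (RtoC r * cis t) * om t ^ k)%C). intros k; apply rcont_mult; auto.
      + intros t _; apply C5.
    - intros t _. unfold h. destruct (Ceq_dec (RtoC r * cis t)%C z) as [E|N].
      + exfalso. assert (A : Cmod (RtoC r * cis t)%C = r) by (apply Cmod_circle; lra). rewrite E in A; lra.
      + rewrite (Csum_scal (D (RtoC r * cis t)%C) (fun k => (om t ^ k)%C)). unfold rem.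
        transitivity (D (RtoC r * cis t) * (Csum (fun k => om t ^ k) n + om t ^ n * / (RtoC 1 - om t)))%C; [|ring].
        rewrite <- geometric_split by apply Hom1. unfold om. field.
        repeat split; [apply cis_neq_0|exact R0|now apply Cminus_eq_contra| ..]. }
  (* An empty sum lacks the term [k = 0] that carries [f z]; for it the bound follows from
     [|f z| <= M]. *)
  destruct n as [|n].
  - simpl. replace (f z - RtoC 0)%C with (f z) by ring.
    assert (B := HM z ltac:(unfold unit_disk; lra)). assert (B0 := Cmod_ge_0 (f z)).
    fold q. rewrite Rmult_1_r. apply Rmult_le_reg_r with (1 - q); [lra|].
    unfold Rdiv; rewrite Rmult_assoc, Rinv_l by lra. nra.
  - set (N := S n) in *.
    assert (S1 : Csum (fun k => RtoC (2 * PI) * (tcoef f k * z ^ k - (if k then f z else RtoC 0)))%C N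
       = (RtoC (2 * PI) * (Csum (fun k => tcoef f k * z ^ k) N - f z))%C).
    { rewrite Csum_scal. f_equal. unfold N. clear. induction n as [|n IH]; simpl in *; [ring|].
      rewrite IH. ring. }
    rewrite S1 in E.
    assert (E' : (f z - Csum (fun k => tcoef f k * z ^ k) N)%C = (RtoC (/ (2 * PI)) * CInt rem 0 (2 * PI))%C).
    { replace (CInt rem 0 (2 * PI)) with (RtoC (2 * PI) * (f z - Csum (fun k => tcoef f k * z ^ k) N))%C.
      - rewrite Cmult_assoc, (Cmult_comm (RtoC (/ _))), two_PI_inv; ring.
      - symmetry. apply Ceq_minus. rewrite <- E. ring. }
    rewrite E', Cmod_mult, Cmod_R, Rabs_pos_eq by (left; apply Rinv_0_lt_compat; lra).
    assert (B : Cmod (CInt rem 0 (2 * PI)) <= 2 * (2 * M * q ^ N / (1 - q)) * (2 * PI - 0)).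
    { apply CInt_bound; [lra|intros t _; apply C5|]. intros t _. unfold rem.
      assert (O1 : 1 - q <= Cmod (RtoC 1 - om t)).
      { assert (A := Cmod_triangle_rev (RtoC 1) (om t)). rewrite Cmod_1, Hom in A. exact A. }
      rewrite !Cmod_mult, Cmod_inv by (apply Cmod_gt_0; lra). rewrite Cmod_pow, Hom.
      assert (B1 : Cmod (D (RtoC r * cis t)%C) <= 2 * M).
      { unfold D. eapply Rle_trans; [apply Cmod_minus_le|].
        assert (A1 := HM z ltac:(unfold unit_disk; lra)).
        assert (A2 := HM (RtoC r * cis t)%C ltac:(unfold unit_disk; rewrite Cmod_circle; lra)). lra. }
      unfold Rdiv. rewrite Rmult_assoc. apply Rmult_le_compat; [apply Cmod_ge_0| |exact B1|].
      - apply Rmult_le_pos; [apply pow_le; lra|left; apply Rinv_0_lt_compat; lra].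
      - apply Rmult_le_compat_l; [apply pow_le; lra|]. apply Rinv_le_contravar; lra. }
    fold q. apply Rle_trans with (/ (2 * PI) * (2 * (2 * M * q ^ N / (1 - q)) * (2 * PI - 0))).
    + apply Rmult_le_compat_l; [left; apply Rinv_0_lt_compat; lra|exact B].
    + right. field. split; lra.
Qed.

(** * Termwise differentiation of the Taylor series *)

Definition cpoly (a : nat -> C) (n : nat) (z : C) : C := Csum (fun k => a k * z ^ k)%C n.

Definition dcoef (a : nat -> C) (k : nat) : C := (RtoC (INR (S k)) * a (S k))%C.

Lemma cderiv_Csum (f : nat -> C -> C) (d : nat -> C) (z : C) (n : nat) :
  (forall k, cderiv (f k) z (d k)) -> cderiv (fun w => Csum (fun k => f k w) n) z (Csum d n).
Proof.
  intros H; induction n as [|n IH]; simpl; [apply cderiv_const|].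
  apply cderiv_plus; [exact IH|apply H].
Qed.

Lemma cderiv_cpoly (a : nat -> C) (n : nat) (z : C) :
  cderiv (cpoly a n) z (cpoly (dcoef a) (pred n) z).
Proof.
  replace (cpoly (dcoef a) (pred n) z) with (Csum (fun k => a k * (RtoC (INR k) * z ^ pred k) + RtoC 0 * z ^ k)%C n).
  - unfold cpoly. apply cderiv_Csum. intros k.
    replace (a k * (RtoC (INR k) * z ^ pred k) + RtoC 0 * z ^ k)%C with (RtoC 0 * z ^ k + a k * (RtoC (INR k) * z ^ pred k))%C by ring.
    apply cderiv_mult; [apply cderiv_const|apply cderiv_Cpow].
  - unfold cpoly, dcoef. destruct n as [|n]; [reflexivity|]. simpl pred.
    induction n as [|n IH].
    + simpl; ring.
    + change (Csum ?u (S (S n))) with (Csum u (S n) + u (S n))%C. rewrite IH.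
      match goal with |- (Csum ?v n + _ = Csum ?v (S n))%C => change (Csum v (S n)) with (Csum v n + v n)%C end.
      cbv beta. simpl pred. ring.
Qed.

(** The natural constant is [k rho^(k-1)]; with [rho >= 1/2] it is at most [2 k rho^k], which avoids
    a predecessor in the exponent. *)
Lemma Cmod_pow_minus_le (w z : C) (rho : R) (k : nat) :
  Cmod w <= rho -> Cmod z <= rho -> 1 / 2 <= rho ->
  Cmod (w ^ k - z ^ k) <= 2 * INR k * rho ^ k * Cmod (w - z).
Proof.
  intros Hw Hz Hr. induction k as [|k IH].
  - simpl. replace (RtoC 1 - RtoC 1)%C with (RtoC 0) by ring. rewrite Cmod_0; lra.
  - rewrite S_INR, !Cpow_S. simpl pow.
    replace (w * w ^ k - z * z ^ k)%C with (w * (w ^ k - z ^ k) + (w - z) * z ^ k)%C by ring.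
    eapply Rle_trans; [apply Cmod_triangle|]. rewrite !Cmod_mult, Cmod_pow.
    assert (P := Cmod_ge_0 (w - z)). assert (Q := Cmod_ge_0 w). assert (Q' := Cmod_ge_0 z).
    assert (P2 : Cmod z ^ k <= rho ^ k) by (apply pow_incr; lra).
    assert (P3 : 0 <= rho ^ k) by (apply pow_le; lra).
    assert (Cmod w * Cmod (w ^ k - z ^ k) <= rho * (2 * INR k * rho ^ k * Cmod (w - z)))
      by (apply Rmult_le_compat; auto using Cmod_ge_0).
    assert (Cmod (w - z) * Cmod z ^ k <= Cmod (w - z) * rho ^ k) by (apply Rmult_le_compat_l; lra).
    assert (Cmod (w - z) * rho ^ k <= 2 * rho * (Cmod (w - z) * rho ^ k)).
    { assert (0 <= Cmod (w - z) * rho ^ k) by now apply Rmult_le_pos. nra. }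
    nra.
Qed.

(** With [q = s^2], one factor [s^n] keeps [n s^n] below the geometric sum [(1 - s^n) / (1 - s)],
    and the other one tends to 0. *)
Lemma is_lim_seq_INR_mult_geom (q : R) : 0 <= q < 1 -> is_lim_seq (fun n => INR n * q ^ n) 0.
Proof.
  intros Hq. set (s := sqrt q).
  assert (Hs : 0 <= s < 1).
  { split; [apply sqrt_pos|]. rewrite <- sqrt_1. apply sqrt_lt_1; lra. }
  assert (Es : s * s = q) by (apply sqrt_sqrt; lra).
  assert (B : forall n, INR n * s ^ n * (1 - s) <= 1 - s ^ n).
  { intros n; induction n as [|n IH]; [simpl; lra|].
    rewrite S_INR. simpl pow. assert (P : 0 <= s ^ n) by (apply pow_le; lra).
    assert (P' : s ^ n <= 1) by (rewrite <- (pow1 n); apply pow_incr; lra).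
    assert (s * (INR n * s ^ n * (1 - s)) <= s * (1 - s ^ n)) by (apply Rmult_le_compat_l; lra).
    assert (0 <= (1 - s) * (1 - s * s ^ n)) by (apply Rmult_le_pos; nra).
    nra. }
  apply is_lim_seq_le_le with (u := fun _ => 0) (w := fun n => / (1 - s) * s ^ n).
  - intros n. assert (P : 0 <= s ^ n) by (apply pow_le; lra). rewrite <- Es, Rpow_mult_distr.
    assert (N := pos_INR n). split.
    + repeat apply Rmult_le_pos; assumption.
    + rewrite <- Rmult_assoc. apply Rmult_le_compat_r; [exact P|].
      apply Rmult_le_reg_r with (1 - s); [lra|]. rewrite Rinv_l by lra.
      eapply Rle_trans; [apply B|lra].
  - apply is_lim_seq_const.
  - replace (Finite 0) with (Rbar_mult (/ (1 - s)) 0) by (simpl; now rewrite Rmult_0_r).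
    apply is_lim_seq_scal_l, is_lim_seq_geom. rewrite Rabs_pos_eq; lra.
Qed.

Lemma is_lim_seq_eps (u : nat -> R) (eps : R) : is_lim_seq u 0 -> 0 < eps ->
  exists N, forall n, (N <= n)%nat -> Rabs (u n) <= eps.
Proof.
  intros H Heps. apply is_lim_seq_spec in H. destruct (H (mkposreal _ Heps)) as [N HN].
  exists N. intros n Hn. specialize (HN n Hn). simpl in HN. rewrite Rminus_0_r in HN. lra.
Qed.

Lemma taylor_convergent (f : C -> C) (M : R) (z : C) (eps : R) : holo f ->
  (forall w, unit_disk w -> Cmod (f w) <= M) -> Cmod z < 1 -> 0 < eps ->
  exists N, forall n, (N <= n)%nat -> Cmod (f z - cpoly (tcoef f) n z)%C <= eps.
Proof.
  intros Hf HM Hz Heps.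
  assert (Z0 := Cmod_ge_0 z).
  set (r := (1 + Cmod z) / 2). set (q := Cmod z / r).
  assert (Hq : 0 <= q < 1).
  { unfold q, r; split; [apply Rmult_le_pos; [lra|left; apply Rinv_0_lt_compat; lra]|].
    apply Rmult_lt_reg_r with ((1 + Cmod z) / 2); [lra|]. unfold Rdiv at 1; rewrite Rmult_assoc, Rinv_l; lra. }
  assert (L : is_lim_seq (fun n => 4 * M / (1 - q) * q ^ n) 0).
  { replace (Finite 0) with (Rbar_mult (4 * M / (1 - q)) 0) by (simpl; now rewrite Rmult_0_r).
    apply is_lim_seq_scal_l, is_lim_seq_geom. rewrite Rabs_pos_eq; lra. }
  destruct (is_lim_seq_eps _ eps L Heps) as [N HN]. exists N. intros n Hn.
  eapply Rle_trans; [apply (taylor_remainder f M r); auto; unfold r; lra|].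
  fold q. eapply Rle_trans; [|apply (HN n Hn)]. eapply Rle_trans; [|apply Rle_abs]. right; field; lra.
Qed.

(** A Lipschitz bound for the block of terms of degree [m] to [m + j - 1]. It does not depend on
    [j], hence passes to the whole tail of the series. *)
Lemma cpoly_diff_bound (c : nat -> C) (K rho : R) (w z : C) (m j : nat) :
  (forall k, Cmod (c k) <= K) -> Cmod w <= rho -> Cmod z <= rho -> 1 / 2 <= rho < 1 ->
  Cmod (cpoly c (m + j) w - cpoly c (m + j) z - (cpoly c m w - cpoly c m z))
  <= 2 * K * (INR m + 1) * rho ^ m / (1 - rho) ^ 2 * Cmod (w - z).
Proof.
  intros HK Hw Hz Hr.
  assert (K0 : 0 <= K) by (eapply Rle_trans; [apply Cmod_ge_0|apply (HK O)]).
  (* [V m] is the tail sum of [k * rho ^ k] over [k >= m]. *)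
  set (V := fun m : nat => rho ^ m * (INR m * (1 - rho) + rho) / (1 - rho) ^ 2).
  assert (HV : forall m, V m = V (S m) + INR m * rho ^ m).
  { intros i. unfold V. rewrite S_INR. simpl pow. field. lra. }
  assert (V0 : forall m, 0 <= V m).
  { intros i. assert (N := pos_INR i). unfold V. apply Rmult_le_pos.
    - apply Rmult_le_pos; [apply pow_le; lra|]. assert (0 <= INR i * (1 - rho)) by (apply Rmult_le_pos; lra). lra.
    - left; apply Rinv_0_lt_compat, pow_lt; lra. }
  assert (D0 := Cmod_ge_0 (w - z)).
  assert (B : Cmod (cpoly c (m + j) w - cpoly c (m + j) z - (cpoly c m w - cpoly c m z))
     <= 2 * K * (V m - V (m + j)%nat) * Cmod (w - z)).
  { induction j as [|j IH].
    - rewrite Nat.add_0_r.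
      match goal with |- Cmod ?X <= _ => replace X with (RtoC 0) by ring end. rewrite Cmod_0.
      right; ring.
    - rewrite Nat.add_succ_r. unfold cpoly in *. simpl Csum.
      set (i := (m + j)%nat) in *.
      match goal with |- Cmod ?X <= _ => replace X with
        (Csum (fun k => c k * w ^ k) i - Csum (fun k => c k * z ^ k) i
         - (Csum (fun k => c k * w ^ k) m - Csum (fun k => c k * z ^ k) m)
         + c i * (w ^ i - z ^ i))%C by ring end.
      eapply Rle_trans; [apply Cmod_triangle|]. rewrite Cmod_mult.
      assert (Cmod (c i) * Cmod (w ^ i - z ^ i) <= K * (2 * INR i * rho ^ i * Cmod (w - z))).
      { apply Rmult_le_compat; auto using Cmod_ge_0. apply Cmod_pow_minus_le; lra. }
      rewrite (HV i) in IH. nra. }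
  eapply Rle_trans; [exact B|]. apply Rmult_le_compat_r; [exact D0|].
  apply Rle_trans with (2 * K * V m).
  - apply Rmult_le_compat_l; [lra|]. assert (A := V0 (m + j)%nat). lra.
  - unfold V, Rdiv. rewrite <- !Rmult_assoc. apply Rmult_le_compat_r; [left; apply Rinv_0_lt_compat, pow_lt; lra|].
    assert (P : 0 <= rho ^ m) by (apply pow_le; lra). assert (N := pos_INR m).
    replace (2 * K * rho ^ m * (INR m * (1 - rho) + rho)) with (2 * K * (INR m * (1 - rho) + rho) * rho ^ m) by ring.
    apply Rmult_le_compat_r; [exact P|]. apply Rmult_le_compat_l; [lra|]. nra.
Qed.

(** The tail [f - P] is Lipschitz on the disk of radius [rho] with constant [T (S n)], as a limit of
    [cpoly_diff_bound]. Its derivative [l - p] at [z] is bounded by the same constant, which tends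
    to 0. *)
Lemma taylor_derivative_convergent (f : C -> C) (M : R) (z l : C) (eps : R) : holo f ->
  (forall w, unit_disk w -> Cmod (f w) <= M) -> Cmod z < 1 -> cderiv f z l -> 0 < eps ->
  exists N, forall n, (N <= n)%nat -> Cmod (l - cpoly (dcoef (tcoef f)) n z)%C <= eps.
Proof.
  intros Hf HM Hz Hl Heps.
  assert (Z0 := Cmod_ge_0 z).
  assert (M0 : 0 <= M) by (eapply Rle_trans; [apply Cmod_ge_0|apply (HM (RtoC 0))]; unfold unit_disk; rewrite Cmod_0; lra).
  set (rho := (1 + Cmod z) / 2). assert (Hr : 1 / 2 <= rho < 1) by (unfold rho; lra).
  set (T := fun m : nat => 2 * (2 * M) * (INR m + 1) * rho ^ m / (1 - rho) ^ 2).
  assert (L : is_lim_seq T 0).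
  { apply is_lim_seq_ext with (fun m => (4 * M / (1 - rho) ^ 2) * (INR m * rho ^ m + rho ^ m)).
    { intros m; unfold T; field. lra. }
    replace (Finite 0) with (Rbar_mult (4 * M / (1 - rho) ^ 2) (0 + 0)) by (simpl; f_equal; ring).
    apply is_lim_seq_scal_l, is_lim_seq_plus'; [apply is_lim_seq_INR_mult_geom; lra|].
    apply is_lim_seq_geom. rewrite Rabs_pos_eq; lra. }
  destruct (is_lim_seq_eps T eps L Heps) as [N HN]. exists N. intros n Hn.
  specialize (HN (S n) ltac:(lia)).
  assert (HT : T (S n) <= eps) by (eapply Rle_trans; [apply Rle_abs|exact HN]).
  eapply Rle_trans; [|exact HT]. clear HT HN.
  assert (HP := cderiv_cpoly (tcoef f) (S n) z). simpl pred in HP.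
  set (P := cpoly (tcoef f) (S n)) in *. set (p := cpoly (dcoef (tcoef f)) n z) in *.
  assert (B : forall w, Cmod w <= rho -> Cmod (f w - f z - (P w - P z)) <= T (S n) * Cmod (w - z)).
  { intros w Hw. apply le_epsilon. intros eta Heta.
    destruct (taylor_convergent f M w (eta / 2) Hf HM ltac:(lra) ltac:(lra)) as [N1 H1].
    destruct (taylor_convergent f M z (eta / 2) Hf HM ltac:(lra) ltac:(lra)) as [N2 H2].
    set (j := (N1 + N2)%nat).
    specialize (H1 (S n + j)%nat ltac:(unfold j; lia)). specialize (H2 (S n + j)%nat ltac:(unfold j; lia)).
    assert (A := cpoly_diff_bound (tcoef f) (2 * M) rho w z (S n) j (fun k => tcoef_bound f M k Hf HM) Hw ltac:(unfold rho; lra) Hr).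
    fold P in A. fold (T (S n)) in A.
    replace (f w - f z - (P w - P z))%C with
      ((cpoly (tcoef f) (S n + j) w - cpoly (tcoef f) (S n + j) z - (P w - P z))
       + ((f w - cpoly (tcoef f) (S n + j) w) - (f z - cpoly (tcoef f) (S n + j) z)))%C by ring.
    eapply Rle_trans; [apply Cmod_triangle|]. apply Rplus_le_compat; [exact A|].
    eapply Rle_trans; [apply Cmod_minus_le|]. lra. }
  apply le_epsilon. intros eta Heta.
  destruct (Hl (eta / 2)) as [d1 [P1 D1]]; [lra|].
  destruct (HP (eta / 2)) as [d2 [P2 D2]]; [lra|].
  set (e := Rmin (rho - Cmod z) (Rmin (d1 / 2) (d2 / 2))).
  assert (He : 0 < e) by (unfold e, rho; repeat apply Rmin_pos; lra).
  assert (E1 : e <= rho - Cmod z) by apply Rmin_l.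
  assert (E2 : e <= d1 / 2) by (eapply Rle_trans; [apply Rmin_r|apply Rmin_l]).
  assert (E3 : e <= d2 / 2) by (eapply Rle_trans; [apply Rmin_r|apply Rmin_r]).
  set (w := (z + RtoC e)%C).
  assert (W : (w - z)%C = RtoC e) by (unfold w; ring).
  assert (We : Cmod (RtoC e) = e) by (rewrite Cmod_R, Rabs_pos_eq; lra).
  specialize (D1 w). specialize (D2 w). rewrite W, We in D1, D2.
  assert (B' : Cmod (f w - f z - (P w - P z)) <= T (S n) * e).
  { replace e with (Cmod (w - z)) by (rewrite W; exact We). apply B. unfold w.
    eapply Rle_trans; [apply Cmod_triangle|]. rewrite We; lra. }
  specialize (D1 ltac:(lra)). specialize (D2 ltac:(lra)).
  assert (A : Cmod ((l - p) * RtoC e) <= (T (S n) + eta) * e).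
  { replace ((l - p) * RtoC e)%C with
      ((f w - f z - (P w - P z)) - (f w - f z - l * RtoC e) + (P w - P z - p * RtoC e))%C by ring.
    eapply Rle_trans; [apply Cmod_triangle|].
    eapply Rle_trans; [apply Rplus_le_compat_r, Cmod_minus_le|]. lra. }
  rewrite Cmod_mult, We in A. apply Rmult_le_reg_r with e; assumption.
Qed.

Lemma tcoef_0 (f : C -> C) (M : R) : holo f ->
  (forall w, unit_disk w -> Cmod (f w) <= M) -> tcoef f 0 = f (RtoC 0).
Proof.
  intros Hf HM. symmetry. apply Ceq_minus, Cmod_eq_0, Rle_antisym; [|apply Cmod_ge_0].
  assert (A := taylor_remainder f M (1 / 2) (RtoC 0) 1 Hf HM).
  rewrite Cmod_0 in A. simpl in A.
  replace (f (RtoC 0) - (RtoC 0 + tcoef f 0 * RtoC 1))%C with (f (RtoC 0) - tcoef f 0)%C in A by ring.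
  eapply Rle_trans; [apply A; lra|]. right; field.
Qed.

Lemma tcoef_1 (f : C -> C) (M : R) (l : C) : holo f ->
  (forall w, unit_disk w -> Cmod (f w) <= M) -> cderiv f (RtoC 0) l -> tcoef f 1 = l.
Proof.
  intros Hf HM Hl. symmetry. apply Ceq_minus, Cmod_eq_0, Rle_antisym; [|apply Cmod_ge_0].
  apply le_epsilon. intros eps Heps. rewrite Rplus_0_l.
  destruct (taylor_derivative_convergent f M (RtoC 0) l eps Hf HM) as [N HN]; try assumption.
  { rewrite Cmod_0; lra. }
  specialize (HN (S N) ltac:(lia)).
  replace (cpoly (dcoef (tcoef f)) (S N) (RtoC 0)) with (tcoef f 1) in HN; [exact HN|].
  unfold cpoly. clear. induction N as [|N IH].
  - simpl. unfold dcoef; simpl; ring.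
  - change (Csum ?u (S (S N))) with (Csum u (S N) + u (S N))%C. rewrite <- IH. simpl Cpow. ring.
Qed.

(** Multiplying a partial sum of the derivative by the quadratic cancels all positive degrees but
    the two topmost. Those terms are of size [n |z|^n], since [e n] grows at most linearly, and
    vanish in the limit. *)
Lemma derivative_of_recurrence (f : C -> C) (M : R) (a lam z l : C) : holo f ->
  (forall w, unit_disk w -> Cmod (f w) <= M) -> Cmod z < 1 -> cderiv f z l ->
  let e := dcoef (tcoef f) in
  (e 1%nat + a * e O)%C = RtoC 0 ->
  (forall n, e (S (S n)) + a * e (S n) + lam * e n = RtoC 0)%C ->
  ((RtoC 1 + a * z + lam * (z * z)) * l)%C = e O.
Proof.
  intros Hf HM Hz Hl e H1 Hn.
  assert (M0 : 0 <= M) by (eapply Rle_trans; [apply Cmod_ge_0|apply (HM (RtoC 0))]; unfold unit_disk; rewrite Cmod_0; lra).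
  assert (HS : forall n, ((RtoC 1 + a * z + lam * (z * z)) * cpoly e (S (S n)) z
     = e O + (a * e (S n) + lam * e n) * z ^ S (S n) + lam * e (S n) * z ^ S (S (S n)))%C).
  { intros n; induction n as [|n IH].
    - unfold cpoly; simpl.
      transitivity (e O + (e 1%nat + a * e O) * z + (a * e 1%nat + lam * e O) * (z * z) + lam * e 1%nat * (z * (z * z)))%C; [ring|].
      rewrite H1; ring.
    - unfold cpoly in *. change (Csum ?u (S (S (S n)))) with (Csum u (S (S n)) + u (S (S n)))%C.
      rewrite Cmult_plus_distr_l, IH.
      transitivity (e O + (e (S (S n)) + a * e (S n) + lam * e n) * z ^ S (S n) + (a * e (S (S n)) + lam * e (S n)) * z ^ S (S (S n))
        + lam * e (S (S n)) * z ^ S (S (S (S n))))%C; [simpl; ring|].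
      rewrite Hn; ring. }
  set (q := Cmod z) in *. assert (Hq : 0 <= q < 1) by (split; [apply Cmod_ge_0|exact Hz]).
  set (Q := (RtoC 1 + a * z + lam * (z * z))%C) in *.
  set (A := Cmod a + 2 * Cmod lam).
  assert (A0 : 0 <= A) by (unfold A; assert (U := Cmod_ge_0 a); assert (U' := Cmod_ge_0 lam); lra).
  assert (Be : forall n, Cmod (e n) <= 2 * M * (INR n + 1)).
  { intros n. unfold e, dcoef. rewrite Cmod_mult, Cmod_R, S_INR, Rabs_pos_eq by (assert (U := pos_INR n); lra).
    rewrite (Rmult_comm (2 * M)). apply Rmult_le_compat_l; [assert (U := pos_INR n); lra|]. now apply tcoef_bound. }
  assert (L : is_lim_seq (fun n => (2 * M * A) * (INR n * q ^ n + 2 * q ^ n)) 0).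
  { replace (Finite 0) with (Rbar_mult (2 * M * A) (0 + 0)) by (simpl; f_equal; ring).
    apply is_lim_seq_scal_l, is_lim_seq_plus'; [apply is_lim_seq_INR_mult_geom; lra|].
    replace (Finite 0) with (Rbar_mult 2 0) by (simpl; now rewrite Rmult_0_r).
    apply is_lim_seq_scal_l, is_lim_seq_geom. rewrite Rabs_pos_eq; lra. }
  apply Ceq_minus, Cmod_eq_0, Rle_antisym; [|apply Cmod_ge_0].
  apply le_epsilon. intros eps Heps. rewrite Rplus_0_l.
  assert (Q0 := Cmod_ge_0 Q).
  destruct (taylor_derivative_convergent f M z l (eps / (2 * (Cmod Q + 1))) Hf HM Hz Hl) as [N1 HN1].
  { apply Rdiv_lt_0_compat; lra. }
  destruct (is_lim_seq_eps _ (eps / 2) L ltac:(lra)) as [N2 HN2].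
  set (n := (N1 + N2)%nat).
  specialize (HN1 (S (S n)) ltac:(unfold n; lia)). specialize (HN2 n ltac:(unfold n; lia)).
  assert (Pq : 0 <= q ^ n) by (apply pow_le; lra). assert (Pn := pos_INR n).
  rewrite Rabs_pos_eq in HN2.
  2:{ apply Rmult_le_pos; [apply Rmult_le_pos; lra|]. assert (0 <= INR n * q ^ n) by now apply Rmult_le_pos. lra. }
  fold e in HN1.
  replace (Q * l - e O)%C with (Q * (l - cpoly e (S (S n)) z)
     + ((a * e (S n) + lam * e n) * z ^ S (S n) + lam * e (S n) * z ^ S (S (S n))))%C.
  2:{ transitivity (Q * l - Q * cpoly e (S (S n)) z
     + ((a * e (S n) + lam * e n) * z ^ S (S n) + lam * e (S n) * z ^ S (S (S n))))%C; [ring|]. rewrite HS; ring. }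
  eapply Rle_trans; [apply Cmod_triangle|].
  replace eps with (eps / 2 + eps / 2) by lra. apply Rplus_le_compat.
  - rewrite Cmod_mult. apply Rle_trans with ((Cmod Q + 1) * (eps / (2 * (Cmod Q + 1)))).
    + apply Rmult_le_compat; try lra. apply Cmod_ge_0.
    + right; field; lra.
  - eapply Rle_trans; [|exact HN2].
    assert (B1 := Be n). assert (B2 := Be (S n)). rewrite S_INR in B2.
    assert (B3 : Cmod (z ^ S (S n)) <= q ^ n).
    { rewrite Cmod_pow. fold q. simpl. assert (q * (q * q ^ n) = q * q * q ^ n) by ring. assert (q * q <= 1) by nra. nra. }
    assert (B4 : Cmod (z ^ S (S (S n))) <= q ^ n).
    { rewrite Cmod_pow. fold q. simpl. assert (q * (q * (q * q ^ n)) = q * q * q * q ^ n) by ring. assert (q * q * q <= 1) by nra. nra. }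
    eapply Rle_trans; [apply Cmod_triangle|]. rewrite !Cmod_mult.
    assert (B5 : Cmod (a * e (S n) + lam * e n) <= (Cmod a + Cmod lam) * (2 * M * (INR n + 2))).
    { eapply Rle_trans; [apply Cmod_triangle|]. rewrite !Cmod_mult.
      assert (U := Cmod_ge_0 a). assert (U' := Cmod_ge_0 lam).
      assert (Cmod a * Cmod (e (S n)) <= Cmod a * (2 * M * (INR n + 2))) by (apply Rmult_le_compat_l; lra).
      assert (Cmod lam * Cmod (e n) <= Cmod lam * (2 * M * (INR n + 2))) by (apply Rmult_le_compat_l; lra). lra. }
    assert (B6 : Cmod (a * e (S n) + lam * e n) * Cmod (z ^ S (S n)) <= (Cmod a + Cmod lam) * (2 * M * (INR n + 2)) * q ^ n)
      by (apply Rmult_le_compat; auto using Cmod_ge_0).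
    assert (B7 : Cmod lam * Cmod (e (S n)) * Cmod (z ^ S (S (S n))) <= Cmod lam * (2 * M * (INR n + 2)) * q ^ n).
    { apply Rmult_le_compat; auto using Cmod_ge_0.
      - apply Rmult_le_pos; apply Cmod_ge_0.
      - apply Rmult_le_compat_l; [apply Cmod_ge_0|lra]. }
    unfold A. eapply Rle_trans; [apply Rplus_le_compat; [exact B6|exact B7]|]. right; ring.
Qed.

(** * Harmonic polynomials *)

Lemma cderiv_is_derive_x (f : C -> C) (p l : C) :
  cderiv f p l -> is_derive (fun t => fst (f (t, snd p))) (fst p) (fst l).
Proof.
  intros H. split; [apply is_linear_scal_l|].
  intros x Hx. rewrite <- (is_filter_lim_locally_unique _ _ Hx). clear x Hx. intros eps.
  destruct (H eps (cond_pos eps)) as [d [Hd1 Hd]].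
  exists (mkposreal d Hd1). intros t Ht.
  assert (E : ((t, snd p) - p)%C = RtoC (t - fst p))
    by (destruct p; unfold Cminus, Cplus, Copp, RtoC; simpl; f_equal; ring).
  specialize (Hd (t, snd p)). rewrite E, Cmod_R in Hd. specialize (Hd Ht).
  eapply Rle_trans; [|exact Hd].
  eapply Rle_trans; [|apply Rabs_fst_le].
  right. change (norm ?u) with (Rabs u). destruct p as [x y]. f_equal.
  unfold minus, plus, opp, scal; simpl; unfold mult; simpl; ring.
Qed.

Lemma cderiv_is_derive_y (f : C -> C) (p l : C) :
  cderiv f p l -> is_derive (fun t => fst (f (fst p, t))) (snd p) (fst (Ci * l)%C).
Proof.
  intros H. split; [apply is_linear_scal_l|].
  intros x Hx. rewrite <- (is_filter_lim_locally_unique _ _ Hx). clear x Hx. intros eps.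
  destruct (H eps (cond_pos eps)) as [d [Hd1 Hd]].
  exists (mkposreal d Hd1). intros t Ht.
  assert (E : ((fst p, t) - p)%C = (Ci * RtoC (t - snd p))%C)
    by (destruct p; unfold Cminus, Cplus, Copp, Cmult, Ci, RtoC; simpl; f_equal; ring).
  specialize (Hd (fst p, t)). rewrite E, Cmod_mult, Cmod_Ci, Rmult_1_l, Cmod_R in Hd. specialize (Hd Ht).
  eapply Rle_trans; [|exact Hd].
  eapply Rle_trans; [|apply Rabs_fst_le].
  right. change (norm ?u) with (Rabs u). destruct p as [x y]. f_equal.
  unfold minus, plus, opp, scal; simpl; unfold mult; simpl; ring.
Qed.

(** Real parts of polynomials are closed under both partial derivatives, so every condition of
    [C2_on] reduces to differentiability or continuity of one such function. *)
Definition re_poly (a : nat -> C) (n : nat) (p : C) : R := fst (cpoly a n p).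

Lemma cpoly_scal (c : C) (a : nat -> C) (n : nat) (z : C) :
  cpoly (fun k => c * a k)%C n z = (c * cpoly a n z)%C.
Proof.
  unfold cpoly. rewrite <- Csum_scal. apply Csum_ext; intros; ring.
Qed.

(** Encodes the Cauchy-Riemann rule that the derivative in [y] is [i] times the complex derivative;
    applied twice it gives the sign -1 that makes the Laplacian vanish. *)
Definition icoef (a : nat -> C) (k : nat) : C := (Ci * a k)%C.

Lemma is_derive_re_poly_x (a : nat -> C) (n : nat) (p : C) :
  is_derive (fun t => re_poly a n (t, snd p)) (fst p) (re_poly (dcoef a) (pred n) p).
Proof. apply (cderiv_is_derive_x (cpoly a n)), cderiv_cpoly. Qed.

Lemma is_derive_re_poly_y (a : nat -> C) (n : nat) (p : C) :
  is_derive (fun t => re_poly a n (fst p, t)) (snd p) (re_poly (icoef (dcoef a)) (pred n) p).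
Proof.
  unfold re_poly at 2, icoef. rewrite cpoly_scal.
  apply (cderiv_is_derive_y (cpoly a n)), cderiv_cpoly.
Qed.

Lemma dx_re_poly (a : nat -> C) (n : nat) : dx (re_poly a n) = re_poly (dcoef a) (pred n).
Proof. apply functional_extensionality; intros p. apply is_derive_unique, is_derive_re_poly_x. Qed.

Lemma dy_re_poly (a : nat -> C) (n : nat) : dy (re_poly a n) = re_poly (icoef (dcoef a)) (pred n).
Proof. apply functional_extensionality; intros p. apply is_derive_unique, is_derive_re_poly_y. Qed.

Lemma continuous_re_poly (a : nat -> C) (n : nat) (p : C) : continuous (re_poly a n) p.
Proof.
  assert (H := cderiv_ccont _ _ _ (cderiv_cpoly a n p)).
  apply (filterlim_locally (F := locally p)). intros eps.
  destruct (H (eps / 2)) as [d [Hd1 Hd]]; [assert (P := cond_pos eps); lra|].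
  assert (Hd2 : 0 < d / 2) by lra.
  exists (mkposreal _ Hd2). intros q [Hq1 Hq2].
  change (Rabs (fst q - fst p) < d / 2) in Hq1. change (Rabs (snd q - snd p) < d / 2) in Hq2.
  change (Rabs (re_poly a n q - re_poly a n p) < eps).
  unfold re_poly.
  eapply Rle_lt_trans; [exact (Rabs_fst_le (cpoly a n q - cpoly a n p)%C)|].
  eapply Rle_lt_trans; [apply Hd|assert (P := cond_pos eps); lra].
  eapply Rle_lt_trans; [apply Cmod_le_abs|].
  change (Rabs (fst q - fst p) + Rabs (snd q - snd p) < d). lra.
Qed.

Lemma harmonic_re_poly (U : C -> Prop) (a : nat -> C) (n : nat) : harmonic_fun_on U (re_poly a n).
Proof.
  split.
  - intros p _. repeat rewrite ?dx_re_poly, ?dy_re_poly.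
    repeat split; first [apply continuous_re_poly | eexists; apply is_derive_re_poly_x | eexists; apply is_derive_re_poly_y].
  - intros p _. repeat rewrite ?dx_re_poly, ?dy_re_poly.
    unfold re_poly.
    replace (cpoly (icoef (dcoef (icoef (dcoef a)))) (pred (pred n)) p)
      with (- RtoC 1 * cpoly (dcoef (dcoef a)) (pred (pred n)) p)%C; [simpl; ring|].
    rewrite <- cpoly_scal. unfold cpoly. apply Csum_ext; intros k _.
    unfold icoef, dcoef.
    replace (- RtoC 1)%C with (Ci * Ci)%C; [ring|].
    unfold Ci, Cmult, Copp, RtoC; simpl; f_equal; ring.
Qed.

Lemma cpoly_plus (a b : nat -> C) (n : nat) (z : C) :
  cpoly (fun k => a k + b k)%C n z = (cpoly a n z + cpoly b n z)%C.
Proof. unfold cpoly. rewrite <- Csum_plus. apply Csum_ext; intros; ring. Qed.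

Definition harm_poly (a b : nat -> C) (n : nat) (z : C) : C := (cpoly a n z + Cconj (cpoly b n z))%C.

Lemma fst_harm_poly (a b : nat -> C) (n : nat) :
  (fun p => fst (harm_poly a b n p)) = re_poly (fun k => a k + b k)%C n.
Proof.
  apply functional_extensionality; intros p. unfold re_poly, harm_poly. rewrite cpoly_plus. reflexivity.
Qed.

(** The imaginary part of [P + conj Q] is the real part of [-i (P - Q)], so both components fall
    under [re_poly]. *)
Lemma snd_harm_poly (a b : nat -> C) (n : nat) :
  (fun p => snd (harm_poly a b n p)) = re_poly (fun k => - Ci * (a k + - RtoC 1 * b k))%C n.
Proof.
  apply functional_extensionality; intros p. unfold re_poly, harm_poly.
  rewrite cpoly_scal, cpoly_plus, cpoly_scal. simpl; ring.
Qed.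

Lemma harmonic_harm_poly (U : C -> Prop) (a b : nat -> C) (n : nat) : harmonic_map_on U (harm_poly a b n).
Proof.
  split; [rewrite fst_harm_poly|rewrite snd_harm_poly]; apply harmonic_re_poly.
Qed.

Lemma cpoly_at_0 (a : nat -> C) (n : nat) : cpoly a (S n) (RtoC 0) = a O.
Proof.
  unfold cpoly. induction n as [|n IH]; [simpl; ring|].
  change (Csum ?u (S (S n))) with (Csum u (S n) + u (S n))%C. rewrite IH. simpl Cpow. ring.
Qed.

(** Without an antiholomorphic linear term the differential at 0 is multiplication by [a 1]. This is
    how the vanishing of the coefficient of index -1 makes a competitor conformal. *)
Lemma jac_harm_poly (a b : nat -> C) (n : nat) : b 1%nat = RtoC 0 ->
  jac (harm_poly a b (S (S n))) (RtoC 0)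
  = Mat2 (fst (a 1%nat)) (- snd (a 1%nat)) (snd (a 1%nat)) (fst (a 1%nat)).
Proof.
  intros Hb. unfold jac.
  rewrite fst_harm_poly, snd_harm_poly, !dx_re_poly, !dy_re_poly.
  unfold re_poly. simpl pred. rewrite !cpoly_at_0. unfold icoef, dcoef. rewrite Hb.
  simpl. f_equal; ring.
Qed.

Lemma conformal_similarity (z : C) : conformal (Mat2 (fst z) (- snd z) (snd z) (fst z)).
Proof.
  destruct (polar z) as [t Ht].
  exists (Cmod z), (Mat2 (cos t) (- sin t) (sin t) (cos t)).
  assert (S := sin2_cos2 t). unfold Rsqr in S.
  split; [apply Cmod_ge_0|]. split; [unfold orthogonal; simpl; repeat split; lra|].
  assert (F : fst z = Cmod z * cos t) by (rewrite Ht at 1; simpl; ring).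
  assert (G : snd z = Cmod z * sin t) by (rewrite Ht at 1; simpl; ring).
  simpl. rewrite F, G. repeat split; ring.
Qed.

Lemma opnorm_similarity (z : C) :
  opnorm (Mat2 (fst z) (- snd z) (snd z) (fst z)) = Finite (Cmod z).
Proof.
  assert (E : forall h, mat_apply (Mat2 (fst z) (- snd z) (snd z) (fst z)) h = (z * h)%C).
  { intros h; unfold mat_apply, Cmult; simpl; f_equal; ring. }
  apply is_lub_Rbar_unique. split.
  - intros r [h [Hh ->]]. rewrite E, Cmod_mult, Hh, Rmult_1_r. apply Rle_refl.
  - intros b Hb. apply (Hb (Cmod z)). exists (RtoC 1). split; [apply Cmod_1|].
    rewrite E, Cmod_mult, Cmod_1; ring.
Qed.

(** * Averages of points of a convex set *)

Lemma riemann_sum_convergent (f : R -> C) (L eps : R) : 0 < L -> 0 < eps -> (forall t, rcont f t) ->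
  exists N, forall n, (N <= n)%nat ->
    let h := L / INR (S n) in
    Cmod (CInt f 0 L - RtoC h * Csum (fun j => f (INR j * h)) (S n)) <= eps.
Proof.
  intros HL Heps Hf.
  (* Two coordinates, the factor 2 of [CInt_bound] and the total length [L] give the error
     [4 * e * L]. *)
  set (e := eps / (4 * L)). assert (He : 0 < e) by (apply Rdiv_lt_0_compat; lra).
  destruct (Heine_cor2 (f := fun t => fst (f t)) (a := 0) (b := L) (fun t _ => rcont_fst f t (Hf t)) (mkposreal e He)) as [d1 H1].
  destruct (Heine_cor2 (f := fun t => snd (f t)) (a := 0) (b := L) (fun t _ => rcont_snd f t (Hf t)) (mkposreal e He)) as [d2 H2].
  assert (Hd : 0 < Rmin d1 d2) by (apply Rmin_pos; apply cond_pos).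
  destruct (nfloor_ex (L / Rmin d1 d2)) as [N [_ HN]].
  { apply Rmult_le_pos; [lra|left; now apply Rinv_0_lt_compat]. }
  exists N. intros n Hn h.
  assert (Pn : 0 < INR (S n)) by (apply lt_0_INR; lia).
  assert (Hh : 0 < h) by (apply Rdiv_lt_0_compat; lra).
  assert (Hh2 : h < Rmin d1 d2).
  { unfold h. apply Rmult_lt_reg_r with (INR (S n)); [exact Pn|].
    unfold Rdiv; rewrite Rmult_assoc, Rinv_l, Rmult_1_r by lra.
    assert (A : L / Rmin d1 d2 < INR (S n)).
    { eapply Rlt_le_trans; [exact HN|]. rewrite S_INR. apply Rplus_le_compat_r, le_INR, Hn. }
    apply (Rmult_lt_compat_r (Rmin d1 d2)) in A; [|exact Hd].
    unfold Rdiv in A; rewrite Rmult_assoc, Rinv_l in A; lra. }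
  assert (E : INR (S n) * h = L) by (unfold h; field; lra).
  assert (Hon : forall a b, rcont_on f a b) by (intros a b t _; apply Hf).
  assert (I : forall j, (j <= S n)%nat ->
    Cmod (CInt f 0 (INR j * h) - RtoC h * Csum (fun j => f (INR j * h)) j) <= INR j * (4 * e * h)).
  { intros j; induction j as [|j IH]; intros Hj.
    - simpl. rewrite Rmult_0_l. replace (CInt f 0 0) with (RtoC 0) by (unfold CInt; rewrite !RInt_point; reflexivity).
      replace (RtoC 0 - RtoC h * RtoC 0)%C with (RtoC 0) by ring. rewrite Cmod_0; lra.
    - specialize (IH ltac:(lia)).
      rewrite <- (CInt_chasles f 0 (INR j * h) (INR (S j) * h)) by apply Hon.
      simpl Csum.
      assert (Ej : INR (S j) * h = INR j * h + h) by (rewrite S_INR; ring).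
      assert (Jm : INR (S j) * h <= L) by (rewrite <- E; apply Rmult_le_compat_r; [lra|apply le_INR, Hj]).
      assert (J0 : 0 <= INR j * h) by (apply Rmult_le_pos; [apply pos_INR|lra]).
      assert (Er : (CInt f (INR j * h) (INR (S j) * h) - RtoC h * f (INR j * h)%R)%C
        = CInt (fun t => f t - f (INR j * h)%R)%C (INR j * h) (INR (S j) * h)).
      { rewrite CInt_minus; [|apply Hon|intros t _; apply rcont_const]. rewrite CInt_const. rewrite Ej. do 3 f_equal. ring. }
      replace (CInt f 0 (INR j * h) + CInt f (INR j * h) (INR (S j) * h) - RtoC h * (Csum (fun j => f (INR j * h)%R) j + f (INR j * h)%R))%C
        with ((CInt f 0 (INR j * h) - RtoC h * Csum (fun j => f (INR j * h)%R) j)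
          + (CInt f (INR j * h) (INR (S j) * h) - RtoC h * f (INR j * h)%R))%C by ring.
      rewrite Er. eapply Rle_trans; [apply Cmod_triangle|].
      replace (INR (S j) * (4 * e * h)) with (INR j * (4 * e * h) + 4 * e * h) by (rewrite S_INR; ring).
      apply Rplus_le_compat; [exact IH|].
      eapply Rle_trans; [apply (CInt_bound _ _ _ (2 * e))|].
      + lra.
      + intros t _. apply rcont_plus; [apply Hf|apply rcont_opp, rcont_const].
      + intros t Ht. eapply Rle_trans; [apply Cmod_le_abs|].
        assert (E1 := Rmin_l d1 d2). assert (E2 := Rmin_r d1 d2).
        assert (A : Rabs (t - INR j * h) <= h) by (apply Rabs_le; lra).
        assert (Q1 := H1 t (INR j * h) ltac:(lra) ltac:(lra) ltac:(lra)).
        assert (Q2 := H2 t (INR j * h) ltac:(lra) ltac:(lra) ltac:(lra)).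
        simpl in Q1, Q2 |- *. unfold Rminus in Q1, Q2. lra.
      + rewrite Ej. right; ring. }
  specialize (I (S n) (le_n _)). rewrite E in I.
  eapply Rle_trans; [exact I|]. right.
  replace (INR (S n) * (4 * e * h)) with (4 * e * (INR (S n) * h)) by ring. rewrite E. unfold e; field; lra.
Qed.

(** The total weight [W] is kept as a factor instead of being divided out, so the induction also
    covers weights that all vanish; the point 0 then serves as default. *)
Lemma convex_combination (D : C -> Prop) (w : nat -> R) (d : nat -> C) (n : nat) :
  convex_set D -> D (RtoC 0) -> (forall j, 0 <= w j) -> (forall j, D (d j)) ->
  exists W p, 0 <= W /\ D p /\ Csum (fun j => RtoC (w j)) n = RtoC W
    /\ Csum (fun j => RtoC (w j) * d j)%C n = (RtoC W * p)%C.
Proof.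
  intros HD H0 Hw Hd. induction n as [|n [W [p [HW [Hp [E1 E2]]]]]].
  - exists 0, (RtoC 0); simpl; repeat split; [lra|exact H0|ring].
  - specialize (Hw n).
    destruct (Rle_lt_or_eq_dec 0 (W + w n) ltac:(lra)) as [P|P].
    + exists (W + w n), ((RtoC (1 - w n / (W + w n)) * p + RtoC (w n / (W + w n)) * d n)%C).
      assert (N : RtoC (W + w n) <> RtoC 0) by (apply RtoC_neq_0; lra).
      simpl. rewrite E1, E2. repeat split.
      * lra.
      * apply (HD p (d n) Hp (Hd n)). split.
        -- apply Rmult_le_pos; [lra|left; now apply Rinv_0_lt_compat].
        -- apply Rmult_le_reg_r with (W + w n); [exact P|]. unfold Rdiv; rewrite Rmult_assoc, Rinv_l; lra.
      * now rewrite RtoC_plus.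
      * replace (1 - w n / (W + w n)) with (W / (W + w n)) by (field; lra).
        rewrite !RtoC_div by lra. field. exact N.
    + exists 0, p. simpl. rewrite E1, E2. assert (W = 0) by lra. assert (w n = 0) by lra.
      repeat split; try lra; try assumption.
      * rewrite <- RtoC_plus. f_equal; lra.
      * replace W with 0 by lra. replace (w n) with 0 by lra. ring.
Qed.

(** Riemann sums of [K] and of [K g] on the same grid are [h W] and [h W p] with [p] in [D]. The
    first is close to [2 PI], so the second is close to [2 PI p]. *)
Lemma weighted_mean_closure (D : C -> Prop) (K : R -> R) (g : R -> C) (eta : R) :
  convex_set D -> bounded_set D -> D (RtoC 0) -> 0 < eta ->
  (forall t, continuity_pt K t) -> (forall t, 0 <= K t) ->
  CInt (fun t => RtoC (K t)) 0 (2 * PI) = RtoC (2 * PI) ->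
  (forall t, rcont g t) -> (forall t, D (g t)) ->
  exists p, D p /\ Cmod (RtoC (/ (2 * PI)) * CInt (fun t => RtoC (K t) * g t)%C 0 (2 * PI) - p) <= eta.
Proof.
  intros HD [M HM] H0 Heta HK KP HI Hg Dg. assert (HPI := PI_RGT_0).
  assert (M0 : 0 <= M) by (eapply Rle_trans; [apply Cmod_ge_0|apply (HM _ H0)]).
  (* The sum for [K g] costs [e], the one for [K] costs [e * M] since [|p| <= M], and the total is
     divided by [2 * PI]. *)
  set (e := eta * (2 * PI) / (1 + M)).
  assert (He : 0 < e) by (apply Rdiv_lt_0_compat; [apply Rmult_lt_0_compat|]; lra).
  destruct (riemann_sum_convergent (fun t => RtoC (K t)) (2 * PI) e) as [N1 H1]; try lra.
  { intros t; apply rcont_RtoC, HK. }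
  destruct (riemann_sum_convergent (fun t => RtoC (K t) * g t)%C (2 * PI) e) as [N2 H2]; try lra.
  { intros t; apply rcont_mult; [apply rcont_RtoC, HK|apply Hg]. }
  set (n := (N1 + N2)%nat).
  specialize (H1 n ltac:(unfold n; lia)). specialize (H2 n ltac:(unfold n; lia)). simpl in H1, H2.
  set (h := 2 * PI / match n with O => 1 | S _ => INR n + 1 end) in *.
  destruct (convex_combination D (fun j => K (INR j * h)) (fun j => g (INR j * h)) (S n) HD H0) as [W [p [HW [Hp [E1 E2]]]]].
  { intros j; apply KP. } { intros j; apply Dg. }
  simpl in E1, E2. rewrite E1, HI in H1. rewrite E2 in H2.
  exists p. split; [exact Hp|].
  set (I := CInt (fun t => RtoC (K t) * g t)%C 0 (2 * PI)) in *.
  replace (RtoC (/ (2 * PI)) * I - p)%C with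
    (RtoC (/ (2 * PI)) * ((I - RtoC h * (RtoC W * p)) - (RtoC (2 * PI) - RtoC h * RtoC W) * p))%C.
  2:{ transitivity (RtoC (/ (2 * PI)) * I - (RtoC (2 * PI) * RtoC (/ (2 * PI))) * p)%C; [ring|]. rewrite two_PI_inv; ring. }
  rewrite Cmod_mult, Cmod_R, Rabs_pos_eq by (left; apply Rinv_0_lt_compat; lra).
  apply Rle_trans with (/ (2 * PI) * (e + e * M)).
  - apply Rmult_le_compat_l; [left; apply Rinv_0_lt_compat; lra|].
    eapply Rle_trans; [apply Cmod_minus_le|]. apply Rplus_le_compat; [exact H2|].
    rewrite Cmod_mult. apply Rmult_le_compat; auto using Cmod_ge_0.
  - right. unfold e. field. split; lra.
Qed.

Lemma open_ball_0 (D : C -> Prop) : open D -> D (RtoC 0) ->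
  exists delta, 0 < delta /\ forall z, Cmod z < delta -> D z.
Proof.
  (* Neighbourhoods in the sense of [open] are squares; both coordinates are bounded by the
     modulus. *)
  intros HO H0. destruct (HO _ H0) as [d Hd]. exists d; split; [apply cond_pos|].
  intros z Hz. apply Hd. split.
  - change (Rabs (fst z - 0) < d). rewrite Rminus_0_r. eapply Rle_lt_trans; [apply Rabs_fst_le|exact Hz].
  - change (Rabs (snd z - 0) < d). rewrite Rminus_0_r. eapply Rle_lt_trans; [apply Rabs_snd_le|exact Hz].
Qed.

(** With [p] in [D] close to [q], the point [(1 - eps) q] is the combination of [p] and of
    [(1 - eps) / eps * (q - p)] with weights [1 - eps] and [eps]; the latter point lies in a small
    disk around 0 contained in [D]. *)
Lemma shrink_closure (D : C -> Prop) (eps : R) (q : C) : open D -> convex_set D -> D (RtoC 0) -> 0 < eps < 1 ->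
  (forall eta, 0 < eta -> exists p, D p /\ Cmod (q - p) <= eta) -> D (RtoC (1 - eps) * q)%C.
Proof.
  intros HO HD H0 He Hq. destruct (open_ball_0 D HO H0) as [d [Hd1 Hd]].
  destruct (Hq (d * eps / 2)) as [p [Hp Hpq]]; [assert (0 < d * eps) by (apply Rmult_lt_0_compat; lra); lra|].
  assert (N : RtoC eps <> RtoC 0) by (apply RtoC_neq_0; lra).
  replace (RtoC (1 - eps) * q)%C with (RtoC (1 - eps) * p + RtoC eps * (RtoC (1 - eps) / RtoC eps * (q - p)))%C by (field; exact N).
  apply HD; [exact Hp| |lra]. apply Hd.
  rewrite Cmod_mult, Cmod_div, !Cmod_R, !Rabs_pos_eq by (lra || exact N).
  apply Rle_lt_trans with (/ eps * (d * eps / 2)).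
  - apply Rmult_le_compat; auto using Cmod_ge_0.
    + apply Rmult_le_pos; [lra|left; apply Rinv_0_lt_compat; lra].
    + rewrite <- (Rmult_1_l (/ eps)). apply Rmult_le_compat_r; [left; apply Rinv_0_lt_compat; lra|lra].
  - replace (/ eps * (d * eps / 2)) with (d / 2) by (field; lra). lra.
Qed.

(** * The extremal inequality for Fourier coefficients *)

(* The Poisson kernel at [rho * w], truncated at degree [n - 1] so as to be a harmonic polynomial. *)
Definition kern (rho : R) (n : nat) (w : C) : R := 2 * fst (Csum (fun k => (RtoC rho * w) ^ k)%C n) - 1.

Lemma fst_RtoC_conj (s : C) : RtoC (2 * fst s - 1) = (s + Cconj s - RtoC 1)%C.
Proof. apply injective_projections; simpl; ring. Qed.

(** With [v = rho w], the kernel times [|1 - v|^2] equals the Poisson numerator [1 - |v|^2] minus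
    [2 Re (v^n conj(1 - v))]. The numerator is at least [1 - rho^2], the truncation error at most
    [4 rho^n]. *)
Lemma kern_pos (rho : R) (n : nat) (w : C) : 0 < rho < 1 -> 4 * rho ^ n <= 1 - rho ^ 2 -> Cmod w <= 1 ->
  0 <= kern rho n w.
Proof.
  intros Hr Hn Hw. unfold kern. set (v := (RtoC rho * w)%C).
  assert (Hv : Cmod v <= rho).
  { unfold v. rewrite Cmod_mult, Cmod_R, Rabs_pos_eq by lra. assert (U := Cmod_ge_0 w). nra. }
  set (S := Csum (fun k => v ^ k)%C n).
  assert (V0 := Cmod_ge_0 v).
  assert (E : ((RtoC 1 - v) * S = RtoC 1 - v ^ n)%C).
  { unfold S. clear. induction n as [|n IH]; simpl; [ring|]. rewrite Cmult_plus_distr_l, IH. ring. }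
  assert (Dm : 1 - rho <= Cmod (RtoC 1 - v)).
  { assert (U := Cmod_triangle_rev (RtoC 1) v). rewrite Cmod_1 in U. lra. }
  assert (Q : Cmod (RtoC 1 - v) ^ 2 * (2 * fst S - 1) = 1 - Cmod v ^ 2 - 2 * fst (v ^ n * Cconj (RtoC 1 - v))%C).
  { assert (E2 : fst ((RtoC 1 - v) * S * Cconj (RtoC 1 - v))%C = Cmod (RtoC 1 - v) ^ 2 * fst S).
    { replace ((RtoC 1 - v) * S * Cconj (RtoC 1 - v))%C with (RtoC (Cmod (RtoC 1 - v) ^ 2) * S)%C.
      - simpl; ring.
      - rewrite Cmod2_conj. ring. }
    rewrite E in E2.
    rewrite Rmult_minus_distr_l, Rmult_1_r.
    replace (Cmod (RtoC 1 - v) ^ 2 * (2 * fst S)) with (2 * (Cmod (RtoC 1 - v) ^ 2 * fst S)) by ring. rewrite <- E2.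
    rewrite !Cmod2_alt. unfold Re, Im. set (u := (v ^ n)%C). destruct u as [u1 u2], v as [v1 v2].
    simpl. ring. }
  assert (B : fst (v ^ n * Cconj (RtoC 1 - v))%C <= 2 * rho ^ n).
  { eapply Rle_trans; [apply Rle_abs|]. eapply Rle_trans; [apply Rabs_fst_le|].
    rewrite Cmod_mult, Cmod_conj, Cmod_pow, Rmult_comm.
    apply Rmult_le_compat; try apply Cmod_ge_0.
    - apply pow_le, V0.
    - eapply Rle_trans; [apply Cmod_minus_le|]. rewrite Cmod_1; lra.
    - apply pow_incr; lra. }
  assert (P : 0 < Cmod (RtoC 1 - v) ^ 2) by (apply pow_lt; lra).
  assert (P2 : Cmod v ^ 2 <= rho ^ 2) by (apply pow_incr; lra).
  apply Rmult_le_reg_l with (Cmod (RtoC 1 - v) ^ 2); [exact P|]. rewrite Rmult_0_r, Q. lra.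
Qed.

(** The kernel is [S + conj S - 1] for a truncated geometric sum [S]: one half collects the Fourier
    coefficients of index [k >= 0], the other those of index [-k], and the subtracted integral
    undoes the double count of index 0. *)
Lemma CInt_kern (rho : R) (n : nat) (z : C) (g : R -> C) : (forall t, rcont g t) ->
  CInt (fun t => RtoC (kern rho n (z * cis (- t))%C) * g t)%C 0 (2 * PI) =
  (Csum (fun k => RtoC rho ^ k * CInt (fun t => g t * cis (- (INR k * t))) 0 (2 * PI) * z ^ k) n
   + Csum (fun k => RtoC rho ^ k * CInt (fun t => g t * cis (INR k * t)) 0 (2 * PI) * Cconj z ^ k) n
   - CInt g 0 (2 * PI))%C.
Proof.
  intros Hg.
  rewrite (CInt_ext _ (fun t => Csum (fun k => RtoC rho ^ k * z ^ k * (g t * cis (- (INR k * t)))) n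
     + Csum (fun k => RtoC rho ^ k * Cconj z ^ k * (g t * cis (INR k * t))) n + - g t)%C).
  - assert (C1 : forall k t, rcont (fun t => g t * cis (- (INR k * t)))%C t)
      by (intros; apply rcont_mult; [apply Hg|apply rcont_cis_opp_scal]).
    assert (C2 : forall k t, rcont (fun t => g t * cis (INR k * t))%C t)
      by (intros; apply rcont_mult; [apply Hg|apply rcont_cis_scal]).
    assert (C3 : forall k t, rcont (fun t => RtoC rho ^ k * z ^ k * (g t * cis (- (INR k * t))))%C t)
      by (intros; apply rcont_mult; [apply rcont_const|apply C1]).
    assert (C4 : forall k t, rcont (fun t => RtoC rho ^ k * Cconj z ^ k * (g t * cis (INR k * t)))%C t)
      by (intros; apply rcont_mult; [apply rcont_const|apply C2]).
    assert (S1 := fun t => rcont_Csum (fun k t => RtoC rho ^ k * z ^ k * (g t * cis (- (INR k * t))))%C n t (fun k => C3 k t)).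
    assert (S2 := fun t => rcont_Csum (fun k t => RtoC rho ^ k * Cconj z ^ k * (g t * cis (INR k * t)))%C n t (fun k => C4 k t)).
    rewrite CInt_plus; [|intros t _; now apply rcont_plus|intros t _; now apply rcont_opp].
    rewrite CInt_plus; [|intros t _; apply S1|intros t _; apply S2].
    rewrite CInt_opp by (intros t _; apply Hg).
    rewrite !CInt_Csum; [|intros k t _; apply C4|intros k t _; apply C3].
    unfold Cminus. f_equal. f_equal; apply Csum_ext; intros k _;
      (rewrite CInt_scal; [ring|intros t _; first [apply C1|apply C2]]).
  - intros t _. unfold kern. rewrite fst_RtoC_conj, Csum_conj.
    unfold Cminus. rewrite !Cmult_plus_distr_r, !(Cmult_comm _ (g t)), <- !Csum_scal.
    f_equal; [f_equal; apply Csum_ext; intros k _|ring].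
    + rewrite !Cpow_mult_l, <- cis_INR. replace (INR k * - t) with (- (INR k * t)) by ring. ring.
    + rewrite Cpow_conj, !Cmult_conj, !Cpow_mult_l, cis_opp, Cconj_conj, cis_INR.
      replace (Cconj (RtoC rho)) with (RtoC rho) by (unfold Cconj, RtoC; simpl; f_equal; ring). ring.
Qed.

Lemma M_D_upper (D : C -> Prop) (f : C -> C) (m k : R) : M_D D (RtoC 0) = Finite m ->
  harmonic_map_on unit_disk f -> (forall z, unit_disk z -> D (f z)) -> f (RtoC 0) = RtoC 0 ->
  conformal (jac f (RtoC 0)) -> opnorm (jac f (RtoC 0)) = Finite k -> k <= m.
Proof.
  intros HM H1 H2 H3 H4 H5.
  destruct (Lub_Rbar_correct (fun r => exists f : C -> C,
    harmonic_map_on unit_disk f /\ (forall z, unit_disk z -> D (f z)) /\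
    f (RtoC 0) = RtoC 0 /\ conformal (jac f (RtoC 0)) /\ Finite r = opnorm (jac f (RtoC 0)))) as [U _].
  change (Lub_Rbar _) with (M_D D (RtoC 0)) in U. rewrite HM in U.
  apply (U k). exists f. auto.
Qed.

(** The kernel average of [g], shrunk by [1 - eps], is a competitor for [M_D]: its value at 0 and
    its antiholomorphic linear term vanish by the two hypotheses on [g], and its differential is the
    coefficient of index 1 up to the factor [(1 - eps)^2]. *)
Lemma extremal_fourier (D : C -> Prop) (m : R) (g : R -> C) :
  open D -> convex_set D -> bounded_set D -> D (RtoC 0) -> M_D D (RtoC 0) = Finite m ->
  (forall t, rcont g t) -> (forall t, D (g t)) ->
  CInt g 0 (2 * PI) = RtoC 0 -> CInt (fun t => g t * cis t)%C 0 (2 * PI) = RtoC 0 ->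
  Cmod (CInt (fun t => g t * cis (- t))%C 0 (2 * PI)) <= 2 * PI * m.
Proof.
  intros HO HD HB H0 HM Hg Dg G0 Gm. assert (HPI := PI_RGT_0).
  set (G := CInt (fun t => g t * cis (- t))%C 0 (2 * PI)).
  assert (K : forall eps, 0 < eps < 1 -> (1 - eps) * (1 - eps) * Cmod G <= 2 * PI * m).
  { intros eps He. set (rho := 1 - eps).
    assert (Hr : 0 < rho < 1) by (unfold rho; lra).
    assert (Hn : exists n, 4 * rho ^ S (S n) <= 1 - rho ^ 2).
    { destruct (pow_lt_1_zero rho) with (y := (1 - rho ^ 2) / 4) as [n Hn].
      - rewrite Rabs_pos_eq; lra.
      - simpl. nra.
      - exists n. specialize (Hn (S (S n)) ltac:(lia)). rewrite Rabs_pos_eq in Hn by (apply pow_le; lra). lra. }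
    destruct Hn as [n Hn].
    set (c := RtoC ((1 - eps) * / (2 * PI))).
    set (a := fun k => (c * (RtoC rho ^ k * CInt (fun t => g t * cis (- (INR k * t))) 0 (2 * PI)))%C).
    (* The conjugate compensates the one that [harm_poly] applies to its second polynomial. *)
    set (b := fun k => Cconj (c * (RtoC rho ^ k * CInt (fun t => g t * cis (INR k * t)) 0 (2 * PI)))%C).
    assert (A0 : a O = RtoC 0).
    { unfold a. rewrite (CInt_ext _ g), G0; [ring|]. intros t _. simpl. rewrite Rmult_0_l, Ropp_0, cis_0; ring. }
    assert (B0 : b O = RtoC 0).
    { unfold b. rewrite (CInt_ext _ g), G0; [|intros t _; simpl; rewrite Rmult_0_l, cis_0; ring].
      unfold Cconj, Cmult, RtoC; simpl; f_equal; ring. }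
    assert (B1 : b 1%nat = RtoC 0).
    { unfold b. rewrite (CInt_ext _ (fun t => g t * cis t)%C), Gm; [|intros t _; simpl; now rewrite Rmult_1_l].
      unfold Cconj, Cmult, RtoC; simpl; f_equal; ring. }
    assert (A1 : a 1%nat = (c * (RtoC rho * G))%C).
    { unfold a, G. rewrite (CInt_ext _ (fun t => g t * cis (- t))%C); [simpl; ring|].
      intros t _; simpl; now rewrite Rmult_1_l. }
    assert (F : forall z, harm_poly a b (S (S n)) z = (RtoC (1 - eps) * (RtoC (/ (2 * PI)) *
       CInt (fun t => RtoC (kern rho (S (S n)) (z * cis (- t))%C) * g t)%C 0 (2 * PI)))%C).
    { intros z. rewrite CInt_kern by exact Hg. rewrite G0.
      unfold harm_poly, cpoly, a, b. rewrite Csum_conj.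
      transitivity (c * (Csum (fun k => RtoC rho ^ k * CInt (fun t => g t * cis (- (INR k * t))) 0 (2 * PI) * z ^ k) (S (S n)) +
          Csum (fun k => RtoC rho ^ k * CInt (fun t => g t * cis (INR k * t)) 0 (2 * PI) * Cconj z ^ k) (S (S n))))%C.
      - rewrite Cmult_plus_distr_l, <- !Csum_scal. f_equal; apply Csum_ext; intros k _; [ring|].
        rewrite Cmult_conj, Cconj_conj, Cpow_conj; ring.
      - unfold c. rewrite RtoC_mult. ring. }
    assert (HD' : forall z, unit_disk z -> D (harm_poly a b (S (S n)) z)).
    { intros z Hz. rewrite F. apply shrink_closure; auto. intros eta Heta.
      apply weighted_mean_closure; auto.
      - intros t.
        assert (RC : rcont (fun t => Csum (fun k => (RtoC rho * (z * cis (- t))) ^ k)%C (S (S n))) t).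
        { apply (rcont_Csum (fun k t => (RtoC rho * (z * cis (- t))) ^ k)%C). intros k.
          apply (rcont_comp (fun w => (RtoC rho * (z * w)) ^ k)%C (fun t => cis (- t))).
          - apply (rcont_comp_R cis Ropp); [apply rcont_cis|]. apply continuity_pt_opp, derivable_continuous_pt, derivable_pt_id.
          - eapply cderiv_ccont. apply (cderiv_comp (fun w => w ^ k)%C (fun w => RtoC rho * (z * w))%C); [|apply cderiv_Cpow].
            apply cderiv_mult; [apply cderiv_const|]. apply cderiv_mult; [apply cderiv_const|apply cderiv_id]. }
        apply continuity_pt_minus; [|apply continuity_pt_const; intros ? ?; reflexivity].
        apply continuity_pt_mult; [apply continuity_pt_const; intros ? ?; reflexivity|].
        apply (rcont_fst _ _ RC).
      - intros t. apply kern_pos; auto. rewrite Cmod_mult, Cmod_cis, Rmult_1_r. unfold unit_disk in Hz; lra.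
      (* The mass of the kernel is obtained from [CInt_kern] for the constant 1, of which only index
         0 survives. *)
      - rewrite (CInt_ext _ (fun t => RtoC (kern rho (S (S n)) (z * cis (- t))%C) * (fun _ => RtoC 1) t)%C) by (intros; ring).
        rewrite CInt_kern by (intros; apply rcont_const).
        assert (Z1 : forall k, CInt (fun t => RtoC 1 * cis (- (INR k * t)))%C 0 (2 * PI) = if k then RtoC (2 * PI) else RtoC 0).
        { intros k. rewrite (CInt_ext _ (fun t => cis (- (INR k * t)))) by (intros; ring).
          destruct k as [|k]; [|apply CInt_cis_neg].
          rewrite (CInt_ext _ (fun _ => RtoC 1)) by (intros t _; simpl; rewrite Rmult_0_l, Ropp_0; apply cis_0).
          rewrite CInt_const, Rminus_0_r; ring. }
        assert (Z2 : forall k, CInt (fun t => RtoC 1 * cis (INR k * t))%C 0 (2 * PI) = if k then RtoC (2 * PI) else RtoC 0).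
        { intros k. rewrite (CInt_ext _ (fun t => Cconj (RtoC 1 * cis (- (INR k * t)))%C)).
          - rewrite CInt_conj, Z1.
            + destruct k; unfold Cconj, RtoC; simpl; f_equal; ring.
            + intros t _. apply rcont_mult; [apply rcont_const|apply rcont_cis_opp_scal].
          - intros t _. rewrite Cmult_conj, cis_opp, Cconj_conj. f_equal. unfold Cconj, RtoC; simpl; f_equal; ring. }
        assert (Z3 : forall (u : nat -> C) (x : C), (forall k, u k = if k then RtoC (2 * PI) else RtoC 0) ->
          Csum (fun k => RtoC rho ^ k * u k * x ^ k)%C (S (S n)) = RtoC (2 * PI)).
        { intros u x Hu. clear - Hu. induction n as [|n IH].
          - simpl. rewrite !Hu. ring.
          - change (Csum ?v (S (S (S n)))) with (Csum v (S (S n)) + v (S (S n)))%C. cbv beta. rewrite IH, Hu. ring. }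
        rewrite (Z3 (fun k => CInt (fun t => RtoC 1 * cis (- (INR k * t)))%C 0 (2 * PI)) z Z1).
        rewrite (Z3 (fun k => CInt (fun t => RtoC 1 * cis (INR k * t))%C 0 (2 * PI)) (Cconj z) Z2).
        rewrite CInt_const, Rminus_0_r. ring. }
    assert (J := jac_harm_poly a b n B1).
    assert (Q : Cmod (a 1%nat) <= m).
    { apply (M_D_upper D (harm_poly a b (S (S n)))); auto.
      - apply harmonic_harm_poly.
      - unfold harm_poly. rewrite !cpoly_at_0, A0, B0. unfold Cconj, Cplus, RtoC; simpl; f_equal; ring.
      - rewrite J. apply conformal_similarity.
      - rewrite J. apply opnorm_similarity. }
    rewrite A1 in Q. unfold c in Q. rewrite !Cmod_mult, !Cmod_R, !Rabs_pos_eq in Q.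
    - apply (Rmult_le_compat_l (2 * PI)) in Q; [|lra].
      replace (2 * PI * ((1 - eps) * / (2 * PI) * (rho * Cmod G))) with ((1 - eps) * (1 - eps) * Cmod G) in Q by (unfold rho; field; lra).
      exact Q.
    - lra.
    - apply Rmult_le_pos; [lra|left; apply Rinv_0_lt_compat; lra]. }
  apply Rnot_lt_le. intros N. set (X := Cmod G) in *. set (Y := 2 * PI * m) in *.
  assert (Y0 : 0 <= Y).
  { eapply Rle_trans; [|apply (K (1 / 2)); lra]. assert (U := Cmod_ge_0 G). fold X in U. nra. }
  (* For this [e], [(1 - e)^2 X >= X - 2 e X = (X + Y) / 2 > Y], contrary to [K]. *)
  assert (E : 0 < (X - Y) / (4 * X) < 1).
  { split; [apply Rdiv_lt_0_compat; lra|]. apply Rmult_lt_reg_r with (4 * X); [lra|].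
    unfold Rdiv; rewrite Rmult_assoc, Rinv_l; lra. }
  specialize (K _ E). set (e := (X - Y) / (4 * X)) in *.
  assert (e * X = (X - Y) / 4) by (unfold e; field; lra). nra.
Qed.

(** * The variation and the Taylor recurrence *)

Lemma cis_plus_conj (t : R) : (cis t + cis (- t))%C = RtoC (2 * cos t).
Proof. rewrite cis_opp. apply injective_projections; simpl; ring. Qed.

Lemma cis_minus_conj (t : R) : (cis t - cis (- t))%C = (Ci * RtoC (2 * sin t))%C.
Proof. rewrite cis_opp. apply injective_projections; simpl; ring. Qed.

(** A rotation multiplies a Fourier coefficient by a phase. The condition on [cis] says that [q] is
    an integer; a real [q] treats indices of both signs at once. *)
Lemma CInt_rotate (F : R -> C) (s q : R) : (forall t, rcont F t) ->
  (forall t, F (t + 2 * PI) = F t) -> cis (q * (2 * PI)) = RtoC 1 ->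
  CInt (fun t => F (t + s)%R * cis (q * t))%C 0 (2 * PI)
  = (cis (- (q * s)) * CInt (fun t => F t * cis (q * t))%C 0 (2 * PI))%C.
Proof.
  intros HF HP Hq.
  assert (HC : forall t, rcont (fun t => F t * cis (q * t))%C t)
    by (intros t; apply rcont_mult; [apply HF|apply rcont_cis_scal]).
  rewrite <- (CInt_shift_period (fun t => F t * cis (q * t))%C s).
  - rewrite <- CInt_scal.
    + apply CInt_ext; intros t _. rewrite Rmult_plus_distr_l, cis_plus, <- cis_conj_inv. field. apply cis_neq_0.
    + intros t _. apply (rcont_comp_R (fun t => F t * cis (q * t))%C (fun t => t + s)); [apply HC|].
      apply continuity_pt_plus; [apply derivable_continuous_pt, derivable_pt_id|apply continuity_pt_const; intros ? ?; reflexivity].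
  - exact HC.
  - intros t. rewrite HP, Rmult_plus_distr_l, cis_plus, Hq. ring.
Qed.

Lemma cis_INR_2PI (k : nat) : cis (INR k * (2 * PI)) = RtoC 1.
Proof.
  rewrite cis_INR. replace (cis (2 * PI)) with (RtoC 1); [apply Cpow_1_l|].
  rewrite <- cis_0, <- (cis_period 0). f_equal; ring.
Qed.

Lemma cis_opp_INR_2PI (k : nat) : cis (- INR k * (2 * PI)) = RtoC 1.
Proof.
  replace (- INR k * (2 * PI)) with (- (INR k * (2 * PI))) by ring.
  rewrite cis_opp, cis_INR_2PI. apply injective_projections; simpl; ring.
Qed.

(** * Fourier coefficients of the variation on the circle of radius [r] *)

Section Variation.

Context (f : C -> C) (r theta : R) (Hf : holo f) (Hr : 0 < r < 1).

Let fr (t : R) : C := f (RtoC r * cis t)%C.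
(** Half sum and half difference of the two rotations, so that [A + u B] is their combination with
    weights [(1 + u) / 2] and [(1 - u) / 2]. The coefficients acquire factors [cos] in [A] and
    [i sin] in [B]; the latter are [Ci * s k]. *)
Let A (t : R) : C := (RtoC (1 / 2) * (fr (t + theta)%R + fr (t + - theta)%R))%C.
Let B (t : R) : C := (RtoC (1 / 2) * (fr (t + theta)%R - fr (t + - theta)%R))%C.
Let s (k : nat) : C := (RtoC (sin (INR k * theta)) * (tcoef f k * RtoC r ^ k))%C.

Lemma rcont_fr (t : R) : rcont fr t.
Proof. apply rcont_circle, holo_ccont; [exact Hf|rewrite Cmod_circle; lra]. Qed.

Lemma rcont_fr_shift (a t : R) : rcont (fun t => fr (t + a)) t.
Proof.
  apply (rcont_comp_R fr (fun t => t + a)); [apply rcont_fr|].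
  apply continuity_pt_plus; [apply derivable_continuous_pt, derivable_pt_id|apply continuity_pt_const; intros ? ?; reflexivity].
Qed.

Lemma fr_period (t : R) : fr (t + 2 * PI) = fr t.
Proof. unfold fr. now rewrite cis_period. Qed.

Lemma rcont_A (t : R) : rcont A t.
Proof. apply rcont_mult; [apply rcont_const|]. apply rcont_plus; apply rcont_fr_shift. Qed.

Lemma rcont_B (t : R) : rcont B t.
Proof.
  apply rcont_mult; [apply rcont_const|]. apply rcont_plus; [|apply rcont_opp]; apply rcont_fr_shift.
Qed.

Lemma CInt_A (q : R) : cis (q * (2 * PI)) = RtoC 1 ->
  CInt (fun t => A t * cis (q * t))%C 0 (2 * PI)
  = (RtoC (cos (q * theta)) * CInt (fun t => fr t * cis (q * t))%C 0 (2 * PI))%C.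
Proof.
  intros Hq.
  assert (HC : forall a t, rcont (fun t => fr (t + a)%R * cis (q * t))%C t)
    by (intros; apply rcont_mult; [apply rcont_fr_shift|apply rcont_cis_scal]).
  rewrite (CInt_ext _ (fun t => RtoC (1 / 2) * (fr (t + theta)%R * cis (q * t) + fr (t + - theta)%R * cis (q * t)))%C)
    by (intros; unfold A; ring).
  rewrite CInt_scal by (intros t _; apply rcont_plus; apply HC).
  rewrite CInt_plus by (intros t _; apply HC).
  rewrite !CInt_rotate; auto using rcont_fr, fr_period.
  replace (RtoC (cos (q * theta))) with (RtoC (1 / 2) * (cis (q * theta) + cis (- (q * theta))))%C.
  - replace (- (q * - theta)) with (q * theta) by ring. ring.
  - rewrite cis_plus_conj, <- RtoC_mult. f_equal; field.
Qed.

Lemma CInt_B (q : R) : cis (q * (2 * PI)) = RtoC 1 ->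
  CInt (fun t => B t * cis (q * t))%C 0 (2 * PI)
  = (- Ci * RtoC (sin (q * theta)) * CInt (fun t => fr t * cis (q * t))%C 0 (2 * PI))%C.
Proof.
  intros Hq.
  assert (HC : forall a t, rcont (fun t => fr (t + a)%R * cis (q * t))%C t)
    by (intros; apply rcont_mult; [apply rcont_fr_shift|apply rcont_cis_scal]).
  rewrite (CInt_ext _ (fun t => RtoC (1 / 2) * (fr (t + theta)%R * cis (q * t) - fr (t + - theta)%R * cis (q * t)))%C)
    by (intros; unfold B; ring).
  rewrite CInt_scal by (intros t _; apply rcont_plus; [|apply rcont_opp]; apply HC).
  rewrite CInt_minus by (intros t _; apply HC).
  rewrite !CInt_rotate; auto using rcont_fr, fr_period.
  replace (- Ci * RtoC (sin (q * theta)))%C with (- (RtoC (1 / 2) * (cis (q * theta) - cis (- (q * theta)))))%C.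
  - replace (- (q * - theta)) with (q * theta) by ring. ring.
  - rewrite cis_minus_conj. replace (sin (q * theta)) with (1 / 2 * (2 * sin (q * theta))) at 2 by field.
    rewrite (RtoC_mult (1 / 2)); ring.
Qed.

Lemma CInt_A_nonneg (k : nat) : CInt (fun t => A t * cis (- INR k * t))%C 0 (2 * PI)
  = (RtoC (2 * PI) * (RtoC (cos (INR k * theta)) * (tcoef f k * RtoC r ^ k)))%C.
Proof.
  rewrite CInt_A by apply cis_opp_INR_2PI.
  rewrite (CInt_ext _ (fun t => f (RtoC r * cis t) * cis (- (INR k * t)))%C)
    by (intros t _; unfold fr; do 2 f_equal; ring).
  rewrite fourier_nonneg by assumption.
  replace (- INR k * theta) with (- (INR k * theta)) by ring. rewrite cos_neg; ring.
Qed.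

Lemma CInt_B_nonneg (k : nat) : CInt (fun t => B t * cis (- INR k * t))%C 0 (2 * PI)
  = (RtoC (2 * PI) * (Ci * s k))%C.
Proof.
  rewrite CInt_B by apply cis_opp_INR_2PI.
  rewrite (CInt_ext _ (fun t => f (RtoC r * cis t) * cis (- (INR k * t)))%C)
    by (intros t _; unfold fr; do 2 f_equal; ring).
  rewrite fourier_nonneg by assumption. unfold s.
  replace (- INR k * theta) with (- (INR k * theta)) by ring. rewrite sin_neg, RtoC_opp; ring.
Qed.

Lemma CInt_A_neg (k : nat) : CInt (fun t => A t * cis (INR (S k) * t))%C 0 (2 * PI) = RtoC 0.
Proof.
  rewrite CInt_A by apply cis_INR_2PI. unfold fr. rewrite fourier_neg by assumption. ring.
Qed.

Lemma CInt_B_neg (k : nat) : CInt (fun t => B t * cis (INR (S k) * t))%C 0 (2 * PI) = RtoC 0.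
Proof.
  rewrite CInt_B by apply cis_INR_2PI. unfold fr. rewrite fourier_neg by assumption. ring.
Qed.

Context (n : nat) (y1 y2 x : C).

(** With negative exponents, [y1], [y2], [x] raise the index of the coefficient of [B] that is read
    off, while their conjugates lower it into the range where [B] has no coefficients. *)
Let u (t : R) : R := 2 * fst (y1 * cis (- 1 * t) + y2 * cis (- 2 * t) + x * cis (- INR n * t))%C.
Let g (t : R) : C := (A t + RtoC (u t) * B t)%C.
Let BI (q : R) : C := CInt (fun t => B t * cis (q * t))%C 0 (2 * PI).

Lemma rcont_u (t : R) : continuity_pt u t.
Proof.
  apply continuity_pt_mult; [apply continuity_pt_const; intros ? ?; reflexivity|].
  apply (rcont_fst (fun t => y1 * cis (- 1 * t) + y2 * cis (- 2 * t) + x * cis (- INR n * t))%C).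
  repeat apply rcont_plus; (apply rcont_mult; [apply rcont_const|apply rcont_cis_scal]).
Qed.

Lemma rcont_g (t : R) : rcont g t.
Proof. apply rcont_plus; [apply rcont_A|]. apply rcont_mult; [apply rcont_RtoC, rcont_u|apply rcont_B]. Qed.

Lemma CInt_g (l : R) : CInt (fun t => g t * cis (l * t))%C 0 (2 * PI) =
  (CInt (fun t => A t * cis (l * t)) 0 (2 * PI)
   + (y1 * BI (l - 1) + Cconj y1 * BI (l + 1))
   + (y2 * BI (l - 2) + Cconj y2 * BI (l + 2))
   + (x * BI (l - INR n) + Cconj x * BI (l + INR n)))%C.
Proof.
  assert (HB : forall q t, rcont (fun t => B t * cis (q * t))%C t)
    by (intros; apply rcont_mult; [apply rcont_B|apply rcont_cis_scal]).
  assert (HS : forall (y : C) q t, rcont (fun t => y * (B t * cis (q * t)))%C t)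
    by (intros; apply rcont_mult; [apply rcont_const|apply HB]).
  set (E := fun (y : C) q t => (y * (B t * cis ((l - q) * t)) + Cconj y * (B t * cis ((l + q) * t)))%C).
  assert (HE : forall y q t, rcont (E y q) t) by (intros; apply rcont_plus; apply HS).
  assert (IE : forall y q, CInt (E y q) 0 (2 * PI) = (y * BI (l - q) + Cconj y * BI (l + q))%C).
  { intros y q. unfold E. rewrite CInt_plus by (intros t _; apply HS).
    rewrite !CInt_scal by (intros t _; apply HB). reflexivity. }
  rewrite (CInt_ext _ (fun t => A t * cis (l * t) + E y1 1 t + E y2 2 t + E x (INR n) t)%C).
  - assert (HA : forall t, rcont (fun t => A t * cis (l * t))%C t)
      by (intros; apply rcont_mult; [apply rcont_A|apply rcont_cis_scal]).
    assert (H1 : forall t, rcont (fun t => A t * cis (l * t) + E y1 1 t)%C t) by (intros; now apply rcont_plus).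
    assert (H2 : forall t, rcont (fun t => A t * cis (l * t) + E y1 1 t + E y2 2 t)%C t) by (intros; now apply rcont_plus).
    rewrite !CInt_plus by (intros t _; auto).
    now rewrite !IE.
  - intros t _. unfold g, E.
    assert (U : RtoC (u t) = (y1 * cis (- 1 * t) + Cconj y1 * cis (1 * t) + (y2 * cis (- 2 * t) + Cconj y2 * cis (2 * t))
      + (x * cis (- INR n * t) + Cconj x * cis (INR n * t)))%C).
    { unfold u. set (v := (y1 * cis (- 1 * t) + y2 * cis (- 2 * t) + x * cis (- INR n * t))%C).
      transitivity (v + Cconj v)%C; [apply injective_projections; simpl; ring|].
      unfold v. rewrite !Cplus_conj, !Cmult_conj, <- !cis_opp.
      replace (- (- 1 * t)) with (1 * t) by ring. replace (- (-2 * t)) with (2 * t) by ring.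
      replace (- (- INR n * t)) with (INR n * t) by ring. ring. }
    rewrite U. unfold Rminus. rewrite !(Rmult_plus_distr_r l), !cis_plus.
    replace (- (1) * t) with (- 1 * t) by ring. replace (- (2) * t) with (-2 * t) by ring. ring.
Qed.

(* [g t] is the convex combination [(1+u)/2 * f(r e^{i(t+theta)}) + (1-u)/2 * f(r e^{i(t-theta)})];
   the two equations on [y1], [y2], [x] say that its Fourier coefficients of index 0 and -1 vanish. *)
Lemma variation_inequality (D : C -> Prop) (m : R) :
  open D -> convex_set D -> bounded_set D -> M_D D (RtoC 0) = Finite m ->
  (forall z, unit_disk z -> D (f z)) -> f (RtoC 0) = RtoC 0 -> tcoef f 0 = RtoC 0 ->
  (3 <= n)%nat -> 2 * (Cmod y1 + Cmod y2 + Cmod x) <= 1 ->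
  (y1 * s 1%nat + y2 * s 2%nat + x * s n = RtoC 0)%C ->
  (y2 * s 1%nat + x * s (pred n) = RtoC 0)%C ->
  Cmod (RtoC (cos theta) * (tcoef f 1 * RtoC r) + Ci * (y1 * s 2%nat + y2 * s 3%nat + x * s (S n)))%C <= m.
Proof.
  intros HO HD HB HM HfD F0 T0 Hn Hy E1 E2. assert (HPI := PI_RGT_0).
  assert (D0 : D (RtoC 0)) by (rewrite <- F0; apply HfD; unfold unit_disk; rewrite Cmod_0; lra).
  assert (Dfr : forall t, D (fr t)) by (intros t; apply HfD; unfold unit_disk; rewrite Cmod_circle; lra).
  (* The smallness of the coefficients is what keeps the weights [(1 + u) / 2] and [(1 - u) / 2] in
     [[0, 1]]. *)
  assert (Hu : forall t, -1 <= u t <= 1).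
  { intros t. apply Rabs_le_between. unfold u. rewrite Rabs_mult, (Rabs_pos_eq 2) by lra.
    eapply Rle_trans; [apply Rmult_le_compat_l; [lra|apply Rabs_fst_le]|].
    eapply Rle_trans; [|exact Hy]. apply Rmult_le_compat_l; [lra|].
    eapply Rle_trans; [apply Cmod_triangle|].
    eapply Rle_trans; [apply Rplus_le_compat_r, Cmod_triangle|].
    rewrite !Cmod_mult, !Cmod_cis. lra. }
  assert (Dg : forall t, D (g t)).
  { intros t. replace (g t) with (RtoC (1 - (1 - u t) / 2) * fr (t + theta)%R + RtoC ((1 - u t) / 2) * fr (t + - theta)%R)%C.
    - apply HD; auto. specialize (Hu t). lra.
    - unfold g, A, B. replace (1 - (1 - u t) / 2) with (1 / 2 + 1 / 2 * u t) by field.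
      replace ((1 - u t) / 2) with (1 / 2 - 1 / 2 * u t) by field.
      rewrite RtoC_plus, RtoC_minus, RtoC_mult. ring. }
  assert (S0 : s 0%nat = RtoC 0) by (unfold s; simpl; rewrite Rmult_0_l, sin_0; ring).
  assert (BN : forall k q, q = - INR k -> BI q = (RtoC (2 * PI) * (Ci * s k))%C) by (intros k q ->; apply CInt_B_nonneg).
  assert (BP : forall k q, q = INR (S k) -> BI q = RtoC 0) by (intros k q ->; apply CInt_B_neg).
  assert (Hj : exists j, n = S (S (S j))) by (exists (n - 3)%nat; lia). destruct Hj as [j En].
  assert (Ej : INR n = INR j + 3) by (rewrite En, !S_INR; ring).
  assert (Ep : pred n = S (S j)) by (rewrite En; reflexivity).
  assert (G0 : CInt g 0 (2 * PI) = RtoC 0).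
  { rewrite (CInt_ext _ (fun t => g t * cis (0 * t))%C) by (intros t _; rewrite Rmult_0_l, cis_0; ring).
    rewrite CInt_g.
    rewrite (CInt_ext _ (fun t => A t * cis (- INR 0 * t))%C) by (intros t _; simpl; do 2 f_equal; ring).
    rewrite CInt_A_nonneg, T0.
    (* Each [BP] kills a term with a conjugated coefficient; each [BN] keeps one that is linear in
       the coefficient itself. *)
    rewrite (BN 1%nat), (BP 0%nat), (BN 2%nat), (BP 1%nat), (BN n), (BP (S (S j))) by (rewrite ?Ej, ?S_INR; simpl; ring).
    transitivity (RtoC (2 * PI) * Ci * (y1 * s 1%nat + y2 * s 2%nat + x * s n))%C; [ring|rewrite E1; ring]. }
  assert (G1 : CInt (fun t => g t * cis t)%C 0 (2 * PI) = RtoC 0).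
  { rewrite (CInt_ext _ (fun t => g t * cis (1 * t))%C) by (intros t _; now rewrite Rmult_1_l).
    rewrite CInt_g.
    rewrite (CInt_ext _ (fun t => A t * cis (INR 1 * t))%C) by (intros t _; reflexivity).
    rewrite CInt_A_neg.
    (* Here [y1] meets index 0, where [s 0 = 0]; hence the constraint involves only [y2] and [x]. *)
    rewrite (BN 0%nat), (BP 1%nat), (BN 1%nat), (BP 2%nat), (BN (S (S j))), (BP n) by (rewrite ?S_INR, ?Ej; simpl; ring).
    rewrite S0, <- Ep.
    transitivity (RtoC (2 * PI) * Ci * (y2 * s 1%nat + x * s (pred n)))%C; [ring|rewrite E2; ring]. }
  assert (X := extremal_fourier D m g HO HD HB D0 HM rcont_g Dg G0 G1).
  rewrite (CInt_ext _ (fun t => g t * cis (- 1 * t))%C) in X by (intros t _; do 2 f_equal; ring).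
  rewrite CInt_g in X.
  rewrite (CInt_ext _ (fun t => A t * cis (- INR 1 * t))%C) in X by (intros t _; reflexivity).
  rewrite CInt_A_nonneg in X.
  (* The conjugate of [y1] meets index 0 and disappears with [s 0 = 0], so the gain depends
     complex-linearly on the coefficients. *)
  rewrite (BN 2%nat), (BN 0%nat), (BN 3%nat), (BP 0%nat), (BN (S n)), (BP (S j)) in X by (rewrite ?S_INR, ?Ej; simpl; ring).
  rewrite S0 in X. replace (INR 1 * theta) with theta in X by (simpl; ring).
  apply Rmult_le_reg_l with (2 * PI); [lra|].
  rewrite <- (Rabs_pos_eq (2 * PI)) at 1 by lra. rewrite <- Cmod_R, <- Cmod_mult.
  eapply Rle_trans; [|exact X]. right. f_equal. simpl Cpow. ring.
Qed.

End Variation.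

(** Bounds the quotients [s k / s 1] uniformly in [theta], so the variation need not shrink with
    [theta]. *)
Lemma sin_INR_bound (k : nat) (t : R) : Rabs (sin (INR k * t)) <= INR k * Rabs (sin t).
Proof.
  induction k as [|k IH].
  - simpl. rewrite !Rmult_0_l, sin_0, Rabs_R0; lra.
  - rewrite S_INR, Rmult_plus_distr_r, Rmult_1_l, sin_plus.
    eapply Rle_trans; [apply Rabs_triang|]. rewrite !Rabs_mult.
    assert (C1 : Rabs (cos t) <= 1) by (apply Rabs_le, COS_bound).
    assert (C2 : Rabs (cos (INR k * t)) <= 1) by (apply Rabs_le, COS_bound).
    assert (P := Rabs_pos (sin t)). assert (P2 := Rabs_pos (sin (INR k * t))). nra.
Qed.

Lemma one_minus_cos_le (t : R) : 1 - cos t <= t ^ 2 / 2.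
Proof.
  replace t with (2 * (t / 2)) at 1 by field. rewrite cos_2a_sin.
  assert (B : Rabs (sin (t / 2)) <= Rabs (t / 2)).
  { apply Rsqr_le_abs_0.
    destruct (Req_dec (t / 2) 0) as [->|N]; [rewrite sin_0; lra|].
    apply Rsqr_le_abs_1.
    destruct (Rle_dec 0 (t / 2)) as [Q|Q].
    - rewrite (Rabs_pos_eq (t / 2)) by exact Q. assert (U := sin_lt_x (t / 2) ltac:(lra)).
      assert (U' := SIN_bound (t / 2)).
      (* Up to 1 the sine is positive and below its argument; beyond 1 the bound by 1 is enough. *)
      destruct (Rle_dec (t / 2) 1) as [W|W].
      + assert (U2 := sin_gt_0 (t / 2) ltac:(lra) ltac:(assert (X := PI2_1); lra)). rewrite Rabs_pos_eq; lra.
      + apply Rabs_le; lra.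
    - assert (U := sin_lt_x (- (t / 2)) ltac:(lra)). rewrite sin_neg in U.
      assert (U' := SIN_bound (t / 2)). rewrite (Rabs_left (t / 2)) by lra.
      destruct (Rle_dec (- (t / 2)) 1) as [W|W].
      + assert (U2 := sin_gt_0 (- (t / 2)) ltac:(lra) ltac:(assert (X := PI2_1); lra)). rewrite sin_neg in U2. rewrite Rabs_left; lra.
      + apply Rabs_le; lra. }
  apply Rsqr_le_abs_1 in B. unfold Rsqr in B. nra.
Qed.

(* Solving the two linear constraints of [variation_inequality] for [y1] and [y2] turns
   [y1 * s 2 + y2 * s 3 + x * s (S n)] into [x * r ^ S n * defect c n theta]. *)
Definition defect (c : nat -> C) (n : nat) (theta : R) : C :=
  let s := fun k : nat => (RtoC (sin (INR k * theta)) * c k)%C in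
  (s (S n) - s (pred n) / s 1%nat * s 3%nat - s n / s 1%nat * s 2%nat
   + s (pred n) / s 1%nat * (s 2%nat / s 1%nat) * s 2%nat)%C.

(** The phase of [x] is chosen so that the contribution of the defect [E] adds to the main term:
    [cos theta * m * r + x0 |E| r^(n+1) <= m]. As [r -> 1] this becomes
    [x0 |E| <= m (1 - cos theta)]. *)
Lemma defect_inequality (f : C -> C) (D : C -> Prop) (m : R) (n : nat) :
  holo f -> open D -> convex_set D -> bounded_set D -> M_D D (RtoC 0) = Finite m ->
  (forall z, unit_disk z -> D (f z)) -> f (RtoC 0) = RtoC 0 -> tcoef f 0 = RtoC 0 ->
  tcoef f 1 <> RtoC 0 -> Cmod (tcoef f 1) = m -> (3 <= n)%nat ->
  exists K, 0 < K /\ forall theta, 0 < theta < PI ->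
    Cmod (defect (tcoef f) n theta) <= K * (1 - cos theta).
Proof.
  intros Hf HO HD HB HM HfD F0 T0 T1 Tm Hn.
  set (c := tcoef f) in *.
  assert (M0 : 0 < m) by (rewrite <- Tm; now apply Cmod_gt_0).
  (* A bound for [sg k / sg 1] that does not depend on [theta]. *)
  set (kap := fun k : nat => INR k * (Cmod (c k) / m)).
  assert (Kp : forall k, 0 <= kap k).
  { intros k. apply Rmult_le_pos; [apply pos_INR|]. apply Rmult_le_pos; [apply Cmod_ge_0|left; now apply Rinv_0_lt_compat]. }
  (* The summands bound [|x|], [|y2|], [|y1|] relative to [x0], so that together they are at most
     1/2. *)
  set (x0 := / (2 * (1 + kap (pred n) + kap n + kap (pred n) * kap 2%nat))).
  assert (Kpp : 0 <= kap (pred n) * kap 2%nat) by (apply Rmult_le_pos; apply Kp).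
  assert (Kn := Kp n). assert (Kn1 := Kp (pred n)).
  assert (X0 : 0 < x0) by (apply Rinv_0_lt_compat; lra).
  assert (X1 : 2 * (1 + kap (pred n) + kap n + kap (pred n) * kap 2%nat) * x0 = 1) by (unfold x0; field; lra).
  exists (m / x0). split; [apply Rdiv_lt_0_compat; lra|].
  intros theta Ht.
  assert (St : 0 < sin theta) by (apply sin_gt_0; lra).
  set (sg := fun k : nat => (RtoC (sin (INR k * theta)) * c k)%C).
  assert (sg1 : sg 1%nat = (RtoC (sin theta) * c 1%nat)%C) by (unfold sg; simpl INR; now rewrite Rmult_1_l).
  assert (N1 : sg 1%nat <> RtoC 0) by (rewrite sg1; apply Cmult_neq_0; [apply RtoC_neq_0; lra|exact T1]).
  assert (Rk : forall k, Cmod (sg k / sg 1%nat) <= kap k).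
  { intros k. rewrite Cmod_div by exact N1. rewrite sg1. unfold sg. rewrite !Cmod_mult, !Cmod_R, Tm.
    rewrite (Rabs_pos_eq (sin theta)) by lra.
    assert (U := sin_INR_bound k theta). rewrite (Rabs_pos_eq (sin theta)) in U by lra.
    unfold kap. apply Rmult_le_reg_r with (sin theta * m); [apply Rmult_lt_0_compat; lra|].
    replace (Rabs (sin (INR k * theta)) * Cmod (c k) / (sin theta * m) * (sin theta * m)) with (Rabs (sin (INR k * theta)) * Cmod (c k)) by (field; lra).
    replace (INR k * (Cmod (c k) / m) * (sin theta * m)) with (INR k * sin theta * Cmod (c k)) by (field; lra).
    apply Rmult_le_compat_r; [apply Cmod_ge_0|exact U]. }
  set (E := defect c n theta).
  assert (V : forall r x, 0 < r < 1 -> Cmod x <= x0 ->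
    Cmod (RtoC (cos theta) * (c 1%nat * RtoC r) + Ci * (x * RtoC r ^ S n * E))%C <= m).
  { intros r x Hr Hx.
    assert (R0 : RtoC r <> RtoC 0) by (apply RtoC_neq_0; lra).
    destruct n as [|[|[|j]]]; try lia. set (n := S (S (S j))) in *.
    (* The triangular system: the condition at index -1 determines [y2], then the one at index 0
       determines [y1]. Since [n = j + 3], the powers of [r] are [r^(n-2)] and [r^(n-1)]. *)
    set (y2 := (- x * RtoC r ^ S j * (sg (pred n) / sg 1%nat))%C).
    set (y1 := (- x * RtoC r ^ S (S j) * (sg n / sg 1%nat) - y2 * RtoC r * (sg 2%nat / sg 1%nat))%C).
    assert (Pr : forall k, 0 <= r ^ k <= 1).
    { intros k; split; [apply pow_le; lra|]. rewrite <- (pow1 k). apply pow_incr; lra. }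
    assert (Cx := Cmod_ge_0 x).
    assert (Cy2 : Cmod y2 <= x0 * kap (pred n)).
    { unfold y2. rewrite !Cmod_mult, Cmod_opp, Cmod_pow, Cmod_R, (Rabs_pos_eq r) by lra.
      apply Rmult_le_compat; [apply Rmult_le_pos; [exact Cx|apply Pr]|apply Cmod_ge_0| |apply Rk].
      assert (U := Pr (S j)). nra. }
    assert (Cy1 : Cmod y1 <= x0 * kap n + x0 * (kap (pred n) * kap 2%nat)).
    { unfold y1. eapply Rle_trans; [apply Cmod_minus_le|].
      rewrite !Cmod_mult, Cmod_opp, Cmod_pow, Cmod_R, (Rabs_pos_eq r) by lra.
      apply Rplus_le_compat.
      - apply Rmult_le_compat; [apply Rmult_le_pos; [exact Cx|apply Pr]|apply Cmod_ge_0| |apply Rk].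
        assert (U := Pr (S (S j))). nra.
      - rewrite <- Rmult_assoc. apply Rmult_le_compat; [apply Rmult_le_pos; [apply Cmod_ge_0|lra]|apply Cmod_ge_0| |apply Rk].
        assert (U := Cmod_ge_0 y2). nra. }
    assert (p1 : (RtoC r ^ S n = RtoC r * (RtoC r * (RtoC r * (RtoC r * RtoC r ^ j))))%C) by reflexivity.
    assert (p2 : (RtoC r ^ n = RtoC r * (RtoC r * (RtoC r * RtoC r ^ j)))%C) by reflexivity.
    assert (p3 : (RtoC r ^ S (S j) = RtoC r * (RtoC r * RtoC r ^ j))%C) by reflexivity.
    assert (p4 : (RtoC r ^ S j = RtoC r * RtoC r ^ j)%C) by reflexivity.
    assert (W := variation_inequality f r theta Hf Hr n y1 y2 x D m HO HD HB HM HfD F0 T0 Hn).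
    fold c in W. simpl in W.
    eapply Rle_trans; [|apply W].
    - right. f_equal.
      change (RtoC (cos theta) * (c 1%nat * RtoC r) + Ci * (x * RtoC r ^ S n * E) =
        RtoC (cos theta) * (c 1%nat * RtoC r) + Ci *
          (y1 * (RtoC (sin (INR 2 * theta)) * (c 2%nat * RtoC r ^ 2)) + y2 * (RtoC (sin (INR 3 * theta)) * (c 3%nat * RtoC r ^ 3))
            + x * (RtoC (sin (INR (S n) * theta)) * (c (S n) * RtoC r ^ S n))))%C.
      do 2 f_equal. unfold E, defect, y1, y2. change (fun k : nat => (RtoC (sin (INR k * theta)) * c k)%C) with sg. cbv zeta.
      transitivity (x * RtoC r ^ S n * (sg (S n) - sg (pred n) / sg 1%nat * sg 3%nat - sg n / sg 1%nat * sg 2%nat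
         + sg (pred n) / sg 1%nat * (sg 2%nat / sg 1%nat) * sg 2%nat))%C; [reflexivity|].
      transitivity ((- x * RtoC r ^ S (S j) * (sg n / sg 1%nat) - (- x * RtoC r ^ S j * (sg (pred n) / sg 1%nat)) * RtoC r * (sg 2%nat / sg 1%nat))
         * (RtoC r ^ 2 * sg 2%nat) + (- x * RtoC r ^ S j * (sg (pred n) / sg 1%nat)) * (RtoC r ^ 3 * sg 3%nat) + x * (RtoC r ^ S n * sg (S n)))%C.
      + rewrite p1, p3, p4. simpl Cpow. ring.
      + unfold sg. ring.
    - lra.
    - change (y1 * (RtoC (sin (INR 1 * theta)) * (c 1%nat * RtoC r ^ 1)) + y2 * (RtoC (sin (INR 2 * theta)) * (c 2%nat * RtoC r ^ 2))
         + x * (RtoC (sin (INR n * theta)) * (c n * RtoC r ^ n)) = RtoC 0)%C.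
      transitivity (y1 * (RtoC r ^ 1 * sg 1%nat) + y2 * (RtoC r ^ 2 * sg 2%nat) + x * (RtoC r ^ n * sg n))%C; [unfold sg; ring|].
      unfold y1, y2. rewrite p2, p3, p4. simpl Cpow. field. exact N1.
    - change (y2 * (RtoC (sin (INR 1 * theta)) * (c 1%nat * RtoC r ^ 1)) + x * (RtoC (sin (INR (pred n) * theta)) * (c (pred n) * RtoC r ^ S (S j))) = RtoC 0)%C.
      transitivity (y2 * (RtoC r ^ 1 * sg 1%nat) + x * (RtoC r ^ S (S j) * sg (pred n)))%C; [unfold sg; ring|].
      unfold y2. rewrite p3, p4. simpl Cpow. field. exact N1. }
  destruct (Ceq_dec E (RtoC 0)) as [Z|NE].
  { rewrite Z, Cmod_0. apply Rmult_le_pos; [left; apply Rdiv_lt_0_compat; lra|]. assert (U := COS_bound theta). lra. }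
  assert (PE := proj1 (Cmod_gt_0 _) NE).
  (* Of modulus [x0], and such that [i x E] is a positive multiple of [c 1]. *)
  set (x := (- Ci * RtoC (x0 * Cmod E / m) * (c 1%nat / E))%C).
  assert (Cx : Cmod x <= x0).
  { unfold x. rewrite !Cmod_mult, Cmod_opp, Cmod_Ci, Cmod_div, Tm, Cmod_R by exact NE.
    rewrite Rabs_pos_eq by (apply Rmult_le_pos; [apply Rmult_le_pos; lra|left; apply Rinv_0_lt_compat; lra]).
    right; field; lra. }
  assert (L : forall r, 0 < r < 1 -> cos theta * m * r + x0 * Cmod E * r ^ S n <= m).
  { intros r Hr. eapply Rle_trans; [|apply (V r x Hr Cx)].
    replace (RtoC (cos theta) * (c 1%nat * RtoC r) + Ci * (x * RtoC r ^ S n * E))%C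
      with (RtoC (cos theta * r + x0 * Cmod E / m * r ^ S n) * c 1%nat)%C.
    - rewrite Cmod_mult, Cmod_R, Tm.
      apply Rle_trans with ((cos theta * r + x0 * Cmod E / m * r ^ S n) * m).
      + right; field; lra.
      + apply Rmult_le_compat_r; [lra|apply Rle_abs].
    - unfold x. rewrite RtoC_plus, (RtoC_mult (cos theta)), (RtoC_mult (x0 * Cmod E / m)), RtoC_pow.
      transitivity (RtoC (cos theta) * (c 1%nat * RtoC r) + - (Ci * Ci) * RtoC (x0 * Cmod E / m) * c 1%nat * RtoC r ^ S n)%C.
      + replace (Ci * Ci)%C with (- RtoC 1)%C by (apply injective_projections; simpl; ring). ring.
      + field. exact NE. }
  assert (L1 := le_of_le_left_1 (fun r => cos theta * m * r + x0 * Cmod E * r ^ S n) m).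
  simpl in L1. rewrite pow1 in L1.
  assert (L2 : cos theta * m * 1 + x0 * Cmod E * (1 * 1) <= m).
  { apply L1; [|exact L]. apply continuity_pt_filterlim.
    apply (ex_derive_continuous (K := R_AbsRing) (V := R_NormedModule) (fun r : R => cos theta * m * r + x0 * Cmod E * (r * r ^ n)) 1).
    auto_derive; easy. }
  apply Rmult_le_reg_l with x0; [exact X0|].
  replace (x0 * (m / x0 * (1 - cos theta))) with (m * (1 - cos theta)) by (field; lra). lra.
Qed.

Lemma is_lim_seq_sin_quotient (k : nat) :
  is_lim_seq (fun i => sin (INR k * / INR (S i)) / (/ INR (S i))) (INR k).
Proof.
  assert (D : is_derive (fun x => sin (INR k * x)) 0 (INR k)).
  { auto_derive; [easy|]. rewrite Rmult_0_r, cos_0; ring. }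
  apply is_derive_Reals in D.
  apply is_lim_seq_spec. intros eps. destruct (D eps (cond_pos eps)) as [d Hd].
  destruct (nfloor_ex (/ d)) as [N [_ HN]]; [left; apply Rinv_0_lt_compat, cond_pos|].
  exists N. intros i Hi.
  assert (Pd := cond_pos d).
  assert (Pi : 0 < INR (S i)) by (apply lt_0_INR; lia).
  assert (H : 0 < / INR (S i)) by now apply Rinv_0_lt_compat.
  specialize (Hd (/ INR (S i)) ltac:(lra)).
  rewrite Rplus_0_l, Rmult_0_r, sin_0, Rminus_0_r in Hd. apply Hd.
  rewrite Rabs_pos_eq by lra. rewrite <- (Rinv_inv d). apply Rinv_lt_contravar.
  - apply Rmult_lt_0_compat; [now apply Rinv_0_lt_compat|exact Pi].
  - eapply Rlt_le_trans; [exact HN|]. rewrite S_INR. apply Rplus_le_compat_r, le_INR, Hi.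
Qed.

(** Times [(sin theta)^2 c_1^2 / theta^3] the defect becomes a combination of products of three
    quotients [sin(k theta) / theta], each tending to [k]. The hypothesis makes the same quantity
    [O(theta)], so the limit is 0; it is taken along [theta = 1 / (i + 1)]. *)
Lemma recurrence_of_defect (c : nat -> C) (n : nat) (K : R) : c 1%nat <> RtoC 0 ->
  (3 <= n)%nat -> 0 < K ->
  (forall theta, 0 < theta < PI -> Cmod (defect c n theta) <= K * (1 - cos theta)) ->
  let e := fun k => (RtoC (INR k) * c k)%C in
  (e 1%nat * e 1%nat * e (S n) - e 1%nat * e (pred n) * e 3%nat - e 1%nat * e n * e 2%nat
   + e (pred n) * e 2%nat * e 2%nat)%C = RtoC 0.
Proof.
  intros T1 Hn HK H e.
  set (T := fun (k i : nat) => sin (INR k * / INR (S i)) / (/ INR (S i))).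
  set (P1 := (c 1%nat * c 1%nat * c (S n))%C). set (P2 := (c 1%nat * c (pred n) * c 3%nat)%C).
  set (P3 := (c 1%nat * c n * c 2%nat)%C). set (P4 := (c (pred n) * c 2%nat * c 2%nat)%C).
  set (W := fun i => (RtoC (T 1%nat i * T 1%nat i * T (S n) i) * P1 - RtoC (T 1%nat i * T (pred n) i * T 3%nat i) * P2
    - RtoC (T 1%nat i * T n i * T 2%nat i) * P3 + RtoC (T (pred n) i * T 2%nat i * T 2%nat i) * P4)%C).
  set (Q := fun p : C -> R => INR 1 * INR 1 * INR (S n) * p P1 - INR 1 * INR (pred n) * INR 3 * p P2
    - INR 1 * INR n * INR 2 * p P3 + INR (pred n) * INR 2 * INR 2 * p P4).
  assert (HL : forall p : C -> R, is_lim_seq (fun i => T 1%nat i * T 1%nat i * T (S n) i * p P1 - T 1%nat i * T (pred n) i * T 3%nat i * p P2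
    - T 1%nat i * T n i * T 2%nat i * p P3 + T (pred n) i * T 2%nat i * T 2%nat i * p P4) (Q p)).
  { intros p. unfold Q.
    assert (LT : forall a b d (q : R), is_lim_seq (fun i => T a i * T b i * T d i * q) (INR a * INR b * INR d * q)).
    { intros a b d q. repeat apply is_lim_seq_mult'; try apply is_lim_seq_sin_quotient. apply is_lim_seq_const. }
    apply is_lim_seq_plus'; [|apply LT]. apply is_lim_seq_minus'; [|apply LT]. apply is_lim_seq_minus'; apply LT. }
  set (m := Cmod (c 1%nat)). assert (M0 : 0 <= m) by apply Cmod_ge_0.
  assert (B : forall i, Cmod (W i) <= m * m * K * / INR (S i)).
  { intros i. set (th := / INR (S i)).
    assert (Pi : 1 <= INR (S i)) by (rewrite S_INR; assert (U := pos_INR i); lra).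
    assert (Ht : 0 < th <= 1).
    { unfold th; split; [apply Rinv_0_lt_compat; lra|]. rewrite <- Rinv_1. apply Rinv_le_contravar; lra. }
    assert (HPI : 1 < PI) by (assert (X := PI2_1); lra).
    assert (St : 0 < sin th) by (apply sin_gt_0; lra).
    specialize (H th ltac:(lra)).
    assert (Tn : RtoC th <> RtoC 0) by (apply RtoC_neq_0; lra).
    assert (Sn : RtoC (sin th) <> RtoC 0) by (apply RtoC_neq_0; lra).
    assert (EW : W i = (RtoC (sin th / th) * RtoC (sin th / th) * (c 1%nat * c 1%nat) * (RtoC (/ th) * defect c n th))%C).
    { unfold W, T, defect, P1, P2, P3, P4. fold th. simpl (INR 1). rewrite !Rmult_1_l.
      rewrite !RtoC_mult. unfold Rdiv. rewrite !RtoC_mult, !RtoC_inv by lra.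
      field. repeat split; assumption. }
    rewrite EW, !Cmod_mult, !Cmod_R. fold m.
    assert (S1 : Rabs (sin th / th) <= 1).
    { rewrite Rabs_pos_eq by (apply Rmult_le_pos; [lra|left; apply Rinv_0_lt_compat; lra]).
      apply Rmult_le_reg_r with th; [lra|]. unfold Rdiv; rewrite Rmult_assoc, Rinv_l by lra.
      assert (U := sin_lt_x th ltac:(lra)). lra. }
    assert (S2 : Rabs (/ th) * Cmod (defect c n th) <= K * th).
    { rewrite Rabs_pos_eq by (left; apply Rinv_0_lt_compat; lra).
      apply Rle_trans with (/ th * (K * (th ^ 2 / 2))).
      - apply Rmult_le_compat_l; [left; apply Rinv_0_lt_compat; lra|].
        eapply Rle_trans; [exact H|]. apply Rmult_le_compat_l; [lra|apply one_minus_cos_le].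
      - replace (/ th * (K * (th ^ 2 / 2))) with (K * th / 2) by (field; lra).
        assert (0 < K * th) by (apply Rmult_lt_0_compat; lra). lra. }
    replace (m * m * K * th) with (1 * 1 * (m * m) * (K * th)) by ring.
    assert (A0 := Rabs_pos (sin th / th)).
    apply Rmult_le_compat; [|apply Rmult_le_pos; [apply Rabs_pos|apply Cmod_ge_0]| |exact S2].
    - repeat apply Rmult_le_pos; assumption.
    - apply Rmult_le_compat_r; [now apply Rmult_le_pos|]. apply Rmult_le_compat; assumption. }
  (* Limits are taken for the real and the imaginary part separately: [p] will be [fst] and
     [snd]. *)
  assert (Z : forall p : C -> R, (forall z, Rabs (p z) <= Cmod z) ->
     (forall i, p (W i) = T 1%nat i * T 1%nat i * T (S n) i * p P1 - T 1%nat i * T (pred n) i * T 3%nat i * p P2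
    - T 1%nat i * T n i * T 2%nat i * p P3 + T (pred n) i * T 2%nat i * T 2%nat i * p P4) -> Q p = 0).
  { intros p Hp Hw.
    assert (L0 : is_lim_seq (fun i => p (W i)) 0).
    { apply is_lim_seq_abs_0. apply is_lim_seq_le_le with (u := fun _ => 0) (w := fun i => m * m * K * / INR (S i)).
      - intros i; split; [apply Rabs_pos|]. eapply Rle_trans; [apply Hp|apply B].
      - apply is_lim_seq_const.
      - replace (Finite 0) with (Rbar_mult (m * m * K) 0) by (simpl; now rewrite Rmult_0_r).
        apply is_lim_seq_scal_l. replace (Finite 0) with (Rbar_inv p_infty) by reflexivity.
        apply is_lim_seq_inv; [|easy]. apply -> (is_lim_seq_incr_1 INR). apply is_lim_seq_INR. }
    apply (is_lim_seq_ext _ _ _ Hw) in L0.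
    assert (U := is_lim_seq_unique _ _ (HL p)). rewrite (is_lim_seq_unique _ _ L0) in U. now injection U. }
  assert (Z1 := Z fst Rabs_fst_le ltac:(intros i; unfold W; simpl; ring)).
  assert (Z2 := Z snd Rabs_snd_le ltac:(intros i; unfold W; simpl; ring)).
  transitivity (RtoC (INR 1 * INR 1 * INR (S n)) * P1 - RtoC (INR 1 * INR (pred n) * INR 3) * P2
    - RtoC (INR 1 * INR n * INR 2) * P3 + RtoC (INR (pred n) * INR 2 * INR 2) * P4)%C.
  - unfold e, P1, P2, P3, P4. rewrite !RtoC_mult. ring.
  - apply injective_projections.
    + transitivity (Q fst); [unfold Q; generalize (INR 1) (INR 2) (INR 3) (INR n) (INR (S n)) (INR (pred n)); intros; simpl; ring|exact Z1].
    + transitivity (Q snd); [unfold Q; generalize (INR 1) (INR 2) (INR 3) (INR n) (INR (S n)) (INR (pred n)); intros; simpl; ring|exact Z2].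
Qed.

(** * Location of the zeros and conclusion *)

Lemma Csqrt_exists (z : C) : exists w : C, (w * w)%C = z.
Proof.
  destruct (polar z) as [t Ht].
  exists (RtoC (sqrt (Cmod z)) * cis (t / 2))%C.
  transitivity (RtoC (sqrt (Cmod z) * sqrt (Cmod z)) * (cis (t / 2) * cis (t / 2)))%C.
  - rewrite RtoC_mult; ring.
  - rewrite sqrt_sqrt by apply Cmod_ge_0. rewrite <- cis_plus. replace (t / 2 + t / 2) with t by field. now symmetry.
Qed.

(** [b1], [b2] are the roots of [t^2 + a t + lam], so [1 + a z + lam z^2 = (1 - b1 z)(1 - b2 z)].
    Using reciprocals of zeros avoids separate cases when the degree drops. *)
Lemma quadratic_factorisation (a lam : C) : exists b1 b2 : C, a = (- (b1 + b2))%C /\ lam = (b1 * b2)%C.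
Proof.
  destruct (Csqrt_exists (a * a - RtoC 4 * lam)%C) as [w Hw].
  assert (N2 : RtoC 2 <> RtoC 0) by (apply RtoC_neq_0; lra).
  exists ((- a + w) / RtoC 2)%C, ((- a - w) / RtoC 2)%C. split.
  - now field.
  - replace ((- a + w) / RtoC 2 * ((- a - w) / RtoC 2))%C with ((a * a - w * w) / (RtoC 2 * RtoC 2))%C by now field.
    rewrite Hw, <- RtoC_mult. replace (2 * 2) with 4 by ring. now field.
Qed.

(** [a - conj(a) lam = -(b1 (1 - |b2|^2) + b2 (1 - |b1|^2))]. With [x = |b1|], [y = |b2|] the claim
    reduces to [(1 - x)(1 - y)(1 - x y) > 0]. *)
Lemma schur_cohn (b1 b2 : C) : Cmod b1 < 1 -> Cmod b2 < 1 ->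
  let a := (- (b1 + b2))%C in let lam := (b1 * b2)%C in
  Cmod lam < 1 /\ Cmod (a - Cconj a * lam) < 1 - Cmod lam ^ 2.
Proof.
  intros H1 H2 a lam. assert (P1 := Cmod_ge_0 b1). assert (P2 := Cmod_ge_0 b2).
  unfold lam. rewrite Cmod_mult. split; [nra|].
  replace (a - Cconj a * (b1 * b2))%C with (- (b1 * RtoC (1 - Cmod b2 ^ 2) + b2 * RtoC (1 - Cmod b1 ^ 2)))%C.
  - rewrite Cmod_opp. eapply Rle_lt_trans; [apply Cmod_triangle|].
    rewrite !Cmod_mult, !Cmod_R, !Rabs_pos_eq by nra.
    set (x := Cmod b1) in *. set (y := Cmod b2) in *.
    assert (0 < (1 - x) * (1 - y) * (1 - x * y)) by (repeat apply Rmult_lt_0_compat; nra). nra.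
  - unfold a. rewrite !RtoC_minus, !Cmod2_conj, Copp_conj, Cplus_conj. ring.
Qed.

(** The map [1 / (1 - v)] sends the unit disk onto the half-plane [Re > 1/2]. It shows that the
    second factor cannot cancel the logarithmic growth below. *)
Lemma Re_inv_ge_half (v : C) : Cmod v < 1 -> 1 / 2 <= fst (/ (RtoC 1 - v))%C.
Proof.
  intros Hv.
  assert (A := Cmod2_alt v). unfold Re, Im in A.
  assert (V0 := Cmod_ge_0 v). assert (Cmod v ^ 2 < 1) by nra.
  destruct v as [x y]; simpl in *.
  assert (P : 0 < (1 + - x) * ((1 + - x) * 1) + (0 + - y) * ((0 + - y) * 1)) by nra.
  apply Rmult_le_reg_r with ((1 + - x) * ((1 + - x) * 1) + (0 + - y) * ((0 + - y) * 1)); [exact P|].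
  unfold Rdiv. rewrite (Rmult_assoc (1 + - x)), Rinv_l by lra. nra.
Qed.

(* On the radius ending at the zero [/ b1] the function grows at least like a logarithm. *)
Lemma no_zero_on_circle (f : C -> C) (M : R) (e b1 b2 : C) :
  (forall w, unit_disk w -> Cmod (f w) <= M) -> e <> RtoC 0 ->
  (forall z, unit_disk z -> cderiv f z (e / ((RtoC 1 - b1 * z) * (RtoC 1 - b2 * z))))%C ->
  Cmod b1 = 1 -> Cmod b2 <= 1 -> False.
Proof.
  intros HM He Hd H1 H2.
  set (z0 := Cconj b1).
  assert (Bz : (b1 * z0)%C = RtoC 1) by (unfold z0; rewrite <- Cmod2_conj, H1; f_equal; ring).
  assert (Z0 : Cmod z0 = 1) by (unfold z0; now rewrite Cmod_conj).
  assert (NZ : z0 <> RtoC 0) by (apply Cmod_gt_0; lra).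
  set (be := (b2 * z0)%C). assert (Hbe : Cmod be <= 1) by (unfold be; rewrite Cmod_mult, Z0; lra).
  (* Rotated and normalised so that along the real radius the derivative is
     [1 / ((1 - s)(1 - s be))]. *)
  set (F := fun w => (/ (e * z0) * f (z0 * w))%C).
  assert (NE : (e * z0)%C <> RtoC 0) by now apply Cmult_neq_0.
  set (psi := fun s => fst (F (RtoC s))).
  assert (Dpsi : forall s, 0 <= s < 1 -> is_derive psi s (/ (1 - s) * fst (/ (RtoC 1 - RtoC s * be))%C)).
  { intros s Hs.
    assert (U : unit_disk (z0 * RtoC s)%C) by (unfold unit_disk; rewrite Cmod_mult, Z0, Cmod_R, Rabs_pos_eq; lra).
    assert (N1 : RtoC (1 - s) <> RtoC 0) by (apply RtoC_neq_0; lra).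
    assert (N2 : (RtoC 1 - RtoC s * be)%C <> RtoC 0).
    { apply Cmod_gt_0. assert (X := Cmod_triangle_rev (RtoC 1) (RtoC s * be)).
      rewrite Cmod_1, Cmod_mult, Cmod_R, Rabs_pos_eq in X by lra. nra. }
    assert (DF : cderiv F (RtoC s) (RtoC (/ (1 - s)) * / (RtoC 1 - RtoC s * be))%C).
    { replace (RtoC (/ (1 - s)) * / (RtoC 1 - RtoC s * be))%C with
        (RtoC 0 * f (z0 * RtoC s) + / (e * z0) * (e / ((RtoC 1 - b1 * (z0 * RtoC s)) * (RtoC 1 - b2 * (z0 * RtoC s))) * (RtoC 0 * RtoC s + z0 * RtoC 1)))%C.
      - apply (cderiv_mult (fun _ => / (e * z0))%C (fun w => f (z0 * w))%C); [apply cderiv_const|].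
        apply (cderiv_comp f (fun w => z0 * w)%C); [|apply Hd, U].
        apply (cderiv_mult (fun _ => z0) (fun w => w)); [apply cderiv_const|apply cderiv_id].
      - replace (RtoC 1 - b1 * (z0 * RtoC s))%C with (RtoC (1 - s)) by (rewrite RtoC_minus, <- (Cmult_1_l (RtoC s)) at 1; rewrite <- Bz; ring).
        replace (RtoC 1 - b2 * (z0 * RtoC s))%C with (RtoC 1 - RtoC s * be)%C by (unfold be; ring).
        rewrite RtoC_inv by lra. field. repeat split; assumption. }
    apply cderiv_is_derive_x in DF. simpl (fst (RtoC s)) in DF.
    replace (/ (1 - s) * fst (/ (RtoC 1 - RtoC s * be))%C) with (fst (RtoC (/ (1 - s)) * / (RtoC 1 - RtoC s * be))%C) by (simpl; ring).
    exact DF. }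
  set (B := M / Cmod e).
  assert (Pe := proj1 (Cmod_gt_0 e) He).
  assert (Bpsi : forall s, 0 <= s < 1 -> Rabs (psi s) <= B).
  { intros s Hs. unfold psi. eapply Rle_trans; [apply Rabs_fst_le|]. unfold F.
    rewrite Cmod_mult, Cmod_inv, Cmod_mult, Z0, Rmult_1_r by exact NE.
    unfold B, Rdiv. rewrite Rmult_comm. apply Rmult_le_compat_r; [left; now apply Rinv_0_lt_compat|].
    apply HM. unfold unit_disk. rewrite Cmod_mult, Z0, Cmod_R, Rabs_pos_eq; lra. }
  (* [psi x + ln (1 - x) / 2] is nondecreasing while [psi] is bounded by [B]; evaluate at a point
     [s] so close to 1 that the logarithm wins. *)
  set (s := 1 - exp (- (4 * B + 1))).
  assert (B0 : 0 <= B) by (eapply Rle_trans; [apply Rabs_pos|apply (Bpsi 0); lra]).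
  assert (E0 := exp_pos (- (4 * B + 1))).
  assert (E1 : exp (- (4 * B + 1)) < 1)
    by (apply Rlt_le_trans with (exp 0); [apply exp_increasing; lra|rewrite exp_0; lra]).
  assert (Hs : 0 < s < 1) by (unfold s; lra).
  destruct (MVT_gen (fun x => psi x + ln (1 - x) / 2) 0 s
     (fun x => / (1 - x) * fst (/ (RtoC 1 - RtoC x * be))%C - / (1 - x) / 2)) as [x [Hx Ex]].
  - intros x Hx. rewrite Rmin_left, Rmax_right in Hx by lra.
    apply (is_derive_plus (K := R_AbsRing) (V := R_NormedModule) psi (fun x => ln (1 - x) / 2)); [apply Dpsi; lra|].
    auto_derive; [lra|field; lra].
  - intros x Hx. rewrite Rmin_left, Rmax_right in Hx by lra.
    apply continuity_pt_filterlim.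
    apply (ex_derive_continuous (K := R_AbsRing) (V := R_NormedModule) (fun x => psi x + ln (1 - x) / 2)).
    apply (ex_derive_plus (K := R_AbsRing) (V := R_NormedModule) psi (fun x => ln (1 - x) / 2)).
    + eexists; apply Dpsi; lra.
    + auto_derive; lra.
  - rewrite Rmin_left, Rmax_right in Hx by lra.
    assert (Hre : 1 / 2 <= fst (/ (RtoC 1 - RtoC x * be))%C).
    { apply Re_inv_ge_half. rewrite Cmod_mult, Cmod_R, Rabs_pos_eq by lra. nra. }
    assert (Ix : 0 < / (1 - x)) by (apply Rinv_0_lt_compat; lra).
    assert (G : 0 <= (/ (1 - x) * fst (/ (RtoC 1 - RtoC x * be))%C - / (1 - x) / 2) * (s - 0)).
    { apply Rmult_le_pos; [|lra]. nra. }
    rewrite <- Ex in G. rewrite Rminus_0_r, ln_1 in G.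
    replace (1 - s) with (exp (- (4 * B + 1))) in G by (unfold s; ring). rewrite ln_exp in G.
    (* Monotonicity gives [psi s - psi 0 >= (4 B + 1) / 2], more than the [2 B] that the bound on
       [psi] permits. *)
    assert (Q1 := Bpsi s ltac:(lra)). assert (Q2 := Bpsi 0 ltac:(lra)).
    assert (Q3 := Rle_abs (psi s)). assert (Q4 := Rle_abs (- psi 0)). rewrite Rabs_Ropp in Q4. lra.
Qed.

Theorem theorem1p2 (D : C -> Prop) (Phi : C -> C) :
  is_domain D -> bounded_set D -> convex_set D ->
  biholomorphic unit_disk D Phi -> Phi (RtoC 0) = RtoC 0 ->
  (exists d : C, is_derive (K := C_AbsRing) (V := C_NormedModule) Phi (RtoC 0) d /\
     Finite (Cmod d) = M_D D (RtoC 0)) ->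
  exists (theta c : R) (a lam : C),
    0 < c /\ Cmod lam < 1 /\
    Cmod (Cminus a (Cmult (Cconj a) lam)) < 1 - Cmod lam ^ 2 /\
    let F := fun z => Cmult (cos theta, sin theta) (Phi z) in
    F (RtoC 0) = RtoC 0 /\
    forall z, unit_disk z ->
      is_derive (K := C_AbsRing) (V := C_NormedModule) F z
        (Cdiv (RtoC c) (Cplus (Cplus (RtoC 1) (Cmult a z)) (Cmult lam (Cmult z z)))).
Proof.
  intros [_ [HO _]] HB HC [Hh [Hmap [g [Hg [Hgm [gf fg]]]]]] Phi0 [d [Hd HM]].
  assert (U0 : unit_disk (RtoC 0)) by (unfold unit_disk; rewrite Cmod_0; lra).
  assert (Hf : holo Phi).
  { intros z Hz. destruct (Hh z Hz) as [l Hl]. exists l. now apply is_derive_cderiv. }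
  assert (HBd := HB). destruct HB as [M HM'].
  assert (HfM : forall z, unit_disk z -> Cmod (Phi z) <= M) by (intros; apply HM'; auto).
  apply is_derive_cderiv in Hd.
  (* The chain rule for [g (Phi z) = z] at 0 exhibits [d] as a factor of 1. *)
  assert (Nd : d <> RtoC 0).
  { intros Z. destruct (Hg (Phi (RtoC 0)) (Hmap _ U0)) as [l Hl]. apply is_derive_cderiv in Hl.
    assert (H1 := cderiv_comp g Phi _ _ _ Hd Hl).
    apply (cderiv_ext_loc _ (fun z => z) _ _ 1 Rlt_0_1) in H1.
    - assert (H2 := cderiv_unique _ _ _ _ H1 (cderiv_id (RtoC 0))).
      rewrite Z, Cmult_0_r in H2. apply C1_nz. now symmetry.
    - intros w Hw. apply gf. unfold unit_disk. replace w with (w - RtoC 0)%C by ring. exact Hw. }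
  assert (T0 : tcoef Phi 0 = RtoC 0) by (rewrite (tcoef_0 Phi M); auto).
  assert (T1 : tcoef Phi 1 = d) by (apply (tcoef_1 Phi M); auto).
  set (e := dcoef (tcoef Phi)).
  assert (E0 : e O = d) by (unfold e, dcoef; rewrite T1; simpl; ring).
  assert (N0 : e O <> RtoC 0) by now rewrite E0.
  set (a := (- (e 1%nat / e O))%C).
  set (lam := (e 1%nat * e 1%nat / (e O * e O) - e 2%nat / e O)%C).
  assert (R1 : (e 1%nat + a * e O)%C = RtoC 0) by (unfold a; field; exact N0).
  assert (Rn : forall n, (e (S (S n)) + a * e (S n) + lam * e n)%C = RtoC 0).
  { intros [|k].
    - unfold a, lam. field. exact N0.
    (* [a] and [lam] are defined so that the first two relations hold; the variation of frequency
       [k + 3] supplies the others. Indices shift by one, as [e k] is [k + 1] times the Taylor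
       coefficient of index [k + 1]. *)
    - destruct (defect_inequality Phi D (Cmod d) (S (S (S k)))) as [K [HK HKd]]; auto.
      + now rewrite T1.
      + now rewrite T1.
      + lia.
      + assert (X := recurrence_of_defect (tcoef Phi) (S (S (S k))) K ltac:(now rewrite T1) ltac:(lia) HK HKd).
        change (e O * e O * e (S (S (S k))) - e O * e (S k) * e 2%nat - e O * e (S (S k)) * e 1%nat
          + e (S k) * e 1%nat * e 1%nat = RtoC 0)%C in X.
        transitivity ((e O * e O * e (S (S (S k))) - e O * e (S k) * e 2%nat - e O * e (S (S k)) * e 1%nat
          + e (S k) * e 1%nat * e 1%nat) / (e O * e O))%C.
        * unfold a, lam. field. exact N0.
        * rewrite X. field. exact N0. }
  assert (Q : forall z l, unit_disk z -> cderiv Phi z l -> ((RtoC 1 + a * z + lam * (z * z)) * l)%C = d).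
  { intros z l Hz Hl. rewrite <- E0. now apply (derivative_of_recurrence Phi M a lam z l). }
  destruct (quadratic_factorisation a lam) as [b1 [b2 [Ea El]]].
  assert (Qf : forall z, (RtoC 1 + a * z + lam * (z * z))%C = ((RtoC 1 - b1 * z) * (RtoC 1 - b2 * z))%C)
    by (intros z; rewrite Ea, El; ring).
  assert (Qn : forall z, unit_disk z -> (RtoC 1 + a * z + lam * (z * z))%C <> RtoC 0).
  (* At a zero of the quadratic in the disk the identity [Q] would give [d = 0], because [Phi] has a
     finite derivative there. *)
  { intros z Hz Z. destruct (Hf z Hz) as [l Hl]. apply Nd. rewrite <- (Q z l Hz Hl), Z. ring. }
  assert (Dp : forall z, unit_disk z -> cderiv Phi z (d / (RtoC 1 + a * z + lam * (z * z)))%C).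
  { intros z Hz. destruct (Hf z Hz) as [l Hl].
    replace (d / (RtoC 1 + a * z + lam * (z * z)))%C with l; [exact Hl|].
    rewrite <- (Q z l Hz Hl). field. now apply Qn. }
  assert (Hroot : forall b b', (forall z, (RtoC 1 + a * z + lam * (z * z))%C = ((RtoC 1 - b * z) * (RtoC 1 - b' * z))%C) -> Cmod b <= 1).
  { intros b b' Hb. apply Rnot_lt_le. intros Hgt.
    assert (Nb : b <> RtoC 0) by (apply Cmod_gt_0; lra).
    apply (Qn (/ b)%C).
    - unfold unit_disk. rewrite Cmod_inv by exact Nb. rewrite <- Rinv_1. apply Rinv_lt_contravar; lra.
    - rewrite Hb, Cinv_r by exact Nb. ring. }
  assert (Qf' : forall z, (RtoC 1 + a * z + lam * (z * z))%C = ((RtoC 1 - b2 * z) * (RtoC 1 - b1 * z))%C)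
    by (intros z; rewrite Qf; ring).
  assert (B1 := Hroot b1 b2 Qf). assert (B2 := Hroot b2 b1 Qf').
  assert (S1 : Cmod b1 < 1).
  { destruct B1 as [|B1]; [assumption|exfalso].
    apply (no_zero_on_circle Phi M d b1 b2); auto. intros z Hz. rewrite <- Qf. now apply Dp. }
  assert (S2 : Cmod b2 < 1).
  { destruct B2 as [|B2]; [assumption|exfalso].
    apply (no_zero_on_circle Phi M d b2 b1); auto. intros z Hz. rewrite <- Qf'. now apply Dp. }
  destruct (schur_cohn b1 b2 S1 S2) as [L1 L2]. rewrite <- El in L1. rewrite <- Ea, <- El in L2.
  destruct (polar d) as [t Ht].
  (* The rotation by [- t] turns [d] into its modulus, which is the constant [c]. *)
  exists (- t), (Cmod d), a, lam.
  split; [now apply Cmod_gt_0|]. split; [exact L1|]. split; [exact L2|]. split.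
  - rewrite Phi0. apply Cmult_0_r.
  - intros z Hz. apply is_derive_cderiv.
    change (cos (- t), sin (- t)) with (cis (- t)).
    replace (RtoC (Cmod d) / (RtoC 1 + a * z + lam * (z * z)))%C
      with (RtoC 0 * Phi z + cis (- t) * (d / (RtoC 1 + a * z + lam * (z * z))))%C.
    + apply (cderiv_mult (fun _ => cis (- t)) Phi); [apply cderiv_const|now apply Dp].
    + rewrite Ht at 1. rewrite <- cis_conj_inv. field. split; [now apply Qn|apply cis_neq_0].
Qed.
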